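(* Let $n\ge 1$, $\mathcal{T}>0$, and consider the stochastic system on $\mathbb{R}^n\times\mathbb{R}^n$ $$dx_t=y_t\,dt,\qquad dy_t=-\big[D^2F(x_t)\,y_t+\nabla_xV(x_t,t)+E(x_t,y_t,t)\big]\,dt+\Sigma(x_t,y_t,t)\,dB_t,$$ where $B_t$ is an $n$-dimensional Brownian motion, $F:\mathbb{R}^n\to\mathbb{R}$, $V:\mathbb{R}^n\times\mathbb{R}\to\mathbb{R}$, $E:\mathbb{R}^n\times\mathbb{R}^n\times\mathbb{R}\to\mathbb{R}^n$ and $\Sigma:\mathbb{R}^n\times\mathbb{R}^n\times\mathbb{R}\to\mathbb{R}^{n\times n}$. Assume that there exist positive constants $a,b,M,m,c_1,c_2,M_1,M_2$ with $c_1+c_2<1$, and a constant $e\ge 0$, such that all of the following hold: (1) All coefficients of the system (that is, $D^2F$, $\nabla_xV$, $E$, $\Sigma$) are continuous on their respective domains and locally Lipschitz continuous in $(x,y)$; $F\in C^2(\mathbb{R}^n)$; $V\in C^{2,1}_{\mathcal T}(\mathbb{R}^n\times\mathbb{R})$; $E(x,y,t)$ and $\Sigma(x,y,t)$ are $\mathcal{T}$-periodic in $t$; and $V$ is bounded from below. (2) $$\lim_{\|x\|\to+\infty}\Big[V(x,t)+aF(x)-\frac{a^2}{2}\|x\|^2\Big]=+\infty\quad\text{uniformly in }t\in\mathbb{R}.$$ (3) $$-\langle\nabla_xV(x,t),\nabla F(x)-ax\rangle\le M-b\|x\|^{2m}\qquad\forall (x,t)\in\mathbb{R}^n\times\mathbb{R}.$$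 (4) $E$ is bounded by $e$, i.e. $\|E(x,y,t)\|\le e$ for all $(x,y,t)$, and $$\lim_{\|x\|\to+\infty}\frac{e\,\|\nabla F(x)-ax\|}{\|x\|^{2m}}=0.$$ (5) $$|V_t(x,t)|\le c_1b\|x\|^{2m}+M_1\qquad\forall (x,t)\in\mathbb{R}^n\times\mathbb{R},$$ $$\mathrm{Tr}\big[(\Sigma\Sigma^{\top})(x,y,t)\big]\le 2c_2\big(a\|y\|^2+b\|x\|^{2m}\big)+M_2\qquad\forall (x,y,t)\in\mathbb{R}^n\times\mathbb{R}^n\times\mathbb{R}.$$ Then the system admits at least one $\mathcal{T}$-periodic probability solution.
   Context: $\|\cdot\|$ and $\langle\cdot,\cdot\rangle$ are the Euclidean norm and inner product; $D^2F$ is the Hessian matrix of $F$; $V_t=\partial_tV$. $C^{2,1}_{\mathcal T}(\mathbb{R}^n\times\mathbb{R})$ is the space of functions $f(x,t)$ that are $C^2$ in $x$, $C^1$ in $t$ (with continuous derivatives) and satisfy $f(x,t+\mathcal T)=f(x,t)$ for all $(x,t)$. Periodic probability solution. For a $\mathcal T$-periodic stochastic differential equation $dZ_t=b(Z_t,t)\,dt+\sigma(Z_t,t)\,dB_t$ on $\mathbb{R}^N$, put $(a^{ij})=\frac12\sigma\sigma^{\top}$ and $\mathcal{L}\phi=\partial_t\phi+\sum_{i,j}a^{ij}\partial_{z_iz_j}\phi+\sum_ib^i\partial_{z_i}\phi$. A $\mathcal T$-periodic probability solution of the equation (equivalently, of its Fokker-Planck equation $-\partial_tp+\partial^2_{ij}(a^{ij}p)-\partial_i(b^ip)=0$)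 is a Borel measure $\mu$ on $\mathbb{R}^N\times\mathbb{R}$ of the form $d\mu=d\mu_t\,dt$, where $\{\mu_t\}_{t\in\mathbb{R}}$ is a family of Borel probability measures on $\mathbb{R}^N$ such that $\mu_t=\mu_{t+\mathcal T}$ for all $t\in\mathbb{R}$, $a^{ij},b^i\in L^1_{\rm loc}(\mathbb{R}^N\times\mathbb{R},d\mu_t\,dt)$ for all $i,j$, and $$\int_{\mathbb{R}}\int_{\mathbb{R}^N}\mathcal{L}\phi\,d\mu_t\,dt=0\qquad\forall\phi\in C_0^{2,1}(\mathbb{R}^N\times\mathbb{R}),$$ where $C_0^{2,1}$ denotes the compactly supported functions that are $C^2$ in $z$ and $C^1$ in $t$. For the system in the claim, $N=2n$, $z=(x,y)$, and $$\mathcal{L}\phi=\partial_t\phi+\tfrac12\sum_{i,j=1}^n(\Sigma\Sigma^\top)^{ij}\partial^2_{y_iy_j}\phi+\langle y,\nabla_x\phi\rangle-\langle D^2F(x)y+\nabla_xV(x,t)+E(x,y,t),\nabla_y\phi\rangle.$$ *)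

(* Defs.v *)
From HB Require Import structures.
From mathcomp Require Import all_boot all_order all_algebra.
From mathcomp Require Import all_classical all_reals all_analysis.

Set Implicit Arguments.
Unset Strict Implicit.
Unset Printing Implicit Defensive.
Import Order.TTheory GRing.Theory Num.Theory.
Import numFieldNormedType.Exports.
Local Open Scope classical_set_scope.
Local Open Scope ring_scope.

(* Vectors of R^n are row vectors.  The norm `|x| that the library puts on
   'rV[R]_n is the sup norm, so the Euclidean structure is defined here; the
   library's topology is the usual one. *)
Definition dotv (R : realType) (n : nat) (u v : 'rV[R]_n) : R :=
  \sum_(i < n) u 0 i * v 0 i.

Definition enorm (R : realType) (n : nat) (u : 'rV[R]_n) : R :=
  Num.sqrt (dotv u u).

(* The filter of "||x|| -> +oo" on R^n. *)
Definition enorm_infty (R : realType) (n : nat) : set_system 'rV[R]_n :=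
  filter_from [set: R] (fun r => [set x | r < enorm x]).

Definition partial (R : realType) (n : nat) (i : 'I_n) (f : 'rV[R]_n -> R) :
  'rV[R]_n -> R := 'D_(delta_mx 0 i) f.

Definition grad (R : realType) (n : nat) (f : 'rV[R]_n -> R) (x : 'rV[R]_n) :
  'rV[R]_n := \row_i partial i f x.

Definition hessian (R : realType) (n : nat) (f : 'rV[R]_n -> R)
  (x : 'rV[R]_n) : 'M[R]_n := \matrix_(i, j) partial i (partial j f) x.

(* Library derivatives are total functions, so existence is stated apart. *)
Definition C1 (R : realType) (n : nat) (f : 'rV[R]_n -> R) : Prop :=
  forall i : 'I_n, (forall x, derivable f x (delta_mx 0 i)) /\
                   continuous (partial i f).

Definition C2 (R : realType) (n : nat) (f : 'rV[R]_n -> R) : Prop :=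
  C1 f /\ forall i : 'I_n, C1 (partial i f).

(* f, its x-derivatives of order <= 2 and its t-derivative exist and are
   jointly continuous in (x, t). *)
Definition C21 (R : realType) (n : nat) (f : 'rV[R]_n -> R -> R) : Prop :=
  [/\ continuous (fun p : 'rV[R]_n * R => f p.1 p.2),
      forall i : 'I_n,
        (forall x t, derivable (f ^~ t) x (delta_mx 0 i)) /\
        continuous (fun p : 'rV[R]_n * R => partial i (f ^~ p.2) p.1),
      forall i j : 'I_n,
        (forall x t, derivable (partial j (f ^~ t)) x (delta_mx 0 i)) /\
        continuous
          (fun p : 'rV[R]_n * R => partial i (partial j (f ^~ p.2)) p.1)
    & (forall x t, derivable (f x) t 1) /\
      continuous (fun p : 'rV[R]_n * R => derive1 (f p.1) p.2)].

Definition C21_periodic (R : realType) (n : nat) (T : R)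
  (f : 'rV[R]_n -> R -> R) : Prop :=
  C21 f /\ forall x t, f x (t + T) = f x t.

Definition C21_compact (R : realType) (n : nat) (f : 'rV[R]_n -> R -> R) :
  Prop :=
  C21 f /\ exists K : set ('rV[R]_n * R),
    compact K /\ forall x t, ~ K (x, t) -> f x t = 0.

(* Locally Lipschitz in the space variable z, with a constant that is locally
   uniform in t. *)
Definition locally_lipschitz (R : realType) (U W : normedModType R)
  (f : U -> R -> W) : Prop :=
  forall (z : U) (t : R), exists (A : set U) (B : set R) (k : R),
    [/\ nbhs z A, nbhs t B & forall s, B s -> k.-lipschitz_A (f ^~ s)].

(* R^N with its Borel sigma-algebra. *)
Definition borel (R : realType) (N : nat) : measurableType _ :=
  g_sigma_algebraType (@open 'rV[R]_N).

(* The stochastic differential equation dZ = b(Z,t) dt + sigma(Z,t) dB on R^N,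
   B a k-dimensional Brownian motion, enters through b and sigma only. *)
Definition diffusion_coef (R : realType) (N k : nat)
  (sigma : 'rV[R]_N -> R -> 'M[R]_(N, k)) (z : 'rV[R]_N) (t : R) : 'M[R]_N :=
  2^-1 *: (sigma z t *m (sigma z t)^T).

Definition generator (R : realType) (N k : nat)
  (b : 'rV[R]_N -> R -> 'rV[R]_N) (sigma : 'rV[R]_N -> R -> 'M[R]_(N, k))
  (phi : 'rV[R]_N -> R -> R) (z : 'rV[R]_N) (t : R) : R :=
  derive1 (phi z) t
  + \sum_(i < N) \sum_(j < N)
      diffusion_coef sigma z t i j * partial i (partial j (phi ^~ t)) z
  + \sum_(i < N) b z t 0 i * partial i (phi ^~ t) z.

(* mu lives on the product sigma-algebra of R^N x R, which is its Borel
   sigma-algebra as both factors are second countable.  The family (mu_t) is a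
   probability kernel: t |-> mu_t(A) has to be measurable for d mu_t dt to
   make sense. *)
Definition periodic_probability_solution (R : realType) (N k : nat) (T : R)
  (b : 'rV[R]_N -> R -> 'rV[R]_N) (sigma : 'rV[R]_N -> R -> 'M[R]_(N, k))
  (mu : {measure set (borel R N * measurableTypeR R)%type -> \bar R}) : Prop :=
  exists mut : R.-pker (measurableTypeR R) ~> (borel R N),
  [/\ forall A, measurable A ->
        mu A = (\int[lebesgue_measure]_t mut t (ysection A t))%E,
      forall t (A : set (borel R N)), measurable A -> mut t A = mut (t + T) A,
      forall K : set ('rV[R]_N * R), compact K ->
        (forall i j : 'I_N, mu.-integrable K
           (fun p => (diffusion_coef sigma p.1 p.2 i j)%:E)) /\
        (forall i : 'I_N, mu.-integrable K (fun p => (b p.1 p.2 0 i)%:E))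
    & forall phi : 'rV[R]_N -> R -> R, C21_compact phi ->
        (\int[lebesgue_measure]_t \int[mut t]_z
           (generator b sigma phi z t)%:E = 0)%E].

(* The system dx = y dt, dy = -(D^2F(x) y + grad_x V(x,t) + E(x,y,t)) dt
   + Sigma(x,y,t) dB, with z = (x, y) encoded as row_mx x y. *)
Definition system_drift (R : realType) (n : nat) (F : 'rV[R]_n -> R)
  (V : 'rV[R]_n -> R -> R) (E : 'rV[R]_n -> 'rV[R]_n -> R -> 'rV[R]_n)
  (z : 'rV[R]_(n + n)) (t : R) : 'rV[R]_(n + n) :=
  let x := lsubmx z in let y := rsubmx z in
  row_mx y (- ((hessian F x *m y^T)^T + grad (V ^~ t) x + E x y t)).

Definition system_diffusion (R : realType) (n : nat)
  (Sigma : 'rV[R]_n -> 'rV[R]_n -> R -> 'M[R]_n)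
  (z : 'rV[R]_(n + n)) (t : R) : 'M[R]_(n + n, n) :=
  col_mx 0 (Sigma (lsubmx z) (rsubmx z) t).

(* Main.v *)
(* Write L for the operator of the equation (time derivative included) and
   U(x,y,t) = |y + grad F(x) - a x|^2 / 2 + V(x,t) + a F(x) - a^2 |x|^2 / 2.
   The Hessian terms cancel in L U, and the hypotheses give L U <= C - W with U
   and W coercive.  No equation has to be solved: perturbing a T-periodic test
   function u by a small multiple of U makes it attain an extremum, where L u
   has a sign, so Hahn-Banach yields a finitely additive probability on space
   times one period that annihilates every L u.  The bound on L U makes it tight,
   and the Riesz construction turns it into a measure.  Testing with functions of
   time alone shows that its time marginal is uniform; disintegrating along time
   and extending periodically gives the family mu_t.  A compactly supported phi
   becomes an admissible periodic test function by summing its translates by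
   multiples of T. *)
Require Import Defs.
From HB Require Import structures.
From mathcomp Require Import all_boot all_order all_algebra.
From mathcomp Require Import all_classical all_reals all_analysis.
From mathcomp Require Import measurable_realfun.
From mathcomp Require Import ring lra.
Set Implicit Arguments.
Unset Strict Implicit.
Unset Printing Implicit Defensive.
Import Order.TTheory GRing.Theory Num.Theory.
Import numFieldNormedType.Exports.
Local Open Scope classical_set_scope.
Local Open Scope ring_scope.

(** * The Hahn-Banach theorem *)

(** [F] is only of class C^2 and the energy [U] contains [grad F], so [U] need not be C^2 in [x];
    moreover the noise is degenerate, acting on [y] alone. Both obstacles disappear when the
    generator is read along directions: [U] has a first derivative along the drift and is quadratic
    in [y], the only variable that the noise moves. Hence [generator_at], which asks for just these
    derivatives, and a maximum principle tested along lines. [LU] need not be bounded, so [U] is not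
    itself a test function. It enters the sublinear functional behind Hahn-Banach through a
    multiplier [s >= 0]: upper bounds of [f] are sought in the form [c + g - s * LU]. The sign of
    [s] is the one for which extrema exist, and the same term yields tightness. A finitely additive
    mean agrees with its Riesz measure on bounded continuous functions, but on open sets only an
    inequality survives. The law of time is therefore squeezed between two open half-lines, with a
    test function that has a kink; right derivatives in time make it admissible. *)

Definition sublinear_on (R : realType) (V : lmodType R) (B : set V)
    (q : V -> R) : Prop :=
  [/\ q 0 = 0,
      forall x y, B x -> B y -> q (x + y) <= q x + q y
    & forall k x, 0 < k -> B x -> q (k *: x) <= k * q x].

Section hahn_banach.
Context {R : realType} {V : lmodType R} (B : set V).
Hypothesis BD : forall x y, B x -> B y -> B (x + y).
Hypothesis BZ : forall (k : R) x, B x -> B (k *: x).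

Let BN x : B x -> B (- x).
Proof. by rewrite -scaleN1r; exact: BZ. Qed.

Lemma sublinearN (q : V -> R) x : sublinear_on B q -> B x -> - q (- x) <= q x.
Proof.
move=> [q0 qD _] Bx; have := qD _ _ Bx (BN Bx).
by rewrite subrr q0; lra.
Qed.

Lemma sublinearZ (q : V -> R) k x : sublinear_on B q -> B x -> 0 < k ->
  q (k *: x) = k * q x.
Proof.
move=> [q0 qD qZ] Bx k0; apply/eqP; rewrite eq_le qZ//=.
have := qZ k^-1 (k *: x); rewrite invr_gt0 => /(_ k0 (BZ _ Bx)).
by rewrite scalerA mulVf ?gt_eqF// scale1r mulrC ler_pdivlMr// mulrC.
Qed.

(* [q] decreased in the direction [y]; it is again sublinear, so a minimal [q]
   satisfies [q x + q y <= q (x + y)]. *)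
Let tilt (q : V -> R) (y x : V) : R :=
  inf [set q (x + t *: y) - t * q y | t in [set t : R | 0 <= t]].

Let tilt_lb q y x : sublinear_on B q -> B x -> B y ->
  lbound [set q (x + t *: y) - t * q y | t in [set t : R | 0 <= t]] (- q (- x)).
Proof.
move=> sq Bx By _ [t /= t0 <-].
have [q0 qD _] := sq.
have -> : t * q y = q (t *: y).
  move: t0; rewrite le_eqVlt => /orP[/eqP<-|t0].
    by rewrite mul0r scale0r q0.
  by rewrite (sublinearZ sq).
have := qD _ _ (BD Bx (BZ t By)) (BN Bx).
by rewrite addrAC subrr add0r; lra.
Qed.

Let tilt_le q y x t : sublinear_on B q -> B x -> B y -> 0 <= t ->
  tilt q y x <= q (x + t *: y) - t * q y.
Proof.
move=> sq Bx By t0; apply: ge_inf; last by exists t.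
by exists (- q (- x)); exact: tilt_lb.
Qed.

Let tilt_ge q y x c : (forall t, 0 <= t -> c <= q (x + t *: y) - t * q y) ->
  c <= tilt q y x.
Proof.
move=> h; apply: lb_le_inf.
  by exists (q (x + 0 *: y) - 0 * q y); exists 0 => //=.
by move=> _ [t /= t0 <-]; exact: h.
Qed.

Let tilt_sublinear q y : B 0 -> sublinear_on B q -> B y ->
  sublinear_on B (tilt q y).
Proof.
move=> B0 sq By; have [q0 qD qZ] := sq; split.
- apply/eqP; rewrite eq_le; apply/andP; split.
    apply: le_trans (tilt_le sq B0 By (lexx 0)) _.
    by rewrite scale0r addr0 q0; lra.
  apply: tilt_ge => t; rewrite le_eqVlt => /orP[/eqP<-|t0].
    by rewrite scale0r addr0 q0; lra.
  by rewrite add0r (sublinearZ sq)// subrr.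
- move=> x1 x2 B1 B2; rewrite -lerBlDr; apply: tilt_ge => t1 t10.
  rewrite lerBlDr -lerBlDl; apply: tilt_ge => t2 t20; rewrite lerBlDl.
  apply: le_trans (tilt_le sq (BD B1 B2) By (addr_ge0 t10 t20)) _.
  have := qD _ _ (BD B1 (BZ t1 By)) (BD B2 (BZ t2 By)).
  rewrite addrACA -scalerDl; lra.
- move=> k x k0 Bx; rewrite -ler_pdivrMl//; apply: tilt_ge => t t0.
  rewrite ler_pdivrMl//.
  apply: le_trans (tilt_le sq (BZ k Bx) By (mulr_ge0 (ltW k0) t0)) _.
  rewrite -scalerA -scalerDr (sublinearZ sq)//; last exact/BD/BZ.
  lra.
Qed.

(** Zorn's lemma gives a minimal sublinear functional below [p]; minimality against [tilt] makes it
    additive, and additivity extends homogeneity to negative scalars. All is relative to a subspace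
    [B] because the [p] of the application is an infimum of reals, meaningful on bounded functions
    only. *)
Lemma hahn_banach (p : V -> R) : B 0 -> sublinear_on B p ->
  exists L : V -> R, [/\ forall x, B x -> L x <= p x,
    forall x y, B x -> B y -> L (x + y) = L x + L y
    & forall k x, B x -> L (k *: x) = k * L x].
Proof.
move=> B0 sp.
pose Q := {q : V -> R | sublinear_on B q /\ forall x, B x -> q x <= p x}.
pose r : rel Q := fun q1 q2 => `[< forall x, B x -> sval q2 x <= sval q1 x >].
have t0 : Q by exists p; split => // x _.
(* A lower bound common to all candidates: it makes the pointwise infimum over a chain a genuine
   one. *)
have Qlb (q : Q) x : B x -> - p (- x) <= sval q x.
  move=> Bx; case: q => q [sq qp] /=.
  by apply: le_trans (sublinearN sq Bx); rewrite lerN2; exact/qp/BN.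
have [|q1 q2 q3 /asboolP h12 /asboolP h23||q qmin] := ZL_preorder t0 (R := r).
- by move=> q; exact/asboolP.
- by apply/asboolP => x Bx; exact: le_trans (h23 x Bx) (h12 x Bx).
- move=> A totA.
  have [->|/set0P A0] := eqVneq A set0; first by exists t0.
  have [q [qle qge]] : exists q : V -> R,
      (forall u x, A u -> B x -> q x <= sval u x) /\
      (forall c x, (forall u, A u -> c <= sval u x) -> c <= q x).
    exists (fun x => inf [set sval u x | u in A]); split => [u x Au Bx|c x h].
      apply: ge_inf; last by exists u.
      by exists (- p (- x)) => _ [v _ <-]; exact: Qlb.
    apply: lb_le_inf; first by case: A0 => u Au; exists (sval u x), u.
    by move=> _ [u Au <-]; exact: h.
  have sq : sublinear_on B q.
    split.
    + case: A0 => u Au; apply/eqP; rewrite eq_le; apply/andP; split.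
        by have [[u0 _ _] _] := svalP u; rewrite -u0; exact: qle.
      by apply: (qge) => v _; have [[-> _ _] _] := svalP v.
    + move=> x y Bx By; rewrite -lerBlDr; apply: (qge) => u Au.
      rewrite lerBlDr -lerBlDl; apply: (qge) => v Av; rewrite lerBlDl.
      have [[_ uD _] _] := svalP u; have [[_ vD _] _] := svalP v.
      (* The members of the chain that are nearly minimal at [x] and at [y] may differ; the smaller
         of the two serves both points. *)
      have [/asboolP uv|/asboolP vu] := totA u v Au Av.
        apply: le_trans (qle v _ Av (BD Bx By)) _.
        by have := uv x Bx; have := vD _ _ Bx By; lra.
      apply: le_trans (qle u _ Au (BD Bx By)) _.
      by have := vu y By; have := uD _ _ Bx By; lra.
    + move=> k x k0 Bx; rewrite -ler_pdivrMl//; apply: (qge) => u Au.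
      rewrite ler_pdivrMl//; apply: le_trans (qle u _ Au (BZ k Bx)) _.
      by have [[_ _ uZ] _] := svalP u; exact: uZ.
  have qp x : B x -> q x <= p x.
    move=> Bx; case: A0 => u Au; apply: le_trans (qle u x Au Bx) _.
    by have [_ h] := svalP u; exact: h.
  exists (exist _ q (conj sq qp)) => u Au; apply/asboolP => x Bx /=.
  exact: qle.
- case: q qmin => q [sq qp] qmin.
  have [q0 qD qZ] := sq.
  have qA x y : B x -> B y -> q (x + y) = q x + q y.
    move=> Bx By; apply/eqP; rewrite eq_le qD//=.
    have tp z : B z -> tilt q y z <= p z.
      move=> Bz; apply: le_trans (tilt_le sq Bz By (lexx 0)) _.
      by rewrite scale0r addr0 mul0r subr0; exact: (qp z).
    have := qmin (exist _ (tilt q y) (conj (tilt_sublinear B0 sq By) tp)).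
    have h : r (exist _ q (conj sq qp))
        (exist _ (tilt q y) (conj (tilt_sublinear B0 sq By) tp)).
      apply/asboolP => z Bz /=; apply: le_trans (tilt_le sq Bz By (lexx 0)) _.
      by rewrite scale0r addr0 mul0r subr0.
    move=> /(_ h) /asboolP /= /(_ x Bx) hx.
    have := tilt_le sq Bx By ler01; rewrite scale1r mul1r; lra.
  have qN x : B x -> q (- x) = - q x.
    by move=> Bx; have := qA _ _ Bx (BN Bx); rewrite subrr q0; lra.
  exists q; split => // k x Bx.
  have [k0|k0|->] := ltgtP k 0.
  + rewrite -[k]opprK scaleNr qN; last exact: BZ.
    by rewrite (sublinearZ sq Bx) ?oppr_gt0 ?opprK ?mulNr ?opprK.
  + exact: (sublinearZ sq).
  + by rewrite scale0r mul0r.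
Qed.

End hahn_banach.

(** * Means and the Riesz representation *)

Lemma compact_ind (X : ptopologicalType) (P : set X -> Prop) (K : set X) :
  P set0 -> (forall A B, P A -> P B -> P (A `|` B)) ->
  (forall A B, A `<=` B -> P B -> P A) ->
  (forall x, K x -> exists2 U, nbhs x U & P U) -> compact K -> P K.
Proof.
move=> P0 PU Psub Ploc; rewrite compact_cover => cK.
have [U HU] : {U : X -> set X & forall x, K x -> nbhs x (U x) /\ P (U x)}.
  apply: (@choice _ _ (fun x V => K x -> nbhs x V /\ P V)) => x.
  have [Kx|nKx] := pselect (K x); last by exists set0.
  by have [V Vx PV] := Ploc x Kx; exists V.
have [|x Kx|D DK KD] := cK X K (fun x => (U x)°).
- by move=> x _; exact: open_interior.
- by exists x => //; exact: (HU x Kx).1.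
apply: (Psub) KD _; rewrite /cover bigcup_fset.
rewrite big_seq; apply: big_ind => // x Dx.
have Kx : K x by have := DK x Dx; rewrite inE.
by apply: (Psub) (HU x Kx).2; exact: interior_subset.
Qed.

(* [C] is the class of compact sets on which the content [l] is known; the
   measure is only determined on open sets, by inner approximation from [C]. *)
Section riesz_measure.
Context {R : realType} {X : ptopologicalType} (C : set (set X)) (l : set X -> R).
Hypothesis Ccompact : forall K, C K -> compact K.
Hypothesis Cclosed : forall K, C K -> closed K.
Hypothesis C0 : C set0.
Hypothesis CU : forall K L, C K -> C L -> C (K `|` L).
Hypothesis Cbasis : forall x G, open G -> G x ->
  exists K, [/\ C K, K `<=` G & nbhs x K].
Hypothesis l0 : l set0 = 0.
Hypothesis l_le1 : forall K, C K -> l K <= 1.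
Hypothesis l_mono : forall K L, C K -> C L -> K `<=` L -> l K <= l L.
Hypothesis l_subU : forall K L, C K -> C L -> l (K `|` L) <= l K + l L.
Hypothesis l_disjU : forall K L, C K -> C L -> K `&` L = set0 ->
  l K + l L <= l (K `|` L).

Local Open Scope ereal_scope.

Definition inner_content (G : set X) : \bar R :=
  ereal_sup [set (l K)%:E | K in [set K | C K /\ K `<=` G]].

Let rho := inner_content.

Definition riesz_outer (A : set X) : \bar R :=
  ereal_inf [set rho G | G in [set G | open G /\ A `<=` G]].

Let mu := riesz_outer.

Lemma inner_content_ub G K : C K -> K `<=` G -> (l K)%:E <= rho G.
Proof. by move=> CK KG; apply: ereal_sup_ubound; exists K. Qed.

Let rho_ge0 G : 0 <= rho G.
Proof. by have := inner_content_ub C0 (@sub0set _ G); rewrite l0. Qed.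

Let rho_le1 G : rho G <= 1.
Proof. by apply: ge_ereal_sup => _ [K [CK _] <-]; rewrite lee_fin l_le1. Qed.

Let rho_mono G H : G `<=` H -> rho G <= rho H.
Proof.
move=> GH; apply: ge_ereal_sup => _ [K [CK KG] <-].
by apply: inner_content_ub => //; exact: subset_trans GH.
Qed.

Let rho_fin G : rho G \is a fin_num.
Proof.
by rewrite fin_real// (lt_le_trans _ (rho_ge0 G)) ?ltNyr//=
  (le_lt_trans (rho_le1 G))// ltry.
Qed.

Let rho_approx G (e : R) : (0 < e)%R ->
  exists K, [/\ C K, K `<=` G & rho G <= (l K + e)%:E].
Proof.
move=> e0; have [_ [K [CK KG] <-] h] := ub_ereal_sup_adherent e0 (rho_fin G).
by exists K; split => //; rewrite EFinD -leeBlDr//; exact: ltW.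
Qed.

Let l_cover (G : nat -> set X) K : (forall n, open (G n)) -> C K ->
  K `<=` \bigcup_n G n -> (l K)%:E <= \sum_(n <oo) rho (G n).
Proof.
move=> oG CK KG.
(* The content is subadditive on members of [C] only, so the open cover is first refined to finitely
   many members of [C], the [i]-th inside [G i]. *)
have : exists L : nat -> set X, exists N, (forall i, C (L i) /\ L i `<=` G i) /\
    K `<=` \big[setU/set0]_(i < N) L i.
  pose P A := exists L : nat -> set X, exists N,
    (forall i, C (L i) /\ L i `<=` G i) /\ A `<=` \big[setU/set0]_(i < N) L i.
  apply: (@compact_ind _ P) (Ccompact CK).
  - by exists (fun=> set0), 0%N; split => //; split.
  - move=> A B [L [N [HL AL]]] [L' [N' [HL' BL']]].
    exists (fun i => L i `|` L' i), (maxn N N'); split.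
      move=> i; have [CL LG] := HL i; have [CL' LG'] := HL' i.
      by split; [exact: CU|rewrite subUset].
    rewrite -(bigcup_mkord _ (fun i => L i `|` L' i)); move: AL BL'; rewrite -!bigcup_mkord => AL BL'.
    move=> x [/AL|/BL'] [i /= iN Lx]; exists i => //=.
    + by rewrite (leq_trans iN)// leq_maxl.
    + by left.
    + by rewrite (leq_trans iN)// leq_maxr.
    + by right.
  - by move=> A B AB [L [N [HL BL]]]; exists L, N; split => //; exact: subset_trans BL.
  - move=> x /KG [n _ Gx]; have [U [CU' UG Ux]] := Cbasis (oG n) Gx.
    exists U => //; exists (fun i => if i == n then U else set0), n.+1; split.
      by move=> i; case: eqP => [->|_]; split.
    rewrite -(bigcup_mkord _ (fun i => if i == n then U else set0)).
    by move=> y Uy; exists n => //=; rewrite eqxx.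
move=> [L [N [HL KL]]].
have CN M : C (\big[setU/set0]_(i < M) L i).
  by elim/big_ind : _ => // i _; exact: (HL i).1.
apply: (@le_trans _ _ (\sum_(i < N) rho (G i))); last first.
  rewrite -(big_mkord xpredT (rho \o G)); apply: nneseries_lim_ge => n _ _.
  exact: rho_ge0.
apply: (@le_trans _ _ (\sum_(i < N) (l (L i))%:E)); last first.
  by apply: lee_sum => i _; apply: inner_content_ub; have [] := HL i.
apply: (@le_trans _ _ (l (\big[setU/set0]_(i < N) L i))%:E).
  by rewrite lee_fin; exact: l_mono.
elim: N {KL} => [|N IH]; first by rewrite !big_ord0 l0.
rewrite !big_ord_recr/=; apply: (le_trans _ (leeD IH (lexx _))).
by rewrite -EFinD lee_fin; apply: l_subU; [exact: CN|exact: (HL N).1].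
Qed.

Let muE G : open G -> mu G = rho G.
Proof.
move=> oG; apply/eqP; rewrite eq_le; apply/andP; split.
  by apply: ereal_inf_lbound; exists G => //; split.
by apply: le_ereal_inf_tmp => _ [H [_ GH] <-]; exact: rho_mono.
Qed.

Let mu_ge0 A : 0 <= mu A.
Proof. by apply: le_ereal_inf_tmp => _ [G _ <-]; exact: rho_ge0. Qed.

Let mu_le1 A : mu A <= 1.
Proof.
apply: le_trans (rho_le1 setT); apply: ereal_inf_lbound; exists setT => //.
by split => //; exact: openT.
Qed.

Let mu_fin A : mu A \is a fin_num.
Proof.
by rewrite fin_real// (lt_le_trans _ (mu_ge0 A)) ?ltNyr//=
  (le_lt_trans (mu_le1 A))// ltry.
Qed.

Let mu_mono : {homo mu : A B / A `<=` B >-> A <= B}.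
Proof.
move=> A B AB; apply: le_ereal_inf_tmp => _ [G [oG BG] <-].
by apply: ereal_inf_lbound; exists G => //; split => //; exact: subset_trans BG.
Qed.

Let mu0 : mu set0 = 0.
Proof.
apply/eqP; rewrite eq_le mu_ge0 andbT muE; last exact: open0.
apply: ge_ereal_sup => _ [K [_ +] <-].
by rewrite subset0 => ->; rewrite l0.
Qed.

Let mu_approx A (e : R) : (0 < e)%R ->
  exists G, [/\ open G, A `<=` G & rho G <= mu A + e%:E].
Proof.
move=> e0; have [_ [G [oG AG] <-] h] := lb_ereal_inf_adherent e0 (mu_fin A).
by exists G; split => //; exact: ltW.
Qed.

Let mu_sub : sigma_subadditive mu.
Proof.
move=> A; apply/lee_addgt0Pr => e e0.
apply: le_trans (epsilon_trick _ _ (ltW e0)); last by move=> n; exact: mu_ge0.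
have [G HG] : {G : nat -> set X & forall n, [/\ open (G n), A n `<=` G n &
    rho (G n) <= mu (A n) + (e / (2 ^ n.+1)%:R)%:E]}.
  apply: (@choice _ _ (fun n G => [/\ open G, A n `<=` G &
    rho G <= mu (A n) + (e / (2 ^ n.+1)%:R)%:E])) => n.
  by apply: mu_approx; rewrite divr_gt0// ltr0n expn_gt0.
apply: (@le_trans _ _ (rho (\bigcup_n G n))).
  apply: ereal_inf_lbound; exists (\bigcup_n G n) => //; split.
    by apply: bigcup_open => n _; have [] := HG n.
  by apply: subset_bigcup => n _; have [] := HG n.
apply: ge_ereal_sup => _ [K [CK KG] <-].
apply: le_trans (l_cover _ CK KG) _; first by move=> n; have [] := HG n.
by apply: lee_nneseries => n _ //; have [] := HG n.
Qed.

HB.instance Definition _ := isOuterMeasure.Build R X mu mu0 mu_ge0 mu_mono mu_sub.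

(* Open sets split every open [A]: first exhaust [A `&` G] by a compact [K],
   then the open set [A `\` K], which contains [A `\` G]. *)
Let open_caratheodory G : open G -> mu.-caratheodory G.
Proof.
move=> oG; apply: le_caratheodory_measurable => A.
apply/lee_addgt0Pr => e e0.
have e3 : (0 < e / 3)%R by lra.
have [H [oH AH hH]] := mu_approx A e3.
have oHG : open (H `&` G) by exact: openI.
have [K [CK KHG hK]] := rho_approx (H `&` G) e3.
have oHK : open (H `\` K).
  by rewrite setDE; apply: openI => //; rewrite openC; exact: Cclosed.
have [L [CL LHK hL]] := rho_approx (H `\` K) e3.
have KL : K `&` L = set0.
  by rewrite -subset0 => x [Kx /LHK[]].
have lKL : (l K + l L)%:E <= rho H.
  apply: (@le_trans _ _ (l (K `|` L))%:E).
    by rewrite lee_fin; exact: l_disjU.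
  apply: inner_content_ub; first exact: CU.
  by move=> x [/KHG[]//|/LHK[]].
apply: (@le_trans _ _ ((l K + e / 3)%:E + (l L + e / 3)%:E)).
  apply: leeD.
    apply: le_trans hK; rewrite -muE//; apply: mu_mono; exact: setSI.
  apply: le_trans hL; rewrite -muE//; apply: mu_mono => x [Ax nGx].
  by split; [exact: AH|move=> /KHG[]].
rewrite -EFinD; apply: (@le_trans _ _ (rho H + (e / 3 + e / 3)%:E)).
  by rewrite -(fineK (rho_fin H)) in lKL *; rewrite -EFinD !lee_fin in lKL *; lra.
apply: le_trans (leeD hH (lexx _)) _.
by rewrite -addeA -EFinD leeD2l// lee_fin; lra.
Qed.

(** Caratheodory's theorem for [riesz_outer]. The measure of a member of [C] may exceed its content,
    since [l] is not assumed to be outer regular; this is why the conclusion speaks of open sets. *)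
Lemma riesz_measure :
  exists m : {measure set (g_sigma_algebraType (@open X)) -> \bar R},
    forall G, open G -> m G = inner_content G.
Proof.
pose I := g_sigma_algebraType (@open X).
have sub : (@measurable _ I) `<=` mu.-cara.-measurable.
  apply: smallest_sub; last exact: open_caratheodory.
  split => //; [by move=> A mA; rewrite setTD; exact: measurableC|].
  by move=> u_ mu_; exact: bigcupT_measurable.
pose m : set I -> \bar R := mu.
have m0 : m set0 = 0 by exact: mu0.
have m_ge0 A : 0 <= m A by exact: mu_ge0.
have m_sigma : semi_sigma_additive m.
  move=> F mF tF mUF.
  apply: (@caratheodory_measure_sigma_additive R X mu) => //; last exact: sub.
  by move=> i; exact: (sub _ (mF i)).
pose m' := isMeasure.Build _ I R m m0 m_ge0 m_sigma.
exists (HB.pack_for {measure set I -> \bar R} m m') => G oG.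
exact: muE.
Qed.

End riesz_measure.

(** * Finitely additive means *)

Definition bounded_fct (R : realType) (X : Type) : set (X -> R) :=
  [set f | exists M, forall x, `|f x| <= M].

Lemma bounded_fctD (R : realType) (X : Type) (f g : X -> R) :
  bounded_fct f -> bounded_fct g -> bounded_fct (f + g).
Proof.
move=> [M hM] [N hN]; exists (M + N) => x.
by rewrite (le_trans (ler_normD _ _))// lerD.
Qed.

Lemma bounded_fctZ (R : realType) (X : Type) (k : R) (f : X -> R) :
  bounded_fct f -> bounded_fct (k *: f).
Proof.
move=> [M hM]; exists (`|k| * M) => x.
by rewrite -[_ x]/(k * f x) normrM ler_wpM2l.
Qed.

Lemma bounded_indic (R : realType) (X : Type) (A : set X) :
  bounded_fct (\1_A : X -> R).
Proof.
by exists 1 => x; rewrite indicE; case: (_ \in _); rewrite ?normr1 ?normr0.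
Qed.

Lemma bounded_cst (R : realType) (X : Type) (c : R) : bounded_fct (cst c : X -> R).
Proof. by exists `|c|. Qed.

(* Finitely additive probabilities, as functionals on all bounded functions. *)
Definition mean_functional (R : realType) (X : Type) (L : (X -> R) -> R) : Prop :=
  [/\ forall f g, bounded_fct f -> bounded_fct g -> L (f + g) = L f + L g,
      forall (k : R) f, bounded_fct f -> L (k *: f) = k * L f,
      forall f, bounded_fct f -> (forall x, 0 <= f x) -> 0 <= L f
    & L (cst 1) = 1].

Section mean_functional_theory.
Context {R : realType} {X : Type} (L : (X -> R) -> R).
Hypothesis meanL : mean_functional L.

Lemma mean_le f g : bounded_fct f -> bounded_fct g ->
  (forall x, f x <= g x) -> L f <= L g.
Proof.
case: meanL => LD LZ L_ge0 _ bf bg fg.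
have bh : bounded_fct (fun x => g x - f x).
  case: bf bg => [M hM] [N hN]; exists (N + M) => x.
  by rewrite (le_trans (ler_normB _ _))// lerD.
have -> : g = f + (fun x => g x - f x).
  by apply/funext => x; rewrite -[RHS]/(f x + (g x - f x)) addrC subrK.
by rewrite LD// lerDl; apply: L_ge0 => // x; rewrite subr_ge0.
Qed.

Lemma mean_cst c : L (cst c) = c.
Proof.
case: meanL => LD LZ _ L1.
rewrite (_ : cst c = c *: (cst 1 : X -> R)).
  by rewrite (LZ _ _ (bounded_cst _ _)) L1 mulr1.
by apply/funext => x; rewrite -[RHS]/(c * 1) mulr1.
Qed.

Lemma mean0 : L 0 = 0.
Proof. by rewrite -[RHS](mean_cst 0). Qed.

Lemma mean_sum n (f : nat -> X -> R) : (forall k, bounded_fct (f k)) ->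
  bounded_fct (\sum_(k < n) f k) /\ L (\sum_(k < n) f k) = \sum_(k < n) L (f k).
Proof.
case: meanL => LD _ _ _ bf; elim: n => [|n [IH1 IH2]].
  by rewrite !big_ord0 mean0; split => //; exact: (bounded_cst _ 0).
rewrite !big_ord_recr/=; split; first exact: bounded_fctD.
by rewrite LD// IH2.
Qed.

End mean_functional_theory.

(** Discrete layer-cake formula: the sum counts the positive integers strictly below [y], up to [n],
    and this number lies between [y - 1] and [y] when [0 <= y <= n]. *)
Lemma sum_layer_le (R : realType) n (y : R) : 0 <= y ->
  \sum_(k < n) ((k.+1%:R : R) < y)%R%:R <= y.
Proof.
elim: n y => [|n IH] y y0; first by rewrite big_ord0.
have [y1|y1] := leP y 1.
  rewrite big1// => i _; case: ltP => // h; exfalso.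
  have : (1 : R) <= i.+1%:R by rewrite ler1n.
  by move=> h1; have := lt_le_trans h y1; lra.
rewrite big_ord_recl y1; have : 0 <= y - 1 by lra.
move=> /IH; under eq_bigr do rewrite ltrBrDl nat1r.
by rewrite /= /bump/=; lra.
Qed.

Lemma sum_layer_ge (R : realType) n (y : R) : y <= n%:R ->
  y - 1 <= \sum_(k < n) ((k.+1%:R : R) < y)%R%:R.
Proof.
elim: n y => [|n IH] y yn; first by rewrite big_ord0; lra.
have [y1|y1] := leP y 1.
  by apply: (@le_trans _ _ 0); [lra|exact: sumr_ge0].
rewrite big_ord_recl y1; have : y - 1 <= n%:R by rewrite -natr1 in yn; lra.
move=> /IH; under eq_bigr do rewrite ltrBrDl nat1r.
by rewrite /= /bump/=; lra.
Qed.

Lemma continuous_open_measurable (R : realType) (X : ptopologicalType) (f : X -> R) :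
  continuous f ->
  measurable_fun setT (f : g_sigma_algebraType (@open X) -> R).
Proof.
move=> cf; apply: (measurability _ (RGenOInfty.measurableE R)) => _ [_ [a ->] <-]; rewrite setTI; apply: sub_sigma_algebra.
by apply: open_comp => // x _; exact: cf.
Qed.

(** [L] does not commute with monotone limits, so [f] is compared with a finite staircase: the
    number of sets [A k] containing a point differs from [n * f] by at most 1. Comparing the
    superlevel sets one by one costs an error of [1 / n]. *)
Lemma integral_le_mean (R : realType) d (X : measurableType d)
    (m : {measure set X -> \bar R}) (L : (X -> R) -> R) (f : X -> R) :
  mean_functional L -> m setT = 1%E -> measurable_fun setT f ->
  (forall x, 0 <= f x <= 1) ->
  (forall c, (m [set x | (c < f x)%R] <= (L \1_[set x | (c < f x)%R])%:E)%E) ->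
  (\int[m]_x (f x)%:E <= (L f)%:E)%E.
Proof.
move=> meanL m1 mf f01 mL; have [LD LZ L_ge0 L1] := meanL.
have bf : bounded_fct f.
  by exists 1 => x; have /andP[f0 f1] := f01 x; rewrite ger0_norm.
apply/lee_addgt0Pr => e e0.
have [n n0 en] : exists2 n, (0 < n)%N & n%:R^-1 <= e.
  exists (Num.truncn e^-1).+1 => //; rewrite invf_ple ?posrE//.
  exact/ltW/truncnS_gt.
have n0' : 0 < n%:R :> R by rewrite ltr0n.
pose A k := [set x | (k.+1%:R < n%:R * f x)%R].
have AE k : A k = [set x | k.+1%:R / n%:R < f x].
  by apply/funext => x; rewrite /A/= ltr_pdivrMr// mulrC.
have mA k : measurable (A k).
  by rewrite AE -preimage_itvoy -[X in measurable X]setTI; exact: mf.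
have indA k x : (\1_(A k) x : R) = ((k.+1%:R : R) < n%:R * f x)%R%:R.
  by rewrite indicE; congr (nat_of_bool _)%:R; apply/idP/idP; rewrite inE.
have [bS LS] := mean_sum meanL n (fun k => bounded_indic R (A k)).
have sumA x : (\sum_(k < n) \1_(A k) : X -> R) x = \sum_(k < n) \1_(A k) x.
  by rewrite fct_sumE.
apply: (@le_trans _ _
    (\int[m]_x ((n%:R^-1)%:E * (1 + \sum_(k < n) (\1_(A k) x)%:E)))%E).
  apply: ge0_le_integral => //.
  - by move=> x _; rewrite lee_fin; have /andP[] := f01 x.
  - exact/measurable_EFinP.
  - apply: measurable_funeM; apply: emeasurable_funD => //.
    by apply: emeasurable_sum => k; exact/measurable_EFinP/measurable_indic.
  move=> x _; rewrite sumEFin -EFinD -EFinM lee_fin ler_pdivlMl//.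
  have : n%:R * f x <= n%:R.
    by have /andP[_ f1] := f01 x; rewrite ler_piMr// ltW.
  move=> /sum_layer_ge; under eq_bigr do rewrite -indA.
  lra.
rewrite ge0_integralZl_EFin//; last 2 first.
- by move=> x _; rewrite adde_ge0// sume_ge0// => k _; rewrite lee_fin.
- apply: emeasurable_funD => //.
  by apply: emeasurable_sum => k; exact/measurable_EFinP/measurable_indic.
rewrite ge0_integralD//; last 2 first.
- by move=> x _; rewrite sume_ge0// => k _; rewrite lee_fin.
- by apply: emeasurable_sum => k; exact/measurable_EFinP/measurable_indic.
rewrite integral_cst// mul1e m1 ge0_integral_sum//; last first.
  by move=> k; exact/measurable_EFinP/measurable_indic.
under eq_bigr do rewrite integral_indic// setIT.
apply: (@le_trans _ _ ((n%:R^-1)%:E * (1 + \sum_(k < n) (L \1_(A k))%:E))%E).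
  rewrite lee_pmul2l//; last by rewrite lte_fin invr_gt0.
  by rewrite leeD2l// lee_sum// => k _; rewrite AE.
rewrite sumEFin -LS -!EFinD -EFinM lee_fin ler_pdivrMl//.
have : L (\sum_(k < n) \1_(A k)) <= L (n%:R *: f).
  apply: mean_le => //; first exact: bounded_fctZ.
  move=> x; rewrite sumA; under eq_bigr do rewrite indA.
  by apply: sum_layer_le; rewrite mulr_ge0//; have /andP[] := f01 x.
rewrite LZ//; have : 1 <= n%:R * e by rewrite mulrC -ler_pdivrMr// div1r.
by lra.
Qed.

Lemma bounded_integrable_on d (X : measurableType d) (R : realType)
    (m : {measure set X -> \bar R}) (D : set X) (f : X -> R) :
  measurable D -> (m D < +oo)%E -> measurable_fun setT f -> bounded_fct f ->
  m.-integrable D (EFin \o f).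
Proof.
move=> mD moo mf [M hM]; apply: measurable_bounded_integrable => //.
  exact: measurable_funTS.
exists M; split; first exact: num_real.
by move=> N /ltW MN x _; exact: le_trans (hM x) MN.
Qed.

Lemma bounded_integrable d (X : measurableType d) (R : realType)
    (m : {measure set X -> \bar R}) (f : X -> R) :
  (m setT < +oo)%E -> measurable_fun setT f -> bounded_fct f ->
  m.-integrable setT (EFin \o f).
Proof. exact: bounded_integrable_on. Qed.

(** Adding a bound of [f] makes it non-negative; this lemma takes the constant out again when an
    identity for non-negative integrands is extended to bounded ones. *)
Lemma integral_addr_cst d (X : measurableType d) (R : realType)
    (m : {measure set X -> \bar R}) (D : set X) (f : X -> R) (c : R) :
  measurable D -> (m D < +oo)%E -> measurable_fun setT f -> bounded_fct f ->
  (\int[m]_(x in D) (f x + c)%:E = \int[m]_(x in D) (f x)%:E + c%:E * m D)%E.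
Proof.
move=> mD moo mf bf; under eq_integral do rewrite EFinD.
rewrite integralD ?integral_cst//; first exact: bounded_integrable_on.
apply: (@bounded_integrable_on _ _ _ _ _ (cst c)) => //; exact: bounded_cst.
Qed.

Section mean_riesz.
Context {R : realType} {X : ptopologicalType} (L : (X -> R) -> R).
Hypothesis Xhaus : hausdorff_space X.
Hypothesis Xbasis : forall (x : X) G, open G -> G x ->
  exists K, [/\ compact K, K `<=` G & nbhs x K].
Hypothesis meanL : mean_functional L.
Hypothesis tightL : forall e, 0 < e -> exists2 K, compact K & 1 - e <= L \1_K.

(** The content of a compact [K] is [L \1_K]. A mean can lose mass at infinity; [tightL] restores
    total mass 1. As [m <= L] on open sets, continuous functions with values in [[0, 1]] satisfy a
    one-sided bound, and equal total masses turn it into an equality by reflection. *)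
Lemma mean_riesz : exists m : {measure set (g_sigma_algebraType (@open X)) -> \bar R},
  [/\ m setT = 1%E, forall G, open G -> (m G <= (L \1_G)%:E)%E &
      forall f : X -> R, continuous f -> bounded_fct f -> (\int[m]_x (f x)%:E = (L f)%:E)%E].
Proof.
have [LD LZ L_ge0 L1] := meanL.
pose l (K : set X) := L \1_K.
have bI := bounded_indic R (X := X).
have l_mono (A B : set X) : A `<=` B -> l A <= l B.
  move=> AB; apply: mean_le => // x; rewrite !indicE ler_nat.
  by case: (boolP (x \in A)) => // /set_mem/AB/mem_set ->.
have [m mE] : exists m : {measure set (g_sigma_algebraType (@open X)) -> \bar R},
    forall G, open G -> m G = inner_content (@compact X) l G.
  apply: riesz_measure => //.
  - by move=> K; exact: compact_closed.
  - exact: compact0.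
  - by move=> K K'; exact: compactU.
  - rewrite /l indic0; exact: mean0.
  - by move=> K _; rewrite -L1 -indicT; exact: l_mono.
  - move=> K K' _ _; exact: l_mono.
  - move=> A B _ _; rewrite /l -LD//; apply: mean_le => //; first exact: bounded_fctD.
    move=> x; rewrite -[leRHS]/(\1_A x + \1_B x) !indicE in_setU -natrD ler_nat.
    by case: (_ \in _); case: (_ \in _).
  - move=> A B _ _ AB; rewrite /l -LD//; apply: mean_le => //; first exact: bounded_fctD.
    move=> x; rewrite -[leLHS]/(\1_A x + \1_B x) !indicE in_setU -natrD ler_nat.
    case: (boolP (x \in A)) => [/set_mem Ax|_]; case: (boolP (x \in B)) => [/set_mem Bx|_] //.
    by have : (A `&` B) x by []; rewrite AB.
have mG G : open G -> (m G <= (L \1_G)%:E)%E.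
  move=> oG; rewrite mE//; apply: ge_ereal_sup => _ [K [_ KG] <-].
  by rewrite lee_fin; exact: l_mono.
have mT : m setT = 1%E.
  apply/eqP; rewrite eq_le; apply/andP; split.
    by rewrite -L1 -indicT; apply: mG; exact: openT.
  rewrite mE; last exact: openT.
  apply/lee_addgt0Pr => e e0; have [K cK KL] := tightL e0.
  apply: (@le_trans _ _ ((l K)%:E + e%:E)%E).
    by rewrite -EFinD lee_fin -lerBlDr.
  by rewrite leeD2r//; apply: inner_content_ub.
exists m; split => // f cf bf.
have mf := continuous_open_measurable cf.
have ub (g : X -> R) : continuous g -> (forall x, 0 <= g x <= 1) ->
    (\int[m]_x (g x)%:E <= (L g)%:E)%E.
  move=> cg g01; apply: integral_le_mean => //.
    exact: continuous_open_measurable.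
  move=> c; apply: mG; rewrite -preimage_itvoy.
  by apply: open_comp => // x _; exact: cg.
have moo : (m setT < +oo)%E by rewrite mT ltry.
have [M hM] := bf.
have M0 : 0 <= M by exact: le_trans (hM point).
(* One more than the bound, so that division by [2 * N] is legitimate even when [f] vanishes. *)
pose N := M + 1.
have N0 : 0 < N by rewrite /N ltr_wpDl.
have fN x : - N <= f x <= N.
  by rewrite -ler_norml (le_trans (hM x))// /N lerDl.
(* Apply the one-sided bound to [(N + f) / 2N] and to [(N - f) / 2N]. *)
have main (s : R) : s = 1 \/ s = -1 ->
    (\int[m]_x (s * f x)%:E <= (s * L f)%:E)%E.
  move=> s1.
  have b1 := bounded_fctZ s bf.
  have b2 : bounded_fct (cst N : X -> R) by exact: bounded_cst.
  have b3 := bounded_fctD b2 b1.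
  pose g x := (2 * N)^-1 * (N + s * f x).
  have cg : continuous g.
    move=> x; apply: cvgM; first exact: cvg_cst.
    by apply: cvgD; [exact: cvg_cst|apply: cvgM; [exact: cvg_cst|exact: cf]].
  have g01 x : 0 <= g x <= 1.
    have sfN : - N <= s * f x <= N by have := fN x; case: s1 => ->; lra.
    have N2 : 0 < 2 * N by rewrite mulr_gt0.
    rewrite /g ler_pdivrMl// mulr1 mulr_ge0 ?invr_ge0 ?(ltW N2)//=; first lra.
    by lra.
  have gE : L g = (2 * N)^-1 * (N + s * L f).
    rewrite (_ : g = (2 * N)^-1 *: (cst N + s *: f)).
      by rewrite (LZ _ _ b3) (LD _ _ b2 b1) (LZ _ _ bf) (mean_cst meanL).
    by apply/funext => x.
  have := ub g cg g01; rewrite gE /g.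
  have isf : m.-integrable setT (fun x => (s * f x)%:E).
    apply: bounded_integrable => //; exact: measurable_funM.
  under eq_integral do rewrite EFinM.
  rewrite integralZl//; last first.
    apply: bounded_integrable => //.
    by apply: measurable_funD => //; exact: measurable_funM.
  rewrite EFinM lee_pmul2l//; last first.
    by rewrite lte_fin invr_gt0; lra.
  under eq_integral do rewrite EFinD.
  rewrite integralD//; last exact: bounded_integrable.
  by rewrite integral_cst// mT mule1 [in X in (_ <= X)%E -> _]EFinD leeD2lE.
apply/eqP; rewrite eq_le; apply/andP; split.
  by have := main 1 (or_introl erefl); rewrite mul1r; under eq_integral do rewrite mul1r.
have := main (-1) (or_intror erefl).
under eq_integral do rewrite mulN1r EFinN.
rewrite mulN1r EFinN integralN/=; last first.
  exact/integrable_add_def/bounded_integrable.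
by rewrite EFinN leeN2.
Qed.

End mean_riesz.

(** * Directional derivatives *)

Section directional_derivatives.
Context {R : realType} {V : normedModType R}.
Implicit Types (f : V -> R) (x u w : V).

Lemma is_derive_line f x u (t d : R) : is_derive (x + t *: u) u f d ->
  is_derive t (1 : R) (fun s : R => f (x + s *: u)) d.
Proof.
case=> df <-; have E : (fun h : R => h^-1 *: (((fun s : R => f (x + s *: u)) \o shift t) (h *: 1) - f (x + t *: u))) =
    (fun h => h^-1 *: ((f \o shift (x + t *: u)) (h *: u) - f (x + t *: u))).
  apply/funext => h /=; congr (_ *: (f _ - _)).
  by rewrite [h *: 1]mulr1 scalerDl addrCA.
by apply: DeriveDef; rewrite /derivable /derive E.
Qed.

Lemma is_derive_lineP f x u (d : R) :
  is_derive (0 : R) (1 : R) (fun s : R => f (x + s *: u)) d -> is_derive x u f d.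
Proof.
case=> df <-; have E : (fun h : R => h^-1 *: (((fun s : R => f (x + s *: u)) \o shift (0 : R)) (h *: 1) - f (x + 0 *: u))) =
    (fun h => h^-1 *: ((f \o shift x) (h *: u) - f x)).
  apply/funext => h /=; rewrite scale0r !addr0; congr (_ *: (f _ - _)).
  by rewrite [h *: 1]mulr1 addrC.
by apply: DeriveDef; move: df; rewrite /derivable /derive E.
Qed.

Lemma mean_value_line f x u (df : R -> R) (h : R) :
  (forall t, is_derive (x + t *: u) u f (df t)) ->
  exists2 c, `|c| <= `|h| & f (x + h *: u) - f x = h * df c.
Proof.
move=> fd.
have fd' t : is_derive t (1 : R) (fun s : R => f (x + s *: u)) (df t).
  exact: is_derive_line.
have cf : continuous (fun s : R => f (x + s *: u)).
  move=> t; apply/differentiable_continuous/derivable1_diffP.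
  by have [] := fd' t.
have [h0|h0] := leP 0 h.
  have [c ch E] := MVT_segment h0 (fun t _ => fd' t) (continuous_subspaceT cf).
  exists c; last by move: E; rewrite /= scale0r addr0 subr0 mulrC.
  move: ch; rewrite in_itv/= => /andP[c0 ch].
  by rewrite !ger0_norm.
have [c ch E] := MVT_segment (ltW h0) (fun t _ => fd' t) (continuous_subspaceT cf).
exists c; last first.
  by move: E; rewrite /= scale0r addr0 sub0r; lra.
move: ch; rewrite in_itv/= => /andP[c0 ch].
by rewrite !ler0_norm ?lerN2// ltW.
Qed.

(** The increment is split into a move along [w] followed by one along [u]; the second is handled by
    the mean value theorem and the continuity of [du] at [x]. The derivative along [w] is needed at
    [x] only, which lets coordinates be added one at a time. *)
Lemma is_derive_dirD f x u w (du : V -> R) (dw : R) :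
  (forall y, is_derive y u f (du y)) -> {for x, continuous du} ->
  is_derive x w f dw -> is_derive x (u + w) f (du x + dw).
Proof.
move=> fu cdu [fw <-].
suff H : (fun h : R => h^-1 *: ((f \o shift x) (h *: (u + w)) - f x)) @ 0^' -->
    du x + 'D_w f x.
  by apply: DeriveDef; [apply/cvg_ex; eexists; exact: H|exact: cvg_lim].
have -> : (fun h : R => h^-1 *: ((f \o shift x) (h *: (u + w)) - f x)) =
    (fun h : R => h^-1 *: (f (x + h *: w + h *: u) - f (x + h *: w)) +
       h^-1 *: ((f \o shift x) (h *: w) - f x)).
  apply/funext => h /=.
  have -> : h *: (u + w) + x = x + h *: w + h *: u.
    by rewrite scalerDr addrC [h *: u + _]addrC addrA.
  by rewrite [h *: w + x]addrC -scalerDr addrA subrK.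
apply: cvgD; last exact: fw.
apply/cvgrPdist_le => e e0.
have /cvgrPdist_le/(_ _ e0)/nbhs_ballP[r r0 hr] := cdu.
have K0 : 0 < `|w| + `|u| + 1 by rewrite ltr_wpDl.
near=> h.
have hn0 : h != 0 by near: h; exact: nbhs_dnbhs_neq.
have [c ch ->] := mean_value_line h (fun t => fu (x + h *: w + t *: u)).
rewrite [h^-1 *: _]mulrA mulVf// mul1r; apply: hr => /=.
rewrite -ball_normE/= -!addrA opprD addrA subrr sub0r normrN.
rewrite (le_lt_trans (ler_normD _ _))// !normrZ.
apply: (@le_lt_trans _ _ (`|h| * (`|w| + `|u| + 1))).
  by rewrite !mulrDr mulr1 -addrA lerD2l ler_wpDr// ler_wpM2r.
rewrite -ltr_pdivlMr//; near: h; apply: dnbhs0_lt.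
by rewrite divr_gt0.
Unshelve. all: by end_near. Qed.

Lemma is_derive_dirZ f x u (k d : R) :
  is_derive x u f d -> is_derive x (k *: u) f (k * d).
Proof.
move=> fd; apply: is_derive_lineP.
have -> : (fun s : R => f (x + s *: (k *: u))) =
    (fun s : R => f (x + s *: u)) \o ( *%R k).
  by apply/funext => s /=; rewrite scalerA mulrC.
rewrite mulrC; apply: is_derive1_comp; last first.
  have := @is_deriveZ R R R id k 0 1 1 (is_derive_id _ _).
  by rewrite [k *: 1]mulr1.
by rewrite mulr0; apply: is_derive_line; rewrite scale0r addr0.
Qed.

(* Both mixed derivatives are values of the same second difference
   [f (x+hu+hw) - f (x+hu) - f (x+hw) + f x], divided by [h ^+ 2]. *)
Lemma derive_sym f x u w (fu fw fuw fwu : V -> R) :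
  (forall y, is_derive y u f (fu y)) -> (forall y, is_derive y w f (fw y)) ->
  (forall y, is_derive y w fu (fuw y)) -> (forall y, is_derive y u fw (fwu y)) ->
  {for x, continuous fuw} -> {for x, continuous fwu} -> fuw x = fwu x.
Proof.
move=> du dw duw dwu cuw cwu.
have key u1 w1 (f1 f2 : V -> R) (h : R) : (forall y, is_derive y u1 f (f1 y)) ->
    (forall y, is_derive y w1 f1 (f2 y)) ->
    exists c1 c2, [/\ `|c1| <= `|h|, `|c2| <= `|h| &
      f (x + h *: w1 + h *: u1) - f (x + h *: u1) - (f (x + h *: w1) - f x) =
        h * (h * f2 (x + c1 *: u1 + c2 *: w1))].
  move=> d1 d2.
  pose g y := f (h *: w1 + y) - f y.
  have dg y : is_derive y u1 g (f1 (h *: w1 + y) - f1 y).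
    have d1' : is_derive y u1 f (f1 y) by exact: d1.
    apply: (@is_deriveB _ _ _ (fun z => f (h *: w1 + z)) f).
    apply: is_derive_lineP.
    have -> : (fun s : R => f (h *: w1 + (y + s *: u1))) =
              (fun s : R => f (h *: w1 + y + s *: u1)).
      by apply/funext => s; rewrite addrA.
    by apply: is_derive_line; rewrite scale0r addr0; exact: d1.
  have [c1 c1h E1] := mean_value_line h (fun t => dg (x + t *: u1)).
  have [c2 c2h E2] := mean_value_line h (fun t => d2 (x + c1 *: u1 + t *: w1)).
  exists c1, c2; split => //.
  rewrite -E2 [x + c1 *: u1 + _]addrC -E1 /g.
  have -> : x + h *: w1 + h *: u1 = h *: w1 + (x + h *: u1).
    by rewrite addrA [_ + x]addrC.
  by rewrite [x + h *: w1]addrC.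
have [//|neq] := eqVneq (fuw x) (fwu x).
pose e := `|fuw x - fwu x| / 3.
have e0 : 0 < e by rewrite divr_gt0// normr_gt0 subr_eq0.
have /cvgrPdist_le/(_ _ e0)/nbhs_ballP[r1 r10 H1] := cuw.
have /cvgrPdist_le/(_ _ e0)/nbhs_ballP[r2 r20 H2] := cwu.
pose r := Num.min r1 r2.
have r0 : 0 < r by rewrite lt_min r10.
have K0 : 0 < `|u| + `|w| + 1 by rewrite ltr_wpDl.
pose h := r / (2 * (`|u| + `|w| + 1)).
have h0 : 0 < h by rewrite divr_gt0// mulr_gt0.
have bnd (c1 c2 : R) : `|c1| <= `|h| -> `|c2| <= `|h| ->
    `|c1| * `|u| + `|c2| * `|w| < r.
  rewrite (gtr0_norm h0) => H H'.
  apply: (@le_lt_trans _ _ (h * (`|u| + `|w| + 1))).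
    by rewrite !mulrDr mulr1 ler_wpDr ?(ltW h0)// lerD// ler_wpM2r.
  by rewrite /h -mulrA invfM -!mulrA mulVf ?gt_eqF// mulr1; lra.
have [c1 [c2 [B1 B2 E1]]] := key u w fu fuw h du duw.
have [c3 [c4 [B3 B4 E2]]] := key w u fw fwu h dw dwu.
have N1 : ball x r1 (x + c1 *: u + c2 *: w).
  rewrite -ball_normE/= -addrA opprD addrA subrr sub0r normrN.
  rewrite (le_lt_trans (ler_normD _ _))// !normrZ.
  by apply: lt_le_trans (bnd _ _ B1 B2) _; rewrite /r ge_min lexx.
have N2 : ball x r2 (x + c3 *: w + c4 *: u).
  rewrite -ball_normE/= -addrA opprD addrA subrr sub0r normrN.
  rewrite (le_lt_trans (ler_normD _ _))// !normrZ addrC.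
  by apply: lt_le_trans (bnd _ _ B4 B3) _; rewrite /r ge_min lexx orbT.
have E : fuw (x + c1 *: u + c2 *: w) = fwu (x + c3 *: w + c4 *: u).
  apply: (mulfI (lt0r_neq0 h0)); apply: (mulfI (lt0r_neq0 h0)).
  by rewrite -E1 -E2 [x + h *: u + _]addrAC; lra.
have : `|fuw x - fwu x| <= e + e.
  have -> : fuw x - fwu x = (fuw x - fuw (x + c1 *: u + c2 *: w)) -
      (fwu x - fwu (x + c3 *: w + c4 *: u)) by rewrite E; lra.
  by rewrite (le_trans (ler_normB _ _))// lerD//; [exact: H1|exact: H2].
have : 0 < `|fuw x - fwu x| by rewrite normr_gt0 subr_eq0.
by rewrite /e => ? ?; exfalso; lra.
Qed.

End directional_derivatives.

Lemma continuous_sum (R : realType) (X : topologicalType) (I : Type) (r : seq I)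
    (F : I -> X -> R) : (forall i, continuous (F i)) ->
  continuous (fun x => \sum_(i <- r) F i x).
Proof. by move=> cF; apply: continuous_big => //; exact: add_continuous. Qed.

Section partial_derivatives.
Context {R : realType} {n : nat}.
Implicit Types (f : 'rV[R]_n -> R) (x v : 'rV[R]_n).

Lemma normr_coord (v : 'rV[R]_n) i : `|v 0 i| <= `|v|.
Proof.
have /mapP[j Hj ->] : `|v 0 i| \in [seq `|v x.1 x.2| | x : 'I_1 * 'I_n].
  by apply/mapP; exists (0, i) => //=; rewrite mem_enum.
by rewrite [leRHS]/Num.norm/= mx_normrE; apply/bigmax_geP; right => /=; exists j.
Qed.

(** Induction on the coordinates of [v]: the new coordinate is the direction with a continuous
    derivative in [is_derive_dirD], the sum already treated is the other one. *)
Lemma C1_is_derive f x v : C1 f ->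
  is_derive x v f (\sum_i v 0 i * partial i f x).
Proof.
move=> Cf; rewrite {1}[v]row_sum_delta.
elim: (index_enum _) x => [|i r IH] x.
  rewrite !big_nil; apply: is_derive_lineP.
  under eq_fun do rewrite scaler0 addr0.
  exact: is_derive_cst.
rewrite !big_cons; apply: (@is_derive_dirD _ _ f x _ _ (fun y => v 0 i * partial i f y)) => //.
  move=> y; apply: is_derive_dirZ; have [h _] := Cf i.
  by apply: DeriveDef; [exact: h|].
by apply: continuousM; [exact: cst_continuous|have [_] := Cf i; exact].
Qed.

(** [C1] speaks of coordinate derivatives only. Near [x] the sum [S] of their absolute values stays
    below [S x + 1], so the mean value theorem gives a Lipschitz bound from [x]. *)
Lemma C1_continuous f : C1 f -> continuous f.
Proof.
move=> Cf x.
pose S y := \sum_i `|partial i f y|.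
have cS : {for x, continuous S}.
  apply: continuous_sum => i y.
  by apply: continuous_comp; [have [_] := Cf i; exact|exact: norm_continuous].
have /cvgrPdist_le/(_ _ ltr01)/nbhs_ballP[r r0 Hr] := cS.
have S0 y : 0 <= S y by apply: sumr_ge0.
apply/(@cvgrPdist_le _ _ _ (nbhs x) (nbhs_filter x)) => e e0.
apply/nbhs_ballP; exists (Num.min r (e / (S x + 1))).
  by rewrite /= lt_min r0 divr_gt0// ltr_wpDl.
move=> y; rewrite -ball_normE/= lt_min => /andP[yr ye].
have [c c1 E] := mean_value_line 1 (fun t => C1_is_derive (x + t *: (y - x)) (y - x) Cf).
have -> : f x - f y = - (f (x + 1 *: (y - x)) - f x).
  by rewrite scale1r [x + _]addrC subrK opprB.
rewrite E mul1r normrN (le_trans (ler_norm_sum _ _ _))//.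
apply: (@le_trans _ _ (`|y - x| * S (x + c *: (y - x)))).
  by rewrite mulr_sumr ler_sum// => i _; rewrite normrM ler_wpM2r// normr_coord.
have Sb : S (x + c *: (y - x)) <= S x + 1.
  have /Hr/= : ball x r (x + c *: (y - x)).
    rewrite -ball_normE/= opprD addrA subrr sub0r normrN normrZ.
    rewrite normr1 in c1; apply: le_lt_trans yr; rewrite distrC.
    by rewrite ler_piMl.
  by rewrite ler_norml => /andP[]; lra.
apply: (@le_trans _ _ (`|y - x| * (S x + 1))); first by rewrite ler_wpM2l.
by rewrite -ler_pdivlMr ?ltr_wpDl// distrC ltW.
Qed.

End partial_derivatives.

(** * The generator and the maximum principle *)

(** One-sided for two reasons: a maximum over one period may sit at its initial time, where only
    later times can be compared, and the test function that identifies the law of time has a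
    kink. *)
Definition right_derive (R : realType) (h : R -> R) (t d : R) : Prop :=
  (fun e => e^-1 * (h (t + e) - h t)) @ 0^'+ --> d.

Lemma derivable_right_derive (R : realType) (h : R -> R) (t : R) :
  derivable h t 1 -> right_derive h t (derive1 h t).
Proof.
rewrite /derivable => /cvg_ex[d Hd].
have -> : derive1 h t = d by rewrite derive1E; exact: cvg_lim Hd.
move=> A /Hd [e e0 Ae]; exists e => // x xe x0.
have := Ae x xe (lt0r_neq0 x0); rewrite /= [x%:A]mulr1 [x + t]addrC; exact.
Qed.

(* [f] is only differentiated along the drift [b z t] and, twice, along the
   columns of [sigma z t]; the Lyapunov function has no other second
   derivatives.  Time derivatives are taken from the right. *)
Definition generator_at (R : realType) (N k : nat) (b : 'rV[R]_N -> R -> 'rV[R]_N)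
    (sigma : 'rV[R]_N -> R -> 'M[R]_(N, k)) (f : 'rV[R]_N -> R -> R)
    (z : 'rV[R]_N) (t g : R) : Prop :=
  exists ft fb (fs : 'I_k -> R),
  [/\ right_derive (f z) t ft,
      is_derive (0 : R) (1 : R) (fun s : R => f (z + s *: b z t) t) fb,
      forall i, exists df : R -> R,
        (forall r : R, is_derive r (1 : R)
           (fun s : R => f (z + s *: (col i (sigma z t))^T) t) (df r)) /\
        is_derive (0 : R) (1 : R) df (fs i)
    & g = ft + fb + 2^-1 * \sum_i fs i].

Section max_second_derivative.
Context {R : realType}.

Lemma right_derive_max (h : R -> R) (t d r : R) : 0 < r ->
  (forall s, t <= s < t + r -> h s <= h t) -> right_derive h t d -> d <= 0.
Proof.
move=> r0 hmax hd; apply: (cvgr_to_le hd); near=> e.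
have e0 : 0 < e by [].
rewrite pmulr_rle0 ?invr_gt0// subr_le0; apply: hmax.
by rewrite lerDl (ltW e0)/= ltrD2l; near: e; exact: nbhs_right_lt.
Unshelve. all: by end_near. Qed.

Lemma derive_max0 (h : R -> R) (d : R) : is_derive (0 : R) (1 : R) h d ->
  (forall s, h s <= h 0) -> d = 0.
Proof.
move=> [hd <-] hmax.
apply/eqP; rewrite eq_le; apply/andP; split.
  rewrite ['D_1 h 0]cvg_at_rightE; last exact: hd.
  apply: limr_le.
    rewrite -(cvg_at_rightE (fun e : R => e^-1 *: ((h \o shift 0) _ - h 0))) //.
    apply: cvg_trans hd; apply: cvg_app.
    by move=> A [e e0 Ae]; exists e => // x xe x0; apply: Ae => //; exact: lt0r_neq0.
  near=> e; have e0 : 0 < e by [].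
  by rewrite /GRing.scale/= pmulr_rle0 ?invr_gt0// subr_le0.
rewrite ['D_1 h 0]cvg_at_leftE; last exact: hd.
apply: limr_ge.
  rewrite -(cvg_at_leftE (fun e : R => e^-1 *: ((h \o shift 0) _ - h 0))) //.
  apply: cvg_trans hd; apply: cvg_app.
  by move=> A [e e0 Ae]; exists e => // x xe x0; apply: Ae => //; exact: ltr0_neq0.
near=> e; have e0 : e < 0 by [].
by rewrite /GRing.scale/= nmulr_rge0 ?invr_lt0// subr_le0.
Unshelve. all: by end_near. Qed.

(** If [d > 0], then [dh 0 = 0] makes [dh] positive just to the right of 0, and the mean value
    theorem finds a value above [h 0]. *)
Lemma derive2_max0 (h dh : R -> R) (d : R) :
  (forall r, is_derive r (1 : R) h (dh r)) -> is_derive (0 : R) (1 : R) dh d ->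
  (forall s, h s <= h 0) -> d <= 0.
Proof.
move=> hd dhd hmax; rewrite leNgt; apply/negP => d0.
have dh0 : dh 0 = 0 by exact: derive_max0 (hd 0) hmax.
have [r r0 Hr] : exists2 r, 0 < r & forall s, 0 < s < r -> 0 < dh s.
  case: dhd => cd dE.
  have : (fun e : R => e^-1 *: ((dh \o shift 0) (e *: 1) - dh 0)) @ 0^' --> d.
    by rewrite -dE.
  move=> /cvgrPdist_lt/(_ _ d0)[r r0 H]; exists r => // s /andP[s0 sr].
  have := H s; rewrite /= sub0r normrN gtr0_norm// sr gt_eqF// => /(_ isT isT).
  rewrite dh0 subr0 addr0 [s%:A]mulr1 ltr_norml => /andP[_].
  by rewrite ltrBlDr ltrDl /GRing.scale/= pmulr_rgt0 ?invr_gt0.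
have ch : continuous h.
  move=> s; apply/differentiable_continuous/derivable1_diffP.
  by have [] := hd s.
have r2 : 0 < r / 2 by rewrite divr_gt0.
have [c] := MVT r2 (fun s _ => hd s) (continuous_subspaceT ch).
rewrite in_itv/= => /andP[c0 cr] E.
have : 0 < dh c by apply: Hr; rewrite c0/=; lra.
have := hmax (r / 2); rewrite -subr_le0 E subr0 pmulr_lle0 ?divr_gt0//.
by move=> h1 h2; have := lt_le_trans h2 h1; rewrite ltxx.
Qed.

End max_second_derivative.

Section generator_at_theory.
Context {R : realType} {N k : nat} (b : 'rV[R]_N -> R -> 'rV[R]_N)
  (sigma : 'rV[R]_N -> R -> 'M[R]_(N, k)).
Implicit Types (f : 'rV[R]_N -> R -> R) (z : 'rV[R]_N) (t : R).
Notation gen := (generator_at b sigma).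

Lemma generator_at0 z t : gen (fun _ _ => 0) z t 0.
Proof.
exists 0, 0, (fun=> 0); split.
- rewrite /right_derive; under eq_fun do rewrite subrr mulr0.
  exact: cvg_cst.
- exact: is_derive_cst.
- by move=> i; exists (fun=> 0); split => *; exact: is_derive_cst.
- by rewrite big1// mulr0 !addr0.
Qed.

Lemma generator_at_lin f1 f2 z t g1 g2 (c : R) : gen f1 z t g1 -> gen f2 z t g2 ->
  gen (fun z t => f1 z t + c * f2 z t) z t (g1 + c * g2).
Proof.
move=> [t1 [b1 [s1 [T1 B1 S1 ->]]]] [t2 [b2 [s2 [T2 B2 S2 ->]]]].
exists (t1 + c * t2), (b1 + c * b2), (fun i => s1 i + c * s2 i); split.
- rewrite /right_derive.
  have -> : (fun e => e^-1 * (f1 z (t + e) + c * f2 z (t + e) - (f1 z t + c * f2 z t))) =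
      (fun e => e^-1 * (f1 z (t + e) - f1 z t) + c * (e^-1 * (f2 z (t + e) - f2 z t))).
    by apply/funext => e; lra.
  by apply: cvgD; [exact: T1|apply: cvgM; [exact: cvg_cst|exact: T2]].
- by have := is_deriveD B1 (is_deriveZ c B2).
- move=> i; have [d1 [D1 E1]] := S1 i; have [d2 [D2 E2]] := S2 i.
  exists (d1 + (c \*: d2)); split => [r|].
    by have := is_deriveD (D1 r) (is_deriveZ c (D2 r)).
  by have := is_deriveD E1 (is_deriveZ c E2).
- rewrite big_split/= -mulr_sumr; lra.
Qed.

Lemma generator_at_max f z t g r : 0 < r -> gen f z t g ->
  (forall s, t <= s < t + r -> f z s <= f z t) -> (forall z', f z' t <= f z t) ->
  g <= 0.
Proof.
move=> r0 [ft [fb [fs [T1 B1 S1 ->]]]] tmax zmax.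
have ft0 : ft <= 0 by exact: right_derive_max r0 tmax T1.
have -> : fb = 0 by apply: (derive_max0 B1) => s; rewrite scale0r addr0.
have : \sum_i fs i <= 0.
  apply: sumr_le0 => i _; have [df [D1 D2]] := S1 i.
  by apply: (derive2_max0 D1 D2) => s; rewrite scale0r addr0.
lra.
Qed.

(** The second-order part [sum a^ij d_i d_j] is half the sum of the second derivatives along the
    columns of [sigma], because [a = sigma sigma^T / 2]. *)
Lemma generator_at_C2 f z t : (forall t, C2 (f ^~ t)) ->
  (forall z t, derivable (f z) t 1) -> gen f z t (generator b sigma f z t).
Proof.
move=> fC2 ft.
pose s i : 'rV[R]_N := (col i (sigma z t))^T.
exists (derive1 (f z) t), (\sum_j b z t 0 j * partial j (f ^~ t) z),
  (fun l => \sum_j s l 0 j * \sum_i s l 0 i * partial i (partial j (f ^~ t)) z).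
split.
- exact: derivable_right_derive.
- by apply: (@is_derive_line _ _ (f ^~ t)); rewrite scale0r addr0; apply: C1_is_derive; exact: (fC2 t).1.
- move=> l; exists (fun r => \sum_j s l 0 j * partial j (f ^~ t) (z + r *: s l)).
  split => [r|].
    by apply: (@is_derive_line _ _ (f ^~ t)); apply: C1_is_derive; exact: (fC2 t).1.
  have -> : (fun r : R => \sum_j s l 0 j * partial j (f ^~ t) (z + r *: s l)) =
      \sum_j (s l 0 j \*: (fun r : R => partial j (f ^~ t) (z + r *: s l))).
    by apply/funext => r; rewrite fct_sumE.
  apply: is_derive_sum => j.
  have D : is_derive (0 : R) (1 : R) (fun r : R => partial j (f ^~ t) (z + r *: s l))
      (\sum_i s l 0 i * partial i (partial j (f ^~ t)) z).
    apply: (@is_derive_line _ _ (partial j (f ^~ t))); rewrite scale0r addr0.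
    by apply: C1_is_derive; exact: (fC2 t).2.
  have := is_deriveZ (s l 0 j) D.
  by rewrite /GRing.scale/= mulr_sumr; under eq_bigr do rewrite mulrA.
- rewrite /generator; rewrite -addrA [X in _ + X]addrC addrA; congr (_ + _ + _).
  rewrite exchange_big [in RHS]exchange_big/= [RHS]mulr_sumr.
  apply: eq_bigr => j _.
  under [in RHS]eq_bigr do rewrite mulr_sumr.
  rewrite exchange_big/= mulr_sumr; apply: eq_bigr => i _.
  rewrite /diffusion_coef mxE mxE -mulrA mulr_suml; congr (_ * _).
  by apply: eq_bigr => l _; rewrite !mxE mulrA [_ * sigma _ _ i l]mulrC.
Qed.

End generator_at_theory.

(** * The stationary mean, by duality with the maximum principle *)

Lemma closed_norm_ball (R : realType) (n : nat) (r : R) :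
  closed [set x : 'rV[R]_n | `|x| <= r].
Proof.
have -> : [set x : 'rV[R]_n | `|x| <= r] = Num.norm @^-1` [set s : R | s <= r] by [].
apply: (@closed_comp _ _ (Num.norm : 'rV[R]_n -> R)) => [x _|]; last exact: closed_le.
exact: norm_continuous.
Qed.

Lemma compact_norm_ball (R : realType) (n : nat) (r : R) :
  compact [set x : 'rV[R]_n | `|x| <= r].
Proof.
apply: bounded_closed_compact; last exact: closed_norm_ball.
by exists r; split => [|M rM x /= xr]; [exact: num_real|exact: le_trans (ltW rM)].
Qed.

Definition cylinder (R : realType) (n : nat) (T r : R) : set ('rV[R]_n * R) :=
  [set p | `|p.1| <= r /\ 0 <= p.2 <= T].

Lemma compact_cylinder (R : realType) (n : nat) (T r : R) :
  compact (@cylinder R n T r).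
Proof.
have -> : @cylinder R n T r = [set x | `|x| <= r] `*` `[0, T]%classic.
  by apply/seteqP; split => -[x t] /=; rewrite in_itv.
by apply: compact_setX; [exact: compact_norm_ball|exact: segment_compact].
Qed.

Section stationary_mean.
Context {R : realType} {N k : nat} (b : 'rV[R]_N -> R -> 'rV[R]_N)
  (sigma : 'rV[R]_N -> R -> 'M[R]_(N, k)) (T : R).
Hypothesis T0 : 0 < T.
Notation gen := (generator_at b sigma).

(** [g] plays the part of [L f]. Everything concerns a single period: periodicity is expressed by
    equal end values, and the generator is taken on [[0, T)], where right derivatives stay inside
    the period. *)
Definition test_function (f g : 'rV[R]_N -> R -> R) : Prop :=
  [/\ forall z t, 0 <= t < T -> gen f z t (g z t),
      continuous (fun p : 'rV[R]_N * R => f p.1 p.2),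
      exists B, forall z t, 0 <= t <= T -> `|f z t| <= B
    & forall z, f z 0 = f z T].

Lemma test_functionD f1 g1 f2 g2 (c : R) :
  test_function f1 g1 -> test_function f2 g2 ->
  test_function (fun z t => f1 z t + c * f2 z t) (fun z t => g1 z t + c * g2 z t).
Proof.
move=> [G1 C1 [B1 H1] P1] [G2 C2 [B2 H2] P2]; split.
- by move=> z t tT; apply: generator_at_lin; [exact: G1|exact: G2].
- move=> p; apply: cvgD; first exact: C1.
  by apply: cvgM; [exact: cvg_cst|exact: C2].
- exists (B1 + `|c| * B2) => z t tT; rewrite (le_trans (ler_normD _ _))// lerD ?H1//.
  by rewrite normrM ler_wpM2l// H2.
- by move=> z; rewrite P1 P2.
Qed.

Lemma test_function0 : test_function (fun _ _ => 0) (fun _ _ => 0).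
Proof.
split => //; first by move=> z t _; exact: generator_at0.
- exact: cst_continuous.
- by exists 0 => z t _; rewrite normr0.
Qed.

Variables (U LU : 'rV[R]_N -> R -> R) (W : 'rV[R]_N -> R) (C : R).
Hypothesis U_gen : forall z t, 0 <= t < T -> gen U z t (LU z t).
Hypothesis U_cont : continuous (fun p : 'rV[R]_N * R => U p.1 p.2).
Hypothesis U_per : forall z, U z 0 = U z T.
Hypothesis U_coercive : forall A, exists r, forall z t,
  0 <= t <= T -> U z t <= A -> `|z| <= r.
Hypothesis W_ge0 : forall z, 0 <= W z.
Hypothesis W_coercive : forall A, exists r, forall z, W z <= A -> `|z| <= r.
Hypothesis U_lyapunov : forall z t, 0 <= t < T -> LU z t <= C - W z.

Lemma maximum_principle f g s : test_function f g -> 0 < s ->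
  exists z t, 0 <= t < T /\ g z t - s * LU z t <= 0.
Proof.
move=> [fgen fcont [B fB] fper] s0.
pose h z t := f z t + (- s) * U z t.
have hcont : continuous (fun p : 'rV[R]_N * R => h p.1 p.2).
  move=> p; apply: cvgD; first exact: fcont.
  by apply: cvgM; [exact: cvg_cst|exact: U_cont].
(* Wherever [h] is at least its value at the origin, [U] is at most this number; a maximum over the
   cylinder of radius [r] is therefore global. *)
have [r Hr] := U_coercive (s^-1 * (B - h 0 0)).
have hr z t : 0 <= t <= T -> h 0 0 <= h z t -> `|z| <= r.
  move=> tT h0; apply: (Hr _ _ tT); rewrite ler_pdivlMl//.
  have := le_trans (ler_norm _) (fB z t tT).
  by move: h0; rewrite {2}/h; lra.
have h00 : (0 : R) <= 0 <= T by rewrite lexx ltW.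
have [[z t] /set_mem/= [zr tT] hmax] :
    exists2 c, c \in @cylinder R N T r & forall p, p \in @cylinder R N T r ->
      h p.1 p.2 <= h c.1 c.2.
  apply: (@compact_EVT_max _ _ (fun p : 'rV[R]_N * R => h p.1 p.2)).
  - by exists (0, 0); split => //=; exact: hr h00 (lexx _).
  - exact: compact_cylinder.
  - exact: continuous_subspaceT.
have hmax' z' t' : 0 <= t' <= T -> h z' t' <= h z t.
  move=> t'T; have [h0|/ltW h0] := leP (h 0 0) (h z' t').
    by apply: (hmax (z', t')); rewrite inE; split => //=; exact: hr h0.
  apply: (le_trans h0); apply: (hmax (0, 0)); rewrite inE; split => //=.
  exact: hr h00 (lexx _).
(* By periodicity the maximum is also attained at a time [t0 < T], where the
   right time derivative can be compared. *)
have [t0 t0T hE] : exists2 t0, 0 <= t0 < T & h z t0 = h z t.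
  move: tT => /= /andP[t0]; rewrite le_eqVlt => /orP[/eqP ->|tT]; last first.
    by exists t => //; rewrite t0.
  by exists 0; rewrite ?lexx//= /h fper U_per.
exists z, t0; split => //.
have /andP[t00 t0T'] := t0T.
have hgen := generator_at_lin (- s) (fgen z t0 t0T) (U_gen z t0T).
rewrite -mulNr; apply: (@generator_at_max _ _ _ b sigma h z t0 _ (T - t0)) => //.
- by rewrite subr_gt0.
- move=> u; rewrite addrC subrK => /andP[tu uT].
  by rewrite hE; apply: hmax'; rewrite (le_trans t00)//= ltW.
- by move=> z'; rewrite hE; apply: hmax'; rewrite t00 ltW.
Qed.

(** Formally [g] and [LU] have mean zero under a stationary law, so each such [c] should bound the
    mean of [f]. The condition [s >= 0] is dictated by the maximum principle: [u - s * U] attains a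
    maximum, not a minimum. Values of [f] outside [[0, T)] do not count, which confines the mean to
    one period. *)
Let upper (f : 'rV[R]_N * R -> R) : set R := [set c | exists u g s,
  [/\ test_function u g, 0 <= s &
      forall z t, 0 <= t < T -> f (z, t) <= c + g z t - s * LU z t]].

Let upper_ge f c m : upper f c -> (forall p, m <= f p) -> m <= c.
Proof.
move=> [u [g [s [tu s0 fc]]]] fm; rewrite leNgt; apply/negP => cm.
(* [s] may be 0 while the maximum principle needs a positive weight on [U]. The extra weight [d]
   costs at most [d * C], which this choice keeps below [m - c]. *)
pose d := (m - c) / (`|C| + 1).
have C1 : 0 < `|C| + 1 by rewrite ltr_wpDl.
have d0 : 0 < d by rewrite divr_gt0// subr_gt0.
have sd0 : 0 < s + d by rewrite ltr_wpDl.
have [z [t [tT H]]] := maximum_principle tu sd0.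
have h1 := fc z t tT; have h2 := fm (z, t).
have h3 : d * LU z t <= d * (C - W z) by rewrite ler_wpM2l ?(ltW d0)// U_lyapunov.
have h4 : 0 <= d * W z by rewrite mulr_ge0// ltW.
have h5 : d * C <= d * `|C| by rewrite ler_wpM2l ?(ltW d0)// ler_norm.
have h6 : d * (`|C| + 1) = m - c by rewrite /d divfK// gt_eqF.
lra.
Qed.

Let p f := inf (upper f).

Let upper_lb f : bounded_fct f -> has_lbound (upper f).
Proof.
move=> [M hM]; exists (- M) => c fc; apply: upper_ge fc _ => q.
by have := hM q; rewrite ler_norml => /andP[].
Qed.

Let upper_bound f M : (forall q, f q <= M) -> upper f M.
Proof.
move=> fM; exists (fun _ _ => 0), (fun _ _ => 0), 0; split => //.
  exact: test_function0.
by move=> z t _; rewrite mul0r subr0 addr0.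
Qed.

Let upper_neq0 f : bounded_fct f -> upper f !=set0.
Proof.
move=> [M hM]; exists M; apply: upper_bound => q.
exact: le_trans (ler_norm _) (hM q).
Qed.

Let p_le f c : bounded_fct f -> upper f c -> p f <= c.
Proof. by move=> bf fc; apply: ge_inf => //; exact: upper_lb. Qed.

Let p_ge f m : bounded_fct f -> (forall q, m <= f q) -> m <= p f.
Proof.
move=> bf fm; apply: lb_le_inf; first exact: upper_neq0.
by move=> c fc; exact: upper_ge fc fm.
Qed.

Let p_sublinear : sublinear_on (@bounded_fct R ('rV[R]_N * R)) p.
Proof.
split.
- have b0 := bounded_cst ('rV[R]_N * R) (0 : R).
  apply/eqP; rewrite eq_le; apply/andP; split.
    by apply: (p_le b0); apply: upper_bound.
  exact: (p_ge b0).
- move=> f1 f2 bf1 bf2; apply/ler_addgt0Pl => e e0.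
  have e2 : 0 < e / 2 by rewrite divr_gt0.
  have [c1 U1 H1] := inf_adherent e2 (conj (upper_neq0 bf1) (upper_lb bf1)).
  have [c2 U2 H2] := inf_adherent e2 (conj (upper_neq0 bf2) (upper_lb bf2)).
  apply: (@le_trans _ _ (c1 + c2)); last by rewrite /p; lra.
  apply: p_le; first exact: bounded_fctD.
  move: U1 U2 => [u1 [g1 [s1 [T1 S1 E1]]]] [u2 [g2 [s2 [T2 S2 E2]]]].
  exists (fun z t => u1 z t + 1 * u2 z t), (fun z t => g1 z t + 1 * g2 z t), (s1 + s2).
  split; [exact: test_functionD|exact: addr_ge0|].
  move=> z t tT; have := E1 z t tT; have := E2 z t tT.
  by rewrite -[(f1 + f2) _]/(f1 (z, t) + f2 (z, t)); lra.
- move=> c f c0 bf; rewrite -ler_pdivrMl//; apply: lb_le_inf; first exact: upper_neq0.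
  move=> d [u [g [s [Tu S0 E]]]]; rewrite ler_pdivrMl//.
  apply: p_le; first exact: bounded_fctZ.
  exists (fun z t => 0 + c * u z t), (fun z t => 0 + c * g z t), (c * s); split.
  + by apply: test_functionD => //; exact: test_function0.
  + by rewrite mulr_ge0// ltW.
  + move=> z t tT; rewrite -[(c *: f) _]/(c * f (z, t)).
    have := E z t tT; rewrite -(ler_pM2l c0); lra.
Qed.

(** The functional lies below [p]. Since both [u] and [- u] are test functions, the generator of [u]
    gets mean 0; positivity and normalization follow from the constant upper bounds in [upper]. *)
Lemma stationary_mean : exists L : ('rV[R]_N * R -> R) -> R,
  [/\ mean_functional L,
      forall u g (G : 'rV[R]_N * R -> R), test_function u g -> bounded_fct G ->
        (forall z t, 0 <= t < T -> G (z, t) = g z t) -> L G = 0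
    & forall e, 0 < e -> exists r, 1 - e <= L \1_(@cylinder R N T r)].
Proof.
have [L [Lp LD LZ]] := hahn_banach (@bounded_fctD R _) (@bounded_fctZ R _)
  (bounded_cst ('rV[R]_N * R) (0 : R)) p_sublinear.
have bN (f : 'rV[R]_N * R -> R) : bounded_fct f -> bounded_fct ((- 1) *: f).
  exact: bounded_fctZ.
have Lub f M : bounded_fct f -> (forall q, f q <= M) -> L f <= M.
  by move=> bf fM; apply: le_trans (Lp f bf) _; apply: p_le => //; exact: upper_bound.
have Llb f M : bounded_fct f -> (forall q, M <= f q) -> M <= L f.
  move=> bf fM; have := Lub ((- 1) *: f) (- M) (bN f bf).
  rewrite LZ// mulN1r lerN2; apply => q.
  by rewrite -[(_ *: _) q]/(-1 * f q) mulN1r lerN2.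
have meanL : mean_functional L.
  split => //; first by move=> f bf f0; exact: Llb.
  have b1 := bounded_cst ('rV[R]_N * R) (1 : R).
  by apply/eqP; rewrite eq_le Lub//= Llb.
exists L; split => //.
- have le0 u g (G : 'rV[R]_N * R -> R) : test_function u g -> bounded_fct G ->
      (forall z t, 0 <= t < T -> G (z, t) = g z t) -> L G <= 0.
    move=> tu bG GE; apply: le_trans (Lp G bG) _; apply: p_le => //.
    by exists u, g, 0; split => // z t tT; rewrite GE// mul0r subr0 add0r.
  move=> u g G tu bG GE; apply/eqP; rewrite eq_le (le0 u g)//=.
  have := le0 _ _ ((- 1) *: G) (test_functionD (-1) test_function0 tu) (bN G bG).
  rewrite LZ// mulN1r oppr_le0; apply => z t tT.
  by rewrite -[(_ *: _) _]/(-1 * G (z, t)) GE// add0r.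
- move=> e e0.
  (* Outside the cylinder [W > A], so its indicator is at most [W / A <= (C - LU) / A]. The
     multiplier [s = A^-1] then bounds the escaping mass by [C / A <= e]. *)
  pose A := (`|C| + 1) / e.
  have C1 : 0 < `|C| + 1 by rewrite ltr_wpDl.
  have A0 : 0 < A by rewrite divr_gt0.
  have [r Hr] := W_coercive A; exists r.
  pose K := @cylinder R N T r.
  have bI := bounded_indic R (X := ('rV[R]_N * R)%type).
  have <- : L \1_K + L \1_(~` K) = 1.
    rewrite -LD//; have [_ _ _ <-] := meanL; congr (L _).
    apply/funext => q; rewrite -[LHS]/(\1_K q + \1_(~` K) q) !indicE in_setC.
    by case: (q \in K); rewrite ?addr0 ?add0r.
  suff : L \1_(~` K) <= e by lra.
  apply: (@le_trans _ _ (C / A)); last first.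
    rewrite ler_pdivrMr// /A mulrCA divff ?gt_eqF// mulr1.
    by have := ler_norm C; lra.
  apply: le_trans (Lp _ (bI _)) _; apply: p_le => //.
  exists (fun _ _ => 0), (fun _ _ => 0), A^-1; split.
  + exact: test_function0.
  + by rewrite invr_ge0 ltW.
  + move=> z t tT; rewrite addr0.
    have h1 : A^-1 * LU z t <= A^-1 * (C - W z).
      by rewrite ler_wpM2l ?invr_ge0 ?(ltW A0)// U_lyapunov.
    suff : \1_(~` K) (z, t) <= A^-1 * W z by lra.
    rewrite indicE; case: (boolP (_ \in _)) => [/set_mem nK|_]; last first.
      by rewrite mulr_ge0 ?invr_ge0 ?(ltW A0).
    rewrite ler_pdivlMl// mulr1 leNgt; apply/negP => WA; apply: nK.
    split; first exact/Hr/ltW.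
    by move: tT => /= /andP[-> /ltW].
Qed.

End stationary_mean.

(** * Disintegration *)

Section rational_balls.
Context {R : realType} {N : nat}.
Notation V := 'rV[R]_N.

(** Countability is the point: densities obey additivity only almost everywhere, so a content can be
    built for a given time only on a countable family. Finite unions of these compact balls exhaust
    every open set. *)
Definition rational_ball (p : 'rV[rat]_N * rat) : set V :=
  [set x | `|x - map_mx ratr p.1| <= ratr p.2].

Definition rational_set (s : seq ('rV[rat]_N * rat)) : set V :=
  \big[setU/set0]_(p <- s) rational_ball p.

Lemma closed_rational_ball p : closed (rational_ball p).
Proof.
have -> : rational_ball p = (fun x : V => x - map_mx ratr p.1) @^-1`
    [set x | `|x| <= ratr p.2] by [].
apply: closed_comp => [x _|]; last exact: closed_norm_ball.
by apply: (@continuousB _ _ _ id (cst _)); [exact: cvg_id|exact: cst_continuous].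
Qed.

Lemma closed_rational_set s : closed (rational_set s).
Proof.
rewrite /rational_set; elim/big_ind : _ => //; first exact: closed0.
  by move=> A B; exact: closedU.
by move=> p _; exact: closed_rational_ball.
Qed.

Lemma compact_rational_set s : compact (rational_set s).
Proof.
rewrite /rational_set; elim/big_ind : _ => //; first exact: compact0.
  by move=> A B; exact: compactU.
move=> p _; apply: bounded_closed_compact; last exact: closed_rational_ball.
exists (ratr p.2 + `|map_mx ratr p.1 : V|); split => [|M MM x /= xp]; first exact: num_real.
apply: le_trans (ltW MM); rewrite -[x in leLHS](subrK (map_mx ratr p.1)).
by rewrite (le_trans (ler_normD _ _))// lerD2r.
Qed.

Lemma rational_set_cat s1 s2 :
  rational_set (s1 ++ s2) = rational_set s1 `|` rational_set s2.
Proof. by rewrite /rational_set big_cat. Qed.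

Lemma rational_vector_approx (x : V) (e : R) : 0 < e ->
  exists q : 'rV[rat]_N, `|x - map_mx ratr q| < e.
Proof.
move=> e0.
have [q Hq] : {q : 'I_N -> rat & forall i, `|x 0 i - ratr (q i)| < e}.
  apply: (@choice _ _ (fun i (q : rat) => `|x 0 i - ratr q| < e)) => i.
  have xe : x 0 i - e < x 0 i + e by lra.
  have [q] := rat_in_itvoo xe; rewrite in_itv/= => /andP[q1 q2].
  by exists q; rewrite ltr_norml; lra.
exists (\row_i q i); rewrite [ltLHS]/Num.norm/= mx_normrE.
by apply/bigmax_ltP; split => // -[i j] _ /=; rewrite !mxE ord1.
Qed.

Lemma rational_ball_basis (x : V) (G : set V) : open G -> G x ->
  exists p, rational_ball p `<=` G /\ nbhs x (rational_ball p).
Proof.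
move=> oG Gx.
have /nbhs_ballP[e /= e0 eG] : nbhs x G by exact: open_nbhs_nbhs.
(* The centre is within [e / 4] of [x] and the radius strictly between [e / 4] and [e / 2]: [x] is
   interior to the ball, and the ball stays at distance less than [e] from [x]. *)
have e4 : 0 < e / 4 by rewrite divr_gt0.
have [q qx] := rational_vector_approx x e4.
have e42 : e / 4 < e / 2 by lra.
have [r] := rat_in_itvoo e42; rewrite in_itv/= => /andP[r1 r2].
exists (q, r); split.
  move=> y; rewrite /rational_ball/= => yq; apply: eG; rewrite -ball_normE/=.
  have -> : x - y = (x - map_mx ratr q) - (y - map_mx ratr q).
    by rewrite opprB addrA subrK.
  by rewrite (le_lt_trans (ler_normB _ _))//; lra.
apply/nbhs_ballP; exists (ratr r - e / 4); first by rewrite /= subr_gt0.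
move=> y; rewrite -ball_normE/= => xy; rewrite /rational_ball/=.
have -> : y - map_mx ratr q = (x - map_mx ratr q) - (x - y).
  by rewrite opprB [RHS]addrC addrA subrK.
by rewrite (le_trans (ler_normB _ _))//; lra.
Qed.

Lemma rational_set_exhaust (G : set V) : open G ->
  exists s : nat -> seq ('rV[rat]_N * rat),
    [/\ forall n m, (n <= m)%N -> rational_set (s n) `<=` rational_set (s m),
        forall n, rational_set (s n) `<=` G &
        G `<=` \bigcup_n rational_set (s n)].
Proof.
move=> oG.
pose f n : seq ('rV[rat]_N * rat) :=
  if unpickle n is Some p then
    if `[< rational_ball p `<=` G >] then [:: p] else [::] else [::].
pose s := fix s n := if n is n'.+1 then s n' ++ f n' else [::].
exists s; split.
- move=> n m /subnKC <-; elim: (m - n)%N => [|k IH]; first by rewrite addn0.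
  by rewrite addnS /= rational_set_cat; apply: subset_trans IH _; exact: subsetUl.
- elim => [|n IH] /=; first by rewrite /rational_set big_nil.
  rewrite rational_set_cat subUset; split => //; rewrite /f.
  case: unpickle => [p|]; last by rewrite /rational_set big_nil.
  case: asboolP => // pG; last by rewrite /rational_set big_nil.
  by rewrite /rational_set big_seq1.
- move=> x Gx; have [p [pG xp]] := rational_ball_basis oG Gx.
  exists (pickle p).+1 => //=; rewrite rational_set_cat; right.
  rewrite /f pickleK asboolT// /rational_set big_seq1.
  exact: nbhs_singleton.
Qed.

End rational_balls.

Section finite_measure_of.
Context d (Y : measurableType d) (R : realType) (m : {measure set Y -> \bar R}).
(** The proof of finiteness is an argument of this alias so that the finite measure structure below
    can depend on it. *)
Definition finite_measure_of of (m setT < +oo)%E : set Y -> \bar R := m.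
Hypothesis moo : (m setT < +oo)%E.

HB.instance Definition _ := Measure.on (finite_measure_of moo).

Let fin : fin_num_fun (finite_measure_of moo).
Proof. exact: lty_fin_num_fun. Qed.

HB.instance Definition _ := Measure_isFinite.Build _ _ _ (finite_measure_of moo) fin.

End finite_measure_of.

Lemma pushforward_measure d d' (X : measurableType d) (Y : measurableType d')
    (R : realType) (m : {measure set X -> \bar R}) (f : X -> Y) :
  measurable_fun setT f ->
  exists m' : {measure set Y -> \bar R}, forall B, m' B = m (f @^-1` B).
Proof.
move=> mf; pose m' := pushforward m f : {measure set Y -> \bar R}.
by exists (m' mf).
Qed.

(** The domination [m1 <= m2] supplies both the finiteness of [m1] and its absolute continuity. *)
Lemma radon_nikodym_le d (Y : measurableType d) (R : realType)
    (m1 m2 : {measure set Y -> \bar R}) :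
  (m2 setT < +oo)%E -> (forall B, measurable B -> (m1 B <= m2 B)%E) ->
  exists r : Y -> R, [/\ measurable_fun setT r, forall y, 0 <= r y &
    forall B, measurable B -> m1 B = (\int[m2]_(y in B) (r y)%:E)%E].
Proof.
move=> m2oo m12.
have m1oo : (m1 setT < +oo)%E by apply: le_lt_trans m2oo; exact: m12.
pose M1 : {finite_measure set Y -> \bar R} := finite_measure_of m1oo.
pose M2 : {finite_measure set Y -> \bar R} := finite_measure_of m2oo.
have [|f [f0 ffin fint fE]] := @radon_nikodym_sigma_finite _ _ _ M2 M1.
  apply/null_content_dominatesP => A mA m2A.
  by apply/eqP; rewrite eq_le measure_ge0 andbT -m2A; exact: m12.
exists (fine \o f); split.
- by apply: measurableT_comp => //; exact: measurable_int fint.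
- by move=> y; rewrite fine_ge0.
- by move=> B mB; rewrite -[LHS]/(M1 B) (fE B mB); apply: eq_integral => y _; rewrite /= fineK.
Qed.

Lemma ae_forall_count d (Y : measurableType d) (R : realType)
    (m : {measure set Y -> \bar R}) (I : countType) (P : I -> Y -> Prop) :
  (forall i, {ae m, forall y, P i y}) -> {ae m, forall y, forall i, P i y}.
Proof.
move=> mP.
have : \forall y \ae m, forall n, (fun n y => if unpickle n is Some i then P i y else True) n y.
  apply: ae_foralln => n; case: unpickle => [i|]; first exact: mP.
  exact/aeW.
by apply: filterS => y H i; have := H (pickle i); rewrite pickleK.
Qed.

Section disintegration.
Context {R : realType} {N : nat} d (Y : measurableType d).
Notation X := (borel R N).
Variables (nu : {measure set (X * Y)%type -> \bar R}) (lam : {measure set Y -> \bar R}).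
Hypothesis lam_fin : (lam setT < +oo)%E.
Hypothesis nu_marginal : forall B, measurable B -> nu (setT `*` B) = lam B.

Let open_measurable_borel (G : set X) : open (G : set 'rV[R]_N) -> measurable G.
Proof. by move=> oG; exact: sub_sigma_algebra. Qed.

Let Q := seq ('rV[rat]_N * rat).
Let K (s : Q) : set X := rational_set (R := R) s.

Let mK s : measurable (K s).
Proof.
rewrite -(setCK (K s)); apply: measurableC; apply: open_measurable_borel.
exact/closed_openC/closed_rational_set.
Qed.

Let density_ex (A : set X) : exists r : Y -> R, measurable A ->
  [/\ measurable_fun setT r, forall y, 0 <= r y &
    forall B, measurable B -> nu (A `*` B) = (\int[lam]_(y in B) (r y)%:E)%E].
Proof.
have [mA|nA] := pselect (measurable A); last by exists (fun=> 0) => /nA.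
have mAT := measurableX mA (@measurableT _ Y).
have [m1 m1E'] := pushforward_measure (mrestr nu mAT) measurable_snd.
have m1E B : m1 B = nu (A `*` B).
  rewrite m1E'; congr (nu _); apply/seteqP; split => -[x y] /= [].
    by move=> By [Ax _].
  by move=> Ax By.
have [//||r [mr r0 rE]] := @radon_nikodym_le _ Y R m1 lam.
  move=> B mB; rewrite m1E -nu_marginal//; apply: le_measure; rewrite ?inE.
  - exact: measurableX.
  - exact: measurableX.
  - by move=> [x y] [].
by exists r => _; split => // B mB; rewrite -rE// m1E.
Qed.

(** Chosen for each set separately: for a fixed [y] this need not be additive in [A], and each
    relation between the densities of different sets holds only off a null set. *)
Let density (A : set X) := sval (cid (density_ex A)).

Let densityP A : measurable A -> [/\ measurable_fun setT (density A),
    forall y, 0 <= density A y &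
    forall B, measurable B ->
      nu (A `*` B) = (\int[lam]_(y in B) (density A y)%:E)%E].
Proof. exact: (svalP (cid (density_ex A))). Qed.

Let nu_le A B : measurable A -> measurable B -> (nu (A `*` B) <= lam B)%E.
Proof.
move=> mA mB; rewrite -nu_marginal//; apply: le_measure; rewrite ?inE.
- exact: measurableX.
- exact: measurableX.
- by move=> [x y] [].
Qed.

Let lam_le B : measurable B -> (lam B <= lam setT)%E.
Proof. by move=> mB; apply: le_measure; rewrite ?inE. Qed.

Let density_integrable A : measurable A ->
  lam.-integrable setT (EFin \o density A).
Proof.
move=> mA; have [mr r0 rE] := densityP mA.
apply/integrableP; split; first exact/measurable_EFinP.
under eq_integral do rewrite /= ger0_norm//.
rewrite -rE//; apply: le_lt_trans lam_fin; exact: nu_le.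
Qed.

Let ae_eq_density A (f : Y -> R) : measurable A -> measurable_fun setT f ->
  (forall B, measurable B -> nu (A `*` B) = (\int[lam]_(y in B) (f y)%:E)%E) ->
  {ae lam, forall y, density A y = f y}.
Proof.
move=> mA mf fE; have [mr r0 rE] := densityP mA.
have := @integral_ae_eq _ _ _ lam setT measurableT (EFin \o f) (EFin \o density A)
  (density_integrable mA) ((measurable_EFinP _ _).2 mf).
have H E : E `<=` setT -> measurable E ->
    (\int[lam]_(x in E) (EFin \o density A) x = \int[lam]_(x in E) (EFin \o f) x)%E.
  by move=> _ mE; rewrite -fE// -rE.
by move=> /(_ H); apply: filterS => y /(_ I) [].
Qed.

Let density_setU A B : measurable A -> measurable B -> A `&` B = set0 ->
  {ae lam, forall y, density (A `|` B) y = density A y + density B y}.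
Proof.
move=> mA mB AB0; have [mrA rA0 rAE] := densityP mA.
have [mrB rB0 rBE] := densityP mB.
apply: ae_eq_density; [exact: measurableU|exact: measurable_funD|].
move=> D mD; under eq_integral do rewrite EFinD.
rewrite ge0_integralD//; last 4 first.
- by move=> y _; rewrite lee_fin.
- by apply: measurable_funTS; exact/measurable_EFinP.
- by move=> y _; rewrite lee_fin.
- by apply: measurable_funTS; exact/measurable_EFinP.
rewrite -rAE// -rBE// -measureU.
- by congr (nu _); apply/seteqP; split => -[x y]; rewrite /setX/setU/=; tauto.
- exact: measurableX.
- exact: measurableX.
- rewrite -subset0 => -[x y] /= [[Ax _] [Bx _]].
  by have : (A `&` B) x by []; rewrite AB0.
Qed.

Let density_setT : {ae lam, forall y, density setT y = 1}.
Proof.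
apply: ae_eq_density => // B mB.
by rewrite nu_marginal// integral_cst// mul1e.
Qed.

(** Let [E] be the set of [y] at which all the sets of an exhaustion of the space have density at
    most [c < 1]. Integrating over [E] and letting the exhaustion grow gives [lam E <= c * lam E],
    hence [lam E = 0]. *)
Let density_full : {ae lam, forall y, forall n : nat,
  exists i : Q, 1 - n.+1%:R^-1 < density (K i) y}.
Proof.
apply: ae_foralln => n; set c := 1 - _.
have c0 : 0 <= c by rewrite /c subr_ge0 invf_le1// ler1n.
have [s [sinc _ scov]] := @rational_set_exhaust R N setT openT.
pose E := \bigcap_k [set y | density (K (s k)) y <= c].
have mE : measurable E.
  apply: bigcap_measurable => [|k _]; first by exists 0%N.
  have [mr _ _] := densityP (mK (s k)).
  by rewrite -[X in measurable X]setTI -preimage_itvNyc; exact: mr.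
exists E; split => //; last first.
  move=> y /= ny k _ /=; rewrite leNgt; apply/negP => h; apply: ny.
  by exists (s k).
have mKE k : measurable (K (s k) `*` E) by exact: measurableX.
have UE : \bigcup_k (K (s k) `*` E) = setT `*` E.
  apply/seteqP; split => [[x y] [k _ [Kx Ey]]//|[x y] [_ Ey]].
  by have [k _ Kx] := scov x I; exists k.
have cvgE : (nu \o (fun k => K (s k) `*` E)) @ \oo --> lam E.
  rewrite -nu_marginal// -UE; apply: nondecreasing_cvg_mu => //.
    by rewrite UE; exact: measurableX.
  move=> p q pq; apply/subsetPset => -[x y] [Kx Ey]; split => //.
  exact: sinc Kx.
have le_c : (lam E <= c%:E * lam E)%E.
  rewrite -(cvg_lim _ cvgE)//; apply: lime_le; first by apply/cvg_ex; exists (lam E).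
  apply: nearW => k /=; have [mr r0 ->//] := densityP (mK (s k)).
  rewrite (cvg_lim _ cvgE)// -integral_cst//; apply: ge0_le_integral => //.
  - by move=> y _; rewrite lee_fin.
  - by apply: measurable_funTS; exact/measurable_EFinP.
  - by move=> y Ey; rewrite lee_fin; exact: Ey.
have lamE : lam E \is a fin_num.
  by rewrite ge0_fin_numE// (le_lt_trans (lam_le mE)).
move: le_c; rewrite -(fineK lamE) -EFinM lee_fin => le_c.
apply/eqP; rewrite eqe; apply/eqP; apply/le_anti.
rewrite fine_ge0// andbT -(pmulr_lle0 _ (_ : 0 < 1 - c)); first by lra.
by rewrite /c opprB addrC subrK invr_gt0.
Qed.

(** The relations that turn [density ^~ y] into a content on rational sets: the first two give
    monotonicity, subadditivity and additivity on disjoint sets, the third bounds the mass by 1 and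
    the fourth brings it up to 1. Their number is countable, so almost every [y] is good. *)
Let good (y : Y) : Prop :=
  [/\ forall ij : Q * Q, density (K ij.1 `|` K ij.2) y =
         density (K ij.1) y + density (K ij.2 `\` K ij.1) y,
      forall ij : Q * Q, density (K ij.2) y =
         density (K ij.2 `\` K ij.1) y + density (K ij.2 `&` K ij.1) y,
      forall i : Q, density (K i) y + density (~` K i) y = 1
    & forall n : nat, exists i : Q, 1 - n.+1%:R^-1 < density (K i) y].

Let density_split A B D : measurable A -> measurable B -> A `&` B = set0 ->
  D = A `|` B -> {ae lam, forall y, density D y = density A y + density B y}.
Proof. by move=> mA mB AB ->; exact: density_setU. Qed.

Let ae_good : {ae lam, forall y, good y}.
Proof.
have H1 : {ae lam, forall y, forall ij : Q * Q, density (K ij.1 `|` K ij.2) y =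
         density (K ij.1) y + density (K ij.2 `\` K ij.1) y}.
  apply: ae_forall_count => -[i j] /=; apply: density_split => //.
  - exact: measurableD.
  - by rewrite setDE setICA setICr setI0.
  - by rewrite setUDr setDv setD0.
have H2 : {ae lam, forall y, forall ij : Q * Q, density (K ij.2) y =
         density (K ij.2 `\` K ij.1) y + density (K ij.2 `&` K ij.1) y}.
  apply: ae_forall_count => -[i j] /=; apply: density_split.
  - exact: measurableD.
  - exact: measurableI.
  - by rewrite setDE setIACA setICl setI0.
  - by rewrite setDE -setIUr setUCl setIT.
have H3 : {ae lam, forall y, forall i : Q,
    density (K i) y + density (~` K i) y = 1}.
  apply: ae_forall_count => i.
  have := @density_split (K i) (~` K i) setT (mK i) (measurableC (mK i)) (setICr _) (esym (setUCr _)).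
  by apply: filterS2 density_setT => y -> <-.
by apply: filterS2 (filterI H1 H2) (filterI H3 density_full) => y [? ?] [? ?]; split.
Qed.

Let bad : set Y := sval (cid ae_good).

Let badP : [/\ measurable bad, lam bad = 0 & forall y, ~ bad y -> good y].
Proof.
rewrite /bad; case: cid => B [mB B0 sub] /=; split => // y nB.
by apply: contrapT => ng; apply: nB; apply: sub.
Qed.

(* At the exceptional points, which form a null set, any probability will do. *)
Let content (y : Y) : set X -> R :=
  if y \in bad then (fun A => \1_A (0 : 'rV[R]_N)) else density^~ y.

Let C : set (set 'rV[R]_N) := range K.

Let K_setU i j : K i `|` K j = K (i ++ j).
Proof. by rewrite /K rational_set_cat. Qed.

Let K0 : K [::] = set0.
Proof. by rewrite /K /rational_set big_nil. Qed.

Let density_ge0 A y : measurable A -> 0 <= density A y.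
Proof. by move=> mA; have [] := densityP mA. Qed.

Let kernel_ex : exists kappa : Y -> {measure set X -> \bar R},
  forall y (G : set 'rV[R]_N), open G -> kappa y G = inner_content C (content y) G.
Proof.
suff H y : exists m : {measure set X -> \bar R},
    forall G : set 'rV[R]_N, open G -> m G = inner_content C (content y) G.
  by have [k Hk] := choice H; exists k.
apply: riesz_measure.
- by move=> _ [i _ <-]; exact: compact_rational_set.
- by move=> _ [i _ <-]; exact: closed_rational_set.
- by exists [::] => //; exact: K0.
- by move=> _ _ [i _ <-] [j _ <-]; exists (i ++ j) => //; rewrite K_setU.
- move=> x G oG Gx; have [p [pG px]] := rational_ball_basis oG Gx.
  exists (rational_ball p); split => //; exists [:: p] => //.
  by rewrite /K /rational_set big_seq1.
all: rewrite /content; case: ifPn => yb.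
- by rewrite indic0.
- have [_ _ /(_ y)] := badP; move/negP: yb; rewrite inE => yb /(_ yb) [H1 _ _ _].
  have := H1 ([::], [::]); rewrite /= K0 setU0 setD0; lra.
- by move=> A _; rewrite indicE; case: (_ \in _).
- move=> _ [i _ <-].
  have [_ _ /(_ y)] := badP; move/negP: yb; rewrite inE => yb /(_ yb) [_ _ H3 _].
  by have := H3 i; have := @density_ge0 (~` K i) y (measurableC (mK i)); lra.
- move=> A B _ _ AB; rewrite !indicE ler_nat.
  by case: (boolP (_ \in A)) => // /set_mem/AB/mem_set ->.
- move=> _ _ [i _ <-] [j _ <-] ij.
  have [_ _ /(_ y)] := badP; move/negP: yb; rewrite inE => yb /(_ yb) [_ H2 _ _].
  have := H2 (i, j); rewrite /= (setIidr ij).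
  by have := @density_ge0 (K j `\` K i) y (measurableD (mK j) (mK i)); lra.
- move=> A B _ _; rewrite !indicE in_setU -natrD ler_nat.
  by case: (_ \in _); case: (_ \in _).
- move=> _ _ [i _ <-] [j _ <-].
  have [_ _ /(_ y)] := badP; move/negP: yb; rewrite inE => yb /(_ yb) [H1 H2 _ _].
  have := H1 (i, j); have := H2 (i, j); rewrite /=.
  by have := @density_ge0 (K j `&` K i) y (measurableI _ _ (mK j) (mK i)); lra.
- move=> A B _ _ AB; rewrite !indicE in_setU -natrD ler_nat.
  case: (boolP (0 \in A)) => [/set_mem A0|_];
    case: (boolP (0 \in B)) => [/set_mem B0|_] //.
  by have : (A `&` B) (0 : 'rV[R]_N) by []; rewrite AB.
- move=> _ _ [i _ <-] [j _ <-] ij.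
  have [_ _ /(_ y)] := badP; move/negP: yb; rewrite inE => yb /(_ yb) [H1 _ _ _].
  by have := H1 (i, j); rewrite /= setDidl ?(setIC (K j))//; lra.
Qed.

Let measurable_content i : measurable_fun setT (content^~ (K i)).
Proof.
have [mbad _ _] := badP; have [mr _ _] := densityP (mK i).
have -> : content^~ (K i) = (fun y => if y \in bad then \1_(K i) (0 : 'rV[R]_N)
    else density (K i) y).
  by apply/funext => y; rewrite /content; case: ifPn.
apply: measurable_fun_if => //.
- by apply: (measurable_fun_bool true); rewrite setTI preimage_mem_true.
- exact: measurable_funTS.
Qed.

Let content_ge0 i y : 0 <= content y (K i).
Proof. by rewrite /content; case: ifPn => // _; exact: density_ge0. Qed.

Let content_le1 i y : content y (K i) <= 1.
Proof.
rewrite /content; case: ifPn => [_|yb]; first by rewrite indicE; case: (_ \in _).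
have [_ _ /(_ y)] := badP; move/negP: yb; rewrite inE => yb /(_ yb) [_ _ H3 _].
by have := H3 i; have := @density_ge0 (~` K i) y (measurableC (mK i)); lra.
Qed.

Let integral_content i B : measurable B ->
  (\int[lam]_(y in B) (content y (K i))%:E = nu (K i `*` B))%E.
Proof.
move=> mB; have [mr r0 ->//] := densityP (mK i).
have [mbad bad0 _] := badP.
apply: ae_eq_integral => //.
- by apply: measurable_funTS; exact/measurable_EFinP/measurable_content.
- by apply: measurable_funTS; exact/measurable_EFinP.
exists bad; split => // y /= ny; apply: contrapT => nb; apply: ny => _.
by rewrite /content memNset.
Qed.

Lemma disintegration : exists kappa : Y -> {measure set X -> \bar R},
  [/\ forall A, measurable A -> measurable_fun setT (kappa ^~ A),
      forall y, kappa y setT = 1%E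
    & forall A B, measurable A -> measurable B ->
        nu (A `*` B) = (\int[lam]_(y in B) kappa y A)%E].
Proof.
have [kappa kE] := kernel_ex; exists kappa.
have kge y (G : set 'rV[R]_N) i : open G -> K i `<=` G ->
    ((content y (K i))%:E <= kappa y G)%E.
  by move=> oG iG; rewrite kE//; apply: inner_content_ub => //; exists i.
have k1 y : kappa y setT = 1%E.
  apply/eqP; rewrite eq_le; apply/andP; split.
    rewrite kE; last exact: openT.
    by apply: ge_ereal_sup => _ [_ [[i _ <-] _] <-]; rewrite lee_fin.
  have [yb|yb] := boolP (y \in bad).
    have [p [_ p0]] := @rational_ball_basis R N 0 setT openT I.
    have -> : 1%E = (content y (K [:: p]))%:E.
      rewrite /content yb indicE mem_set// /K /rational_set big_seq1.
      exact: nbhs_singleton.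
    by apply: kge => //; exact: openT.
  apply/lee_addgt0Pr => e e0.
  have [_ _ /(_ y)] := badP; move/negP: (yb); rewrite inE => yb' /(_ yb') [_ _ _ H4].
  have [i Hi] := H4 (Num.truncn e^-1).
  apply: (@le_trans _ _ ((content y (K i))%:E + e%:E)%E); last first.
    by rewrite leeD2r// kge//; exact: openT.
  rewrite -EFinD lee_fin /content (negbTE yb)/=.
  have : (Num.truncn e^-1).+1%:R^-1 <= e.
    by rewrite invf_ple ?posrE//; exact/ltW/truncnS_gt.
  move=> ue; apply: (le_trans _ (lerD (lexx _) ue)).
  by rewrite -lerBlDr ltW.
have mO (G : set 'rV[R]_N) : open G -> measurable_fun setT (kappa ^~ G).
  move=> oG.
  (* On an open set [kappa y] is a countable supremum of measurable contents. Codes of no set, or of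
     a set not inside [G], receive 0, which does not alter a supremum of non-negative terms. *)
  pose h n y : \bar R := if unpickle n is Some i then
    if `[< K i `<=` G >] then (content y (K i))%:E else 0%E else 0%E.
  have -> : kappa ^~ G = (fun y => esups (h ^~ y) 0).
    apply/funext => y; rewrite kE//; apply/eqP; rewrite eq_le; apply/andP; split.
      apply: ge_ereal_sup => _ [_ [[i _ <-] iG] <-].
      apply: ereal_sup_ubound; exists (pickle i) => //.
      by rewrite /h pickleK asboolT.
    apply: ge_ereal_sup => _ [n _ <-]; rewrite /h.
    have k0 : (0 <= inner_content C (content y) G)%E by rewrite -kE.
    case: unpickle => [i|//]; case: asboolP => // iG.
    by rewrite -kE//; exact: kge.
  apply: measurable_fun_esups => n; rewrite /h.
  case: unpickle => [i|]; last exact: measurable_cst.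
  case: asboolP => _; last exact: measurable_cst.
  exact/measurable_EFinP/measurable_content.
have kC y A : measurable A -> kappa y (~` A) = (1 - kappa y A)%E.
  move=> mA; have h : (kappa y setT < +oo)%E by rewrite k1 ltry.
  by rewrite -setTD (measureD measurableT mA h) setTI; congr (_ - _)%E; exact: k1.
have kU y F : (forall n : nat, measurable (F n)) -> trivIset setT F ->
    kappa y (\bigcup_n F n) = (\sum_(n <oo) kappa y (F n))%E.
  by move=> mF tF; rewrite measure_semi_bigcup//; exact: bigcupT_measurable.
have openI_closed : setI_closed (@open 'rV[R]_N) by move=> A B; exact: openI.
have mk A : measurable A -> measurable_fun setT (kappa ^~ A).
  apply: (dynkin_induction (T := X) (G := @open 'rV[R]_N)
    (P := fun A => measurable_fun setT (kappa ^~ A))) => //.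
  - by apply: mO; exact: openT.
  - move=> S mS kS; rewrite (_ : kappa ^~ (~` S) = (fun y => 1 - kappa y S)%E).
      exact: emeasurable_funB.
    by apply/funext => y; exact: kC.
  - move=> F mF tF kF.
    rewrite (_ : kappa ^~ _ = (fun y => \sum_(n <oo) kappa y (F n))%E).
      by apply: ge0_emeasurable_sum => n *; [exact: measure_ge0|exact: kF].
    by apply/funext => y; exact: kU.
have kle1 y A : measurable A -> (kappa y A <= 1)%E.
  by move=> mA; rewrite -(k1 y); apply: le_measure; rewrite ?inE.
split => //.
have mkB A B : measurable A -> measurable_fun B (kappa ^~ A).
  by move=> mA; apply: measurable_funTS; exact: mk.
have intC A B : measurable A -> measurable B ->
    (\int[lam]_(y in B) kappa y A + \int[lam]_(y in B) kappa y (~` A) = lam B)%E.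
  move=> mA mB; rewrite -ge0_integralD//; [|exact: mkB|by apply: mkB; exact: measurableC].
  rewrite -[RHS]mul1e -integral_cst//; apply: eq_integral => y _.
  rewrite kC// addeCA subee ?adde0//.
  by rewrite ge0_fin_numE// (le_lt_trans (kle1 _ _ mA))// ltry.
have nuC A B : measurable A -> measurable B ->
    (nu (A `*` B) + nu (~` A `*` B) = lam B)%E.
  move=> mA mB; have mAC := measurableC mA.
  rewrite -nu_marginal// -measureU; [|exact: measurableX..|].
    congr (nu _); apply/seteqP; split => -[x y] /=; first by case => -[].
    by move=> [_ By]; have [Ax|nAx] := EM (A x); [left|right].
  by rewrite -subset0 => -[x y] /= [[Ax _] []].
have lamfin B : measurable B -> lam B \is a fin_num.
  by move=> mB; rewrite ge0_fin_numE// (le_lt_trans (lam_le mB)).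
have nufin A B : measurable A -> measurable B -> nu (A `*` B) \is a fin_num.
  by move=> mA mB; rewrite ge0_fin_numE// (le_lt_trans (nu_le mA mB))// -ge0_fin_numE// lamfin.
have int_ge0 A B : (0 <= \int[lam]_(y in B) kappa y A)%E by exact: integral_ge0.
have intfin A B : measurable A -> measurable B ->
    (\int[lam]_(y in B) kappa y A)%E \is a fin_num.
  move=> mA mB; rewrite ge0_fin_numE//.
  apply: (@le_lt_trans _ _ (lam B)); last by rewrite -ge0_fin_numE// lamfin.
  by rewrite -(intC A)// leeDl.
(* Inner approximation gives one inequality on open sets. Passing to complements reverses it on
   rational sets, and exhausting an open set by rational sets brings the reversed inequality back to
   open sets; a Dynkin argument concludes. *)
have Ole (G : set 'rV[R]_N) B : open G -> measurable B ->
    (nu (G `*` B) <= \int[lam]_(y in B) kappa y G)%E.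
  move=> oG mB; have [s [sinc sG scov]] := rational_set_exhaust oG.
  have UE : \bigcup_k (K (s k) `*` B) = G `*` B.
    apply/seteqP; split => [[x y] [k _ [Kx By]]|[x y] [Gx By]].
      by split => //; exact: sG Kx.
    by have [k _ Kx] := scov x Gx; exists k.
  have cvgG : (nu \o (fun k => K (s k) `*` B)) @ \oo --> nu (G `*` B).
    rewrite -UE; apply: nondecreasing_cvg_mu => //.
    - by move=> k; exact: measurableX.
    - by rewrite UE; apply: measurableX => //; exact: open_measurable_borel.
    - by move=> p q pq; apply/subsetPset => -[x y] [Kx By]; split => //; exact: sinc Kx.
  rewrite -(cvg_lim _ cvgG)//; apply: lime_le; first by apply/cvg_ex; exists (nu (G `*` B)).
  apply: nearW => k /=; rewrite -integral_content//; apply: ge0_le_integral => //.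
  - by move=> y _; rewrite lee_fin.
  - by apply: measurable_funTS; exact/measurable_EFinP/measurable_content.
  - by apply: mkB; exact: open_measurable_borel.
  - by move=> y _; exact: kge.
have Cle i B : measurable B -> (\int[lam]_(y in B) kappa y (K i) <= nu (K i `*` B))%E.
  move=> mB; have mKC := measurableC (mK i).
  have oKC : open (~` K i : set 'rV[R]_N) by exact/closed_openC/closed_rational_set.
  have := Ole _ _ oKC mB; have := intC _ _ (mK i) mB; rewrite -(nuC _ _ (mK i) mB).
  rewrite -(fineK (intfin _ _ (mK i) mB)) -(fineK (intfin _ _ mKC mB)).
  rewrite -(fineK (nufin _ _ (mK i) mB)) -(fineK (nufin _ _ mKC mB)).
  by rewrite -!EFinD !lee_fin => -[]; lra.
have OE (G : set 'rV[R]_N) B : open G -> measurable B ->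
    nu (G `*` B) = (\int[lam]_(y in B) kappa y G)%E.
  move=> oG mB; apply/eqP; rewrite eq_le Ole//=.
  have mG := open_measurable_borel oG.
  have [s [sinc sG scov]] := rational_set_exhaust oG.
  have UE : \bigcup_k K (s k) = G.
    apply/seteqP; split => [x [k _ Kx]|x Gx]; first exact: sG Kx.
    by have [k _ Kx] := scov x Gx; exists k.
  have cvgk y : kappa y (K (s k)) @[k --> \oo] --> kappa y G.
    rewrite -UE; apply: nondecreasing_cvg_mu => //; first by rewrite UE.
    by move=> p q pq; apply/subsetPset; exact: sinc.
  have cvgI : (\int[lam]_(y in B) kappa y (K (s k)))%E @[k --> \oo] -->
      (\int[lam]_(y in B) kappa y G)%E.
    rewrite (_ : (\int[lam]_(y in B) kappa y G)%E =
        (\int[lam]_(y in B) limn (fun k => kappa y (K (s k))))%E); last first.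
      by apply: eq_integral => y _; rewrite (cvg_lim _ (cvgk y)).
    apply: cvg_monotone_convergence => //.
    - by move=> k; exact: mkB.
    - by move=> y _ p q pq; apply: le_measure; rewrite ?inE//; exact: sinc.
  rewrite -(cvg_lim _ cvgI)//; apply: lime_le.
    by apply/cvg_ex; exists (\int[lam]_(y in B) kappa y G)%E.
  apply: nearW => k; apply: le_trans (Cle _ _ mB) _.
  apply: le_measure; rewrite ?inE; [exact: measurableX..|].
  by move=> [x y] [Kx By]; split => //; exact: sG Kx.
move=> A B mA mB; move: A mA.
apply: (dynkin_induction (T := X) (G := @open 'rV[R]_N)
  (P := fun A => nu (A `*` B) = (\int[lam]_(y in B) kappa y A)%E)) => //.
- by apply: OE => //; exact: openT.
- by move=> G oG; exact: OE.
- move=> S mS HS; have mSC := measurableC mS.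
  have := intC _ _ mS mB; rewrite -(nuC _ _ mS mB) HS.
  rewrite -(fineK (intfin _ _ mS mB)) -(fineK (intfin _ _ mSC mB)) -(fineK (nufin _ _ mSC mB)).
  by rewrite -!EFinD => -[] /addrI ->.
- move=> F mF tF HF.
  transitivity (\sum_(n <oo) nu (F n `*` B))%E.
    rewrite -measure_semi_bigcup//.
    + by congr (nu _); apply/seteqP; split => [[x y] [[n _ Fx] By]|[x y] [n _ [Fx By]]];
        [exists n|split => //; exists n].
    + by move=> n; exact: measurableX.
    + apply/trivIsetP => i j _ _ ij; rewrite -subset0 => -[x y] [[Fi _] [Fj _]].
      have := trivIsetP.1 tF i j I I ij.
      by rewrite -subset0 => /(_ x (conj Fi Fj)).
    + by apply: bigcupT_measurable => n; exact: measurableX.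
  under eq_eseriesr do rewrite HF.
  rewrite -integral_nneseries//; last by move=> n; exact: mkB.
  by apply: eq_integral => y _; rewrite kU.
Qed.

End disintegration.

(** * Measures on space-time *)

Section section_kernel.
Context d d' (X : measurableType d) (Y : measurableType d') (R : realType).
Variable kappa : R.-pker Y ~> X.

Let measurable_sec (y : Y) : measurable_fun setT (fun x : X => (x, y)).
Proof. by apply: measurable_fun_pair => //; exact: measurable_id. Qed.

(** The law of [(x, y)] when [x] follows [kappa y]. With the dummy [unit] argument, [bundle_measure]
    becomes a composition of kernels, which provides sigma-additivity and the iterated integral. *)
Definition section_kernel (uy : unit * Y) : {measure set (X * Y)%type -> \bar R} :=
  sval (cid (pushforward_measure (kappa uy.2) (measurable_sec uy.2))).

Lemma section_kernelE uy A : section_kernel uy A = kappa uy.2 (ysection A uy.2).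
Proof.
rewrite /section_kernel; case: cid => m /= ->; congr (kappa _ _).
by apply/seteqP; split => x; rewrite /ysection/= inE.
Qed.

Lemma measurable_ysection_kernel (A : set (X * Y)) : measurable A ->
  measurable_fun setT (fun y => kappa y (ysection A y)).
Proof.
move=> mA.
pose A' : set (Y * X) := (fun p => (p.2, p.1)) @^-1` A.
have mA' : measurable A'.
  rewrite -[X in measurable X]setTI.
  by apply: (measurable_fun_pair measurable_snd measurable_fst).
have -> : (fun y => kappa y (ysection A y)) = (fun y => kappa y (xsection A' y)).
  by apply/funext => y; congr (kappa _ _).
by apply: measurable_fun_xsection_finite_kernel; rewrite inE.
Qed.

Let measurable_section_kernel U : measurable U ->
  measurable_fun setT (section_kernel ^~ U).
Proof.
move=> mU; under eq_fun do rewrite section_kernelE.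
exact: (measurableT_comp (measurable_ysection_kernel mU) measurable_snd).
Qed.

HB.instance Definition _ := isKernel.Build _ _ _ _ R section_kernel
  measurable_section_kernel.

Let prob_section_kernel uy : section_kernel uy setT = 1%E.
Proof.
rewrite section_kernelE -(prob_kernel (s := kappa) uy.2); congr (kappa _ _).
by apply/seteqP; split => x _ //; rewrite /ysection/= inE.
Qed.

HB.instance Definition _ := Kernel_isProbability.Build _ _ _ _ R section_kernel
  prob_section_kernel.

Variable lam : {measure set Y -> \bar R}.

Definition cst_kernel (_ : unit) : {measure set Y -> \bar R} := lam.

Let measurable_cst_kernel U : measurable U -> measurable_fun setT (cst_kernel ^~ U).
Proof. by move=> mU; exact: measurable_cst. Qed.

HB.instance Definition _ := isKernel.Build _ _ _ _ R cst_kernel measurable_cst_kernel.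

Definition bundle_measure : {measure set (X * Y)%type -> \bar R} :=
  mkcomp cst_kernel section_kernel tt.

Lemma bundle_measureE A :
  bundle_measure A = (\int[lam]_y kappa y (ysection A y))%E.
Proof.
by rewrite /bundle_measure/= /kcomp; apply: eq_integral => y _; rewrite section_kernelE.
Qed.

End section_kernel.

Section kernel_mean.
Context d d' (X : measurableType d) (Y : measurableType d') (R : realType).
Variable (kappa : R.-pker Y ~> X) (f : X * Y -> R).
Hypothesis mf : measurable_fun setT f.

Definition kernel_mean (y : Y) : R := fine (\int[kappa y]_x (f (x, y))%:E)%E.

Let k1 y : kappa y setT = 1%E. Proof. exact: prob_kernel. Qed.

Let koo y : (kappa y setT < +oo)%E. Proof. by rewrite k1 ltry. Qed.

Let msec (y : Y) : measurable_fun setT (fun x : X => (x, y)).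
Proof. by apply: measurable_fun_pair => //; exact: measurable_id. Qed.

Variable M : R.
Hypothesis fM : forall p, `|f p| <= M.

Lemma integrable_kernel y : (kappa y).-integrable setT (fun x => (f (x, y))%:E).
Proof.
apply: (@bounded_integrable _ _ _ (kappa y) (fun x => f (x, y))) => //.
  exact: measurableT_comp.
by exists M.
Qed.

Lemma kernel_meanE y : (\int[kappa y]_x (f (x, y))%:E = (kernel_mean y)%:E)%E.
Proof. by rewrite fineK//; apply: integrable_fin_num => //; exact: integrable_kernel. Qed.

Lemma kernel_meanD y (c : R) :
  (\int[kappa y]_x (f (x, y) + c)%:E = (kernel_mean y + c)%:E)%E.
Proof.
under eq_integral do rewrite EFinD.
rewrite integralD//.
- by rewrite kernel_meanE integral_cst// k1 mule1.
- exact: integrable_kernel.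
- by apply: bounded_integrable => //; exact: bounded_cst.
Qed.

Lemma measurable_kernel_mean : measurable_fun setT kernel_mean.
Proof.
(* Shifted by the bound [M], the integrand is non-negative and the measurability of integrals
   against a kernel applies. *)
have -> : kernel_mean = (fun y => (kernel_mean y + M) - M).
  by apply/funext => y; rewrite addrK.
apply: measurable_funB => //; apply/measurable_EFinP.
rewrite (_ : EFin \o _ = (fun y => \int[kappa y]_x (f (x, y) + M)%:E)%E); last first.
  by apply/funext => y; rewrite kernel_meanD.
apply: (@measurable_fun_integral_finite_kernel _ _ Y X R
  (fun p : Y * X => (f (p.2, p.1) + M)%:E) kappa) => [p|].
  by rewrite lee_fin; have := fM (p.2, p.1); rewrite ler_norml => /andP[]; lra.
apply/measurable_EFinP; apply: measurable_funD => //.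
apply: (measurableT_comp mf).
exact: (measurable_fun_pair measurable_snd measurable_fst).
Qed.

Lemma kernel_mean_le y : `|kernel_mean y| <= M.
Proof.
rewrite -lee_fin -abse_EFin -kernel_meanE; apply: le_trans (le_abse_integral _ _ _) _ => //.
  exact/measurable_EFinP/measurableT_comp.
rewrite -[leRHS]mule1 -(k1 y) -integral_cst//; apply: ge0_le_integral => //.
- by apply: measurableT_comp => //; exact/measurable_EFinP/measurableT_comp.
- by move=> x _; rewrite lee_fin; exact: le_trans (fM (x, y)).
Qed.

End kernel_mean.

Section bundle_integral.
Context d d' (X : measurableType d) (Y : measurableType d') (R : realType).
Variables (kappa : R.-pker Y ~> X) (lam : {measure set Y -> \bar R}).
Hypothesis lam_fin : (lam setT < +oo)%E.

(** A copy of [cst_kernel] that carries the finiteness of [lam]: [bundle_measure] is formed over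
    Lebesgue measure as well, but the integral formula is for finite base measures such as the
    uniform law. *)
Definition cst_fkernel of (lam setT < +oo)%E : unit -> {measure set Y -> \bar R} :=
  cst_kernel lam.

HB.instance Definition _ := Kernel.on (cst_fkernel lam_fin).

Let uub_cst_fkernel : measure_fam_uub (cst_fkernel lam_fin).
Proof.
exists (fine (lam setT) + 1) => x; rewrite /cst_fkernel /cst_kernel.
by rewrite EFinD fineK ?ge0_fin_numE// lteDl ?ge0_fin_numE// lte_fin.
Qed.

HB.instance Definition _ := Kernel_isFinite.Build _ _ _ _ R (cst_fkernel lam_fin)
  uub_cst_fkernel.

Lemma integral_bundle (f : X * Y -> \bar R) :
  (forall p, (0 <= f p)%E) -> measurable_fun setT f ->
  (\int[bundle_measure kappa lam]_p f p =
   \int[lam]_y \int[kappa y]_x f (x, y))%E.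
Proof.
move=> f0 mf.
rewrite [LHS](@integral_kcomp _ _ _ _ _ _ R (cst_fkernel lam_fin) (section_kernel kappa) tt f f0 mf).
apply: eq_integral => y _.
have msec : measurable_fun setT (fun x : X => (x, y)).
  by apply: measurable_fun_pair => //; exact: measurable_id.
pose pf := pushforward (kappa y) (fun x : X => (x, y)) : {measure set (X * Y)%type -> \bar R}.
rewrite (eq_measure_integral (pf msec)); last first.
  move=> A mA _; rewrite section_kernelE; congr (kappa _ _).
  by apply/seteqP; split => x; rewrite /ysection/= inE.
by rewrite ge0_integral_pushforward.
Qed.

Lemma bounded_integral_bundle (f : X * Y -> R) :
  bounded_fct f -> measurable_fun setT f ->
  (\int[bundle_measure kappa lam]_p (f p)%:E =
   \int[lam]_y (kernel_mean kappa f y)%:E)%E.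
Proof.
move=> [M hM] mf.
have k1 y : kappa y setT = 1%E by exact: prob_kernel.
have T1 : bundle_measure kappa lam setT = lam setT.
  rewrite bundle_measureE -[RHS]mul1e -integral_cst//; apply: eq_integral => y _.
  by rewrite -(k1 y); congr (kappa _ _); apply/seteqP; split => x _ //; rewrite /ysection/= inE.
have Too : (bundle_measure kappa lam setT < +oo)%E by rewrite T1.
have fi : (bundle_measure kappa lam).-integrable setT (EFin \o f).
  by apply: bounded_integrable => //; exists M.
have Fi : lam.-integrable setT (EFin \o kernel_mean kappa f).
  apply: bounded_integrable => //; first exact: measurable_kernel_mean.
  by exists M => y; exact: kernel_mean_le.
have E1 : (\int[bundle_measure kappa lam]_p (f p + M)%:E =
   \int[lam]_y (kernel_mean kappa f y + M)%:E)%E.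
  rewrite integral_bundle//.
  - by apply: eq_integral => y _; exact: kernel_meanD.
  - move=> p; rewrite lee_fin; have := hM p; rewrite ler_norml => /andP[]; lra.
  - by apply/measurable_EFinP; exact: measurable_funD.
have Mfin : (M%:E * lam setT)%E \is a fin_num by rewrite fin_numM// ge0_fin_numE.
have bF : bounded_fct (kernel_mean kappa f) by exists M => y; exact: kernel_mean_le.
have mF := measurable_kernel_mean kappa mf hM.
move: E1; rewrite !integral_addr_cst ?T1//; last by exists M.
by move=> /(congr1 (fun u => u - M%:E * lam setT)%E); rewrite !addeK.
Qed.

End bundle_integral.

(** Makes space-time a [ptopologicalType], the structure over which [mean_riesz] is stated. *)
HB.instance Definition _ (X Y : ptopologicalType) := Pointed.on (X * Y)%type.

Section space_time.
Context {R : realType} {N : nat}.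
Notation V := 'rV[R]_N.
Notation S := ('rV[R]_N * R)%type.

Lemma space_time_hausdorff : hausdorff_space S.
Proof. exact: norm_hausdorff. Qed.

Lemma space_time_basis (x : S) (G : set S) : open G -> G x ->
  exists K : set S, [/\ compact K, K `<=` G & nbhs x K].
Proof.
move=> oG Gx.
have /nbhs_ballP[e /= e0 eG] : nbhs x G by exact: open_nbhs_nbhs.
have [p [pB xp]] := @rational_ball_basis R N x.1 (ball x.1 e) (@ball_open R V x.1 e) (ballxx _ e0).
exists (rational_ball p `*` `[x.2 - e / 2, x.2 + e / 2]%classic); split.
- apply: compact_setX; last exact: segment_compact.
  have := @compact_rational_set R N [:: p].
  by rewrite /rational_set big_seq1.
- move=> y [y1 y2]; apply: eG; split => /=; first exact: pB.
  rewrite -ball_normE/= ltr_norml; move: y2; rewrite /= in_itv/=; lra.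
- exists (rational_ball p, `[x.2 - e / 2, x.2 + e / 2]%classic); last by [].
  split => //=; apply/nbhs_ballP; exists (e / 2); first by rewrite /= divr_gt0.
  by move=> y; rewrite -ball_normE/= in_itv/= ltr_norml; lra.
Qed.

(** The Riesz measure lives on the Borel sets of the product topology; pushing it forward along this
    identity places it on the product sigma-algebra, where kernels and sections are available. *)
Lemma measurable_id_space_time :
  measurable_fun setT (id : g_sigma_algebraType (@open S) -> (borel R N * measurableTypeR R)%type).
Proof.
have H1 : measurable_fun setT (fst : g_sigma_algebraType (@open S) -> borel R N).
  apply: (@measurability _ _ (g_sigma_algebraType (@open S)) (borel R N) setT fst (@open V) erefl) => _ [A oA <-].
  rewrite setTI; apply: sub_sigma_algebra; apply: open_comp => // p _.
  exact: cvg_fst.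
have H2 : measurable_fun setT (snd : g_sigma_algebraType (@open S) -> measurableTypeR R).
  apply: (measurability _ (RGenOInfty.measurableE R)) => _ [_ [a ->] <-].
  rewrite setTI; apply: sub_sigma_algebra; apply: open_comp => // p _.
  exact: cvg_snd.
have := measurable_fun_pair H1 H2.
by rewrite (_ : (fun _ => (_, _)) = id)//; apply/funext => -[].
Qed.

Lemma open_prod_measurable (G : set S) : open G ->
  measurable (G : set (borel R N * measurableTypeR R)%type).
Proof.
move=> oG.
(* Rational boxes: every open set of space-time is a countable union of them. *)
pose B (i : ('rV[rat]_N * rat) * (rat * rat)) : set (borel R N * measurableTypeR R)%type :=
  rational_ball i.1 `*` `]ratr i.2.1, ratr i.2.2[%classic.
have -> : G = \bigcup_(n in [set: nat])
    (if unpickle n is Some i then (if `[< B i `<=` G >] then B i else set0) else set0).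
  apply/seteqP; split => [x Gx|x [n _]]; last first.
    by case: unpickle => // i; case: asboolP => // iG; exact: iG.
  have /nbhs_ballP[e /= e0 eG] : nbhs x G by exact: open_nbhs_nbhs.
  have [p [pB xp]] := @rational_ball_basis R N x.1 (ball x.1 e) (@ball_open R V x.1 e) (ballxx _ e0).
  have l1 : x.2 - e < x.2 by lra.
  have l2 : x.2 < x.2 + e by lra.
  have [q1] := rat_in_itvoo l1; rewrite in_itv/= => /andP[q11 q12].
  have [q2] := rat_in_itvoo l2; rewrite in_itv/= => /andP[q21 q22].
  exists (pickle (p, (q1, q2))) => //; rewrite pickleK asboolT.
    by split => /=; [exact: nbhs_singleton|rewrite in_itv/= q12 q21].
  move=> y [/= y1]; rewrite in_itv/= => /andP[y2 y3]; apply: eG; split => /=.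
    exact: pB.
  by rewrite -ball_normE/= ltr_norml; lra.
apply: bigcupT_measurable => n; case: unpickle => [i|]; last exact: measurable0.
case: asboolP => _; last exact: measurable0.
apply: measurableX; last exact: measurable_itv.
rewrite -(setCK (rational_ball i.1)); apply: measurableC.
apply: sub_sigma_algebra; exact/closed_openC/closed_rational_ball.
Qed.

Lemma continuous_prod_measurable (f : S -> R) : continuous f ->
  measurable_fun setT (f : (borel R N * measurableTypeR R)%type -> R).
Proof.
move=> cf; apply: (measurability _ (RGenOInfty.measurableE R)) => _ [_ [a ->] <-].
by rewrite setTI; apply: open_prod_measurable; apply: open_comp => // x _; exact: cf.
Qed.

End space_time.

(** * Time: translations, the uniform law and the time marginal *)

Section lebesgue_shift.
Context {R : realType}.
Notation mu := (@lebesgue_measure R).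

Let shiftr (c : R) (x : measurableTypeR R) : measurableTypeR R := x + c.

Let measurable_shiftr c : measurable_fun setT (shiftr c).
Proof. exact: measurable_funD. Qed.

Lemma lebesgue_shift (c : R) (A : set (measurableTypeR R)) : measurable A ->
  mu ((fun x => x + c) @^-1` A) = mu A.
Proof.
move=> mA; have [m' mE] := pushforward_measure mu (measurable_shiftr c).
rewrite -[LHS]mE; apply/esym/lebesgue_measure_unique => //= _ [[a b]] _ <-.
rewrite mE /=.
have -> : shiftr c @^-1` `]a, b] = `]a - c, b - c]%classic.
  by apply/seteqP; split => x; rewrite /shiftr/= !in_itv/= ltrBlDr lerBrDr.
by rewrite !lebesgue_measure_itv/= !lte_fin ltrD2r -!EFinB; case: ifP => // _; congr EFin; ring.
Qed.

Lemma integrable_shift (c : R) (f : R -> \bar R) : mu.-integrable setT f ->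
  mu.-integrable setT (fun x => f (x + c)).
Proof.
move=> fi; have [mf foo] := integrableP _ _ _ fi.
pose m' := pushforward mu (shiftr c) : {measure set (measurableTypeR R) -> \bar R}.
have mE A : measurable A -> A `<=` setT -> mu A = m' (measurable_shiftr c) A.
  by move=> mA _; rewrite -(lebesgue_shift c mA).
apply/integrableP; split; first exact: (measurableT_comp mf (measurable_shiftr c)).
move: foo; rewrite (eq_measure_integral _ mE) ge0_integral_pushforward//.
exact: measurableT_comp.
Qed.

Lemma integral_shift (c : R) (f : R -> \bar R) : mu.-integrable setT f ->
  (\int[mu]_x f (x + c)%R = \int[mu]_x f x)%E.
Proof.
move=> fi; have [mf _] := integrableP _ _ _ fi.
pose m' := pushforward mu (shiftr c) : {measure set (measurableTypeR R) -> \bar R}.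
have mE A : measurable A -> A `<=` setT -> mu A = m' (measurable_shiftr c) A.
  by move=> mA _; rewrite -(lebesgue_shift c mA).
rewrite [RHS](eq_measure_integral _ mE) integral_pushforward//.
exact: integrable_shift.
Qed.

Lemma integral_periodize (T : R) (g : R -> R) (k : nat) : 0 < T ->
  measurable_fun setT g -> bounded_fct g ->
  (forall t, ~~ (- (k%:R * T) <= t < k%:R * T) -> g t = 0) ->
  (\int[mu]_t (g t)%:E =
   \int[mu]_(t in `[0%R, T[) (\sum_(j < k + k) g (t + (j%:R - k%:R) * T))%R%:E)%E.
Proof.
move=> T0 mg [M gM] g0.
pose s (j : 'I_(k + k)) : R := (j%:R - k%:R) * T.
pose h : R -> R := \1_(`[0, T[%classic).
have mI : measurable (`[0, T[%classic : set (measurableTypeR R)) by exact: measurable_itv.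
have mgs c : measurable_fun setT (fun t : measurableTypeR R => g (t + c)).
  exact: (measurableT_comp mg (measurable_shiftr c)).
have mh : measurable_fun setT (h : measurableTypeR R -> R) by exact: measurable_indic.
have hi c : mu.-integrable setT (fun t => (g (t + c) * h t)%:E).
  have hI : mu.-integrable setT (fun t => (M * h t)%:E).
    have := @integrableZl _ _ _ mu _ measurableT M _ (integrable_indic_itv 0 T true true).
    by apply: eq_integrable => // t _; rewrite /= EFinM.
  apply: le_integrable hI => //; first exact/measurable_EFinP/measurable_funM.
  move=> t _; rewrite lee_fin !normrM ler_wpM2r//.
  exact: le_trans (gM _) (ler_norm _).
have gE t : g t = \sum_j g t * h (t - s j).
  have [/andP[t1 t2]|/g0 ->] := boolP (- (k%:R * T) <= t < k%:R * T); last first.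
    by rewrite big1// => j _; rewrite mul0r.
  (* Time in units of the period, counted from the left end of the support: [t] lies in the
     translate of [[0, T)] whose index is the integer part of [u], and in no other. *)
  pose u := t / T + k%:R.
  have u0 : 0 <= u by rewrite -lerBlDr sub0r ler_pdivlMr// mulNr.
  have uk : (Num.truncn u < k + k)%N.
    by rewrite truncn_lt_nat// natrD ltrD2r ltr_pdivrMr.
  rewrite (bigD1 (Ordinal uk))//= big1 ?addr0.
    rewrite /h indicE mem_set ?mulr1//= /s/= in_itv/=.
    have /andP[v1 v2] := truncn_itv u0.
    have -> : t = (u - k%:R) * T by rewrite /u addrK divfK// gt_eqF.
    rewrite -mulrBl; apply/andP; split; first by rewrite pmulr_lge0//; lra.
    by rewrite gtr_pMl//; move: v2; rewrite -natr1; lra.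
  move=> j jn; rewrite /h indicE memNset ?mulr0// /s/= in_itv/=.
  have -> : t = (u - k%:R) * T by rewrite /u addrK divfK// gt_eqF.
  rewrite -mulrBl pmulr_lge0// gtr_pMl// => /andP[w1 w2].
  move/eqP: jn; apply; apply/val_inj => /=; apply/esym/truncn_def.
  by rewrite -natr1; apply/andP; split; lra.
have hE c : (\int[mu]_t (g t * h (t - c))%:E = \int[mu]_t (g (t + c) * h t)%:E)%E.
  rewrite -(@integral_shift (- c) _ (hi c)).
  by apply: eq_integral => t _; rewrite subrK.
have gi c : mu.-integrable setT (fun t => (g t * h (t - c))%:E).
  by apply: eq_integrable (integrable_shift (- c) (hi c)) => // t _; rewrite subrK.
transitivity (\int[mu]_t \sum_j (g t * h (t - s j))%:E)%E.
  by apply: eq_integral => t _; rewrite {1}gE -sumEFin.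
rewrite integral_sum// (eq_bigr (fun j => \int[mu]_t (g (t + s j) * h t)%:E)%E) => [|j _//].
rewrite -integral_sum//= [RHS]integral_mkcond/=.
apply: eq_integral => t _; rewrite patchE sumEFin /h indicE.
case: ifPn => _; last by rewrite big1// => j _; rewrite mulr0.
by congr EFin; apply: eq_bigr => j _; rewrite mulr1.
Qed.
End lebesgue_shift.

Section uniform_time.
Context {R : realType} (T : R).
Hypothesis T0 : 0 < T.
Notation mu := (@lebesgue_measure R).

Lemma uniform_probE (A : set (measurableTypeR R)) : measurable A ->
  uniform_prob T0 A = (T^-1%:E * mu (A `&` `[0%R, T]%classic))%E.
Proof.
move=> mA; rewrite /uniform_prob integral_uniform_pdf.
rewrite (eq_integral (fun=> T^-1%:E)) => [|x].
  by rewrite integral_cst//; exact: measurableI.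
by rewrite inE /uniform_pdf /= in_itv/= => -[_ ->]; rewrite subr0.
Qed.

Lemma uniform_prob_gt (a : R) :
  uniform_prob T0 `]a, +oo[%classic = (1 - Num.max 0 (Num.min a T) / T)%:E.
Proof.
rewrite uniform_probE//.
have -> : `]a, +oo[%classic `&` `[0, T]%classic =
    (if 0 <= a then `]a, T]%classic else `[0, T]%classic).
  apply/seteqP; split => x; case: leP => a0 /=; rewrite !in_itv/= ?andbT.
  - by move=> [-> /andP[]].
  - by case.
  - by move=> /andP[ax ->]; rewrite ax (ltW (le_lt_trans a0 ax)).
  - by move=> /andP[x0 ->]; rewrite x0 (lt_le_trans a0).
have Tn0 : T != 0 by rewrite gt_eqF.
case: leP => a0; rewrite lebesgue_measure_itv/= lte_fin.
- have [aT|aT] := ltP a T.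
    by rewrite (max_idPr a0) -EFinB -EFinM; congr EFin; field.
  by rewrite (max_idPr (ltW T0)) mule0 divff ?subrr.
- rewrite T0 (min_idPl (ltW (lt_trans a0 T0))) (max_idPl (ltW a0)) mul0r !subr0.
  by rewrite -EFinB -EFinM subr0 mulVf.
Qed.

Lemma uniform_prob_unique (m : {measure set (measurableTypeR R) -> \bar R}) :
  (forall a, m `]a, +oo[%classic = (1 - Num.max 0 (Num.min a T) / T)%:E) ->
  forall A, measurable A -> m A = uniform_prob T0 A.
Proof.
move=> mE; apply: (@measure_unique _ R (measurableTypeR R)
    [set A | exists a, A = `]a, +oo[%classic] (fun i => `](- i%:R), +oo[%classic)).
- exact: RGenOInfty.measurableE.
- move=> _ _ [a ->] [b ->]; exists (Num.max a b).
  by apply/seteqP; split => x /=; rewrite !in_itv/= !andbT gt_max => /andP.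
- by move=> i; exists (- i%:R).
- apply/seteqP; split => x // _; exists (Num.truncn (- x)).+1 => //=.
  by rewrite in_itv/= andbT ltrNl truncnS_gt.
- by move=> _ [a ->]; rewrite mE -uniform_prob_gt.
- by move=> i; rewrite mE ltry.
Qed.

Lemma uniform_integral0 (g : R -> R) : measurable_fun setT g -> bounded_fct g ->
  (\int[uniform_prob T0]_t (g t)%:E = 0)%E ->
  (\int[mu]_(t in `[0%R, T[) (g t)%:E = 0)%E.
Proof.
move=> mg bg g0; have [M gM] := bg.
have mI : measurable (`[0, T]%classic : set (measurableTypeR R)) by exact: measurable_itv.
have muI : mu `[0%R, T]%classic = T%:E by rewrite lebesgue_measure_itv/= lte_fin T0 sube0.
have mgM : measurable_fun setT (fun t => g t + M) by exact: measurable_funD.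
have gM0 t : 0 <= g t + M by have := gM t; rewrite ler_norml => /andP[]; lra.
have u1 : (uniform_prob T0 : {measure set (measurableTypeR R) -> \bar R}) setT = 1%E.
  exact: probability_setT.
have muoo : (mu `[0%R, T]%classic < +oo)%E by rewrite muI ltry.
have E1 : (\int[uniform_prob T0]_t (g t + M)%:E = M%:E)%E.
  have uoo : ((uniform_prob T0 : {measure set (measurableTypeR R) -> \bar R}) setT < +oo)%E.
    by rewrite u1 ltry.
  by rewrite (integral_addr_cst M measurableT uoo mg bg) g0 add0e u1 mule1.
have E2 : (\int[mu]_(t in `[0%R, T]) (g t + M)%:E =
    \int[mu]_(t in `[0%R, T]) (g t)%:E + M%:E * T%:E)%E.
  rewrite (integral_addr_cst M mI muoo mg bg); congr (_ + _ * _)%E; exact: muI.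
have H : (M%:E = T^-1%:E * (\int[mu]_(t in `[0%R, T]) (g t)%:E + M%:E * T%:E))%E.
  rewrite -E2 -E1 (integral_uniform T0 (f := fun t => (g t + M)%:E)) ?subr0//.
  exact/measurable_EFinP.
rewrite integral_itv_bndo_bndc; last exact/measurable_EFinP/measurable_funTS.
have : (\int[mu]_(t in `[0%R, T]) (g t)%:E)%E \is a fin_num.
  by apply: integrable_fin_num => //; exact: bounded_integrable_on.
move: H; case: (\int[mu]_(t in `[0%R, T]) (g t)%:E)%E => // r /esym/eqP H _.
have {}H : T^-1 * (r + M * T) = M by apply: EFin_inj; exact/eqP.
have : T * (T^-1 * (r + M * T)) = T * M by rewrite H.
by rewrite mulrA divff ?gt_eqF// mul1r => rE; congr EFin; lra.
Qed.

End uniform_time.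

Section time_marginal.
Context {R : realType} {N k : nat} (b : 'rV[R]_N -> R -> 'rV[R]_N)
  (sigma : 'rV[R]_N -> R -> 'M[R]_(N, k)) (T : R).
Hypothesis T0 : 0 < T.
Notation S := ('rV[R]_N * R)%type.

Let right_derive_min (c t : R) :
  right_derive (fun s => Num.min s c - s * (c / T)) t ((t < c)%R%:R - c / T).
Proof.
have Tn0 : T != 0 by rewrite gt_eqF.
have [tc|tc] := ltP t c; apply: cvg_near_cst; near=> e; have e0 : 0 < e by [].
  have tec : t + e <= c.
    suff : e < c - t by lra.
    by near: e; apply: nbhs_right_lt; rewrite subr_gt0.
  by rewrite (min_idPl tec) (min_idPl (ltW tc))/= mulr1n; field; rewrite Tn0 gt_eqF.
rewrite (min_idPr tc) (min_idPr _) ?(le_trans tc) ?lerDl ?(ltW e0)//=.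
by rewrite mulr0n; field; rewrite Tn0 gt_eqF.
Unshelve. all: by end_near. Qed.

(* Right derivative [1_{t < c} - c / T]: stationarity forces the time marginal
   to give mass [c / T] to [t < c]. *)
Lemma test_function_time (c : R) : 0 <= c <= T ->
  test_function b sigma T (fun _ t => Num.min t c - t * (c / T))
    (fun _ t => (t < c)%R%:R - c / T).
Proof.
move=> /andP[c0 cT].
have cT0 : 0 <= c / T by rewrite divr_ge0// ltW.
have cT1 : c / T <= 1 by rewrite ler_pdivrMr// mul1r.
have bound (s : R) : 0 <= s <= T -> `|Num.min s c - s * (c / T)| <= T + T.
  move=> /andP[s0 sT]; rewrite (le_trans (ler_normB _ _))// lerD//.
    by rewrite ger0_norm ?ge_min ?sT// le_min s0.
  rewrite ger0_norm; last exact: mulr_ge0.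
  by apply: le_trans sT; rewrite ler_piMr.
split.
- move=> z t _; exists ((t < c)%R%:R - c / T), 0, (fun=> 0); split.
  + exact: right_derive_min.
  + exact: is_derive_cst.
  + by move=> i; exists (fun=> 0); split => *; exact: is_derive_cst.
  + by rewrite big1// mulr0 !addr0.
- move=> p; apply: cvgB; last by apply: cvgMl; exact: cvg_snd.
  have cm : continuous (fun t : R => Num.min t c).
    by move=> t; apply: continuous_min; [exact: cvg_id|exact: cvg_cst].
  exact: (@cvg_comp _ _ _ (snd : S -> R) (fun t : R => Num.min t c) _ _ _ cvg_snd (cm p.2)).
- exists (T + T) => _; exact: bound.
- by move=> _; rewrite (min_idPl c0) (min_idPr cT) mul0r mulrCA divff ?gt_eqF// mulr1 !subrr.
Qed.

Variable (L : (S -> R) -> R) (m : {measure set (g_sigma_algebraType (@open S)) -> \bar R}).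
Hypothesis meanL : mean_functional L.
Hypothesis L0 : forall u g (G : S -> R), test_function b sigma T u g ->
  bounded_fct G -> (forall z t, 0 <= t < T -> G (z, t) = g z t) -> L G = 0.
Hypothesis m1 : m setT = 1%E.
Hypothesis mL : forall G, open G -> (m G <= (L \1_G)%:E)%E.

Let mean_lt (c : R) : 0 <= c <= T -> L \1_[set p | p.2 < c] = c / T.
Proof.
move=> cT; have [LD LZ _ L1] := meanL.
have bI := bounded_indic R (X := S).
have bC := bounded_cst S (- (c / T)).
have := L0 (G := \1_[set p | p.2 < c] + cst (- (c / T))) (test_function_time cT) (bounded_fctD (bI _) bC).
rewrite LD// mean_cst// => /(_ _)/eqP; rewrite subr_eq0 => H; apply/eqP; apply: H => z t _.
rewrite -[(_ + cst _) _]/(\1_[set p : S | p.2 < c] (z, t) - c / T) indicE.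
by congr ((nat_of_bool _)%:R - _); apply/idP/idP => [/set_mem|tc]; [|exact: mem_set].
Qed.

Let open_after (c : R) : open [set p : S | c < p.2].
Proof. by apply: (@open_comp _ _ (snd : S -> R) [set t | c < t]) => [p _|]; [exact: cvg_snd|exact: open_gt]. Qed.

Let open_before (c : R) : open [set p : S | p.2 < c].
Proof. by apply: (@open_comp _ _ (snd : S -> R) [set t | t < c]) => [p _|]; [exact: cvg_snd|exact: open_lt]. Qed.

(** On open sets only [m <= L] is known. The set [t > a] gives the upper bound directly; for the
    lower bound, [t > a] and [t < c] cover everything as soon as [c > a], and [c] can be taken
    arbitrarily close to [a]. *)
Lemma mean_time_marginal (a : R) :
  m [set p | a < p.2] = (1 - Num.max 0 (Num.min a T) / T)%:E.
Proof.
have [LD LZ Lge0 L1] := meanL.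
have bI := bounded_indic R (X := S).
have mo (G : set S) : open G -> measurable (G : set (g_sigma_algebraType (@open S))).
  exact: sub_sigma_algebra.
have upper c : 0 <= c <= T -> c <= a -> (m [set p | (a < p.2)%R] <= (1 - c / T)%:E)%E.
  move=> cT ca; apply: le_trans (mL (@open_after a)) _;  rewrite lee_fin -(mean_lt cT) lerBrDr.
  rewrite -LD// -L1; apply: mean_le => //; first exact: bounded_fctD.
    exact: bounded_cst.
  move=> p; rewrite -[(_ + _) p]/(\1_[set p : S | a < p.2] p + \1_[set p : S | p.2 < c] p) !indicE /=.
  case: (boolP (p \in _)) => [/set_mem/= pa|_].
    by rewrite memNset ?addr0//= => pc; have := lt_le_trans pc ca; rewrite ltNge (ltW pa).
  by rewrite add0r; case: (_ \in _).
have lower c : 0 <= c <= T -> a < c -> ((1 - c / T)%:E <= m [set p | (a < p.2)%R])%E.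
  move=> cT ac; have mlt : (m [set p | (p.2 < c)%R] <= (c / T)%:E)%E.
    by rewrite -(mean_lt cT); exact: mL.
  have -> : (1 - c / T)%:E = (1 - (c / T)%:E)%E by rewrite EFinB.
  rewrite leeBlDr//; apply: (@le_trans _ _ (m [set p | (a < p.2)%R] + m [set p | (p.2 < c)%R])%E).
    rewrite -m1 -[X in (m X <= _)%E](_ : [set p | (a < p.2)%R] `|` [set p | (p.2 < c)%R] = setT).
      exact: measureU2 (mo _ (@open_after a)) (mo _ (@open_before c)).
    apply/seteqP; split => p _ //=; have [?|pa] := ltP a p.2; [by left|right].
    exact: le_lt_trans pa ac.
  by rewrite leeD2l.
have mle1 : (m [set p | (a < p.2)%R] <= 1)%E by rewrite -m1 le_measure ?inE//; exact: mo.
have mge0 : (0 <= m [set p | (a < p.2)%R])%E by [].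
have mfin : m [set p | (a < p.2)%R] \is a fin_num by rewrite ge0_fin_numE// (le_lt_trans mle1) ?ltry.
move: upper lower mle1 mge0; rewrite -(fineK mfin); set x := fine _.
move=> upper lower; rewrite !lee_fin => x1 x0; congr EFin.
have [a0|a0] := ltP a 0.
  rewrite (min_idPl (ltW (lt_trans a0 T0))) (max_idPl (ltW a0)) mul0r subr0.
  have := lower 0; rewrite lexx (ltW T0) => /(_ isT a0); rewrite lee_fin mul0r; lra.
have [aT|aT] := ltP a T; last first.
  rewrite (max_idPr (ltW T0)) divff ?gt_eqF//.
  have := upper T; rewrite lexx (ltW T0) => /(_ isT aT); rewrite lee_fin divff ?gt_eqF//; lra.
rewrite (max_idPr a0).
have xa : x <= 1 - a / T.
  by have := upper a; rewrite a0 (ltW aT) lexx => /(_ isT isT).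
apply/eqP; rewrite eq_le xa/= leNgt; apply/negP => xlt.
(* If the mass [x] were too small, [a] would lie below [(1 - x) * T]; at the midpoint [c] the lower
   bound asks for [c >= (1 - x) * T], a contradiction. *)
pose c := (a + (1 - x) * T) / 2.
have ax : a < (1 - x) * T by rewrite -ltr_pdivrMr//; lra.
have xT : (1 - x) * T <= T by rewrite ger_pMl//; lra.
have /lower : 0 <= c <= T by rewrite /c; lra.
rewrite lee_fin => /(_ _)/wrap[|]; first by rewrite /c; lra.
rewrite leNgt => /negP; apply; rewrite ltrBrDr -ltrBrDl ltr_pdivrMr// /c; lra.
Qed.

End time_marginal.

(** * Periodic solutions from a Lyapunov function *)

(** An alias holding the two proofs, so that the kernel structures below can be attached to a bare
    family of measures. *)
Definition probability_kernel (R : realType) d d' (X : measurableType d)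
    (Y : measurableType d') (f : Y -> {measure set X -> \bar R})
    of (forall A, measurable A -> measurable_fun setT (f ^~ A))
    & (forall y, f y setT = 1%E) : Y -> {measure set X -> \bar R} := f.

Section probability_kernel.
Context (R : realType) d d' (X : measurableType d) (Y : measurableType d').
Variable f : Y -> {measure set X -> \bar R}.
Hypothesis mf : forall A, measurable A -> measurable_fun setT (f ^~ A).
Hypothesis f1 : forall y, f y setT = 1%E.

HB.instance Definition _ := isKernel.Build _ _ _ _ R (probability_kernel mf f1) mf.

HB.instance Definition _ :=
  Kernel_isProbability.Build _ _ _ _ R (probability_kernel mf f1) f1.

Lemma probability_kernel_ex : exists kappa : R.-pker Y ~> X, forall y, kappa y = f y.
Proof. by exists (probability_kernel mf f1). Qed.

End probability_kernel.

(* The representative of [t] modulo [T] in [0, T). *)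
Definition phase (R : realType) (T t : R) : R := t - T * (Num.floor (t / T))%:~R.

Lemma phase_period (R : realType) (T t : R) : 0 < T -> phase T (t + T) = phase T t.
Proof.
move=> T0; rewrite /phase mulrDl divff ?gt_eqF// floorDrz ?floor1 ?int_num1// intrD.
by rewrite mulrDr mulr1 opprD addrACA subrr addr0.
Qed.

Lemma phase_id (R : realType) (T t : R) : 0 <= t < T -> phase T t = t.
Proof.
move=> /andP[t0 tT]; have T0 : 0 < T by exact: le_lt_trans tT.
rewrite /phase (_ : Num.floor _ = 0) ?mulr0 ?subr0//.
by apply: floor_def; rewrite add0r divr_ge0 ?(ltW T0)//= ltr_pdivrMr// mul1r.
Qed.

Lemma measurable_phase (R : realType) (T : R) :
  measurable_fun setT (phase T : measurableTypeR R -> measurableTypeR R).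
Proof.
have mfloor : measurable_fun setT
    ((fun x => (Num.floor x)%:~R) : measurableTypeR R -> measurableTypeR R).
  apply: (measurability _ (RGenOInfty.measurableE R)) => _ [_ [a ->] <-].
  rewrite setTI (_ : _ @^-1` _ = `[(Num.floor a + 1)%:~R, +oo[%classic)//.
  apply/seteqP; split => x /=; rewrite !in_itv/= !andbT -floor_ge_int lezD1 floor_lt_int//.
apply: measurable_funB => //; apply: measurable_funM => //.
by apply: (measurableT_comp mfloor); exact: measurable_funM.
Qed.

Section stationary_measure.
Context {R : realType} {N k : nat} (b : 'rV[R]_N -> R -> 'rV[R]_N)
  (sigma : 'rV[R]_N -> R -> 'M[R]_(N, k)) (T : R).
Hypothesis T0 : 0 < T.
Variables (U LU : 'rV[R]_N -> R -> R) (W : 'rV[R]_N -> R) (C : R).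
Hypothesis U_gen : forall z t, 0 <= t < T -> generator_at b sigma U z t (LU z t).
Hypothesis U_cont : continuous (fun p : 'rV[R]_N * R => U p.1 p.2).
Hypothesis U_per : forall z, U z 0 = U z T.
Hypothesis U_coercive : forall A, exists r, forall z t,
  0 <= t <= T -> U z t <= A -> `|z| <= r.
Hypothesis W_ge0 : forall z, 0 <= W z.
Hypothesis W_coercive : forall A, exists r, forall z, W z <= A -> `|z| <= r.
Hypothesis U_lyapunov : forall z t, 0 <= t < T -> LU z t <= C - W z.

Lemma stationary_measure :
  exists nu : {measure set (borel R N * measurableTypeR R)%type -> \bar R},
  (forall B, measurable B -> nu (setT `*` B) = uniform_prob T0 B) /\
  (forall u g (G : 'rV[R]_N * R -> R), test_function b sigma T u g ->
     bounded_fct G -> continuous G ->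
     (forall z t, 0 <= t < T -> G (z, t) = g z t) -> (\int[nu]_p (G p)%:E = 0)%E).
Proof.
have [L [meanL L0 tightL]] := stationary_mean T0 U_gen U_cont U_per U_coercive
  W_ge0 W_coercive U_lyapunov.
have tight e : 0 < e -> exists2 K : set ('rV[R]_N * R), compact K & 1 - e <= L \1_K.
  by move=> /tightL[r Hr]; exists (cylinder T r) => //; exact: compact_cylinder.
have [m [m1 mL mint]] := mean_riesz space_time_hausdorff space_time_basis meanL tight.
have [nu nuE] := pushforward_measure m (@measurable_id_space_time R N).
exists nu; split.
- have [nt ntE] := pushforward_measure nu (@measurable_snd _ _ (borel R N) (measurableTypeR R)).
  move=> B mB.
  have -> : [set: borel R N] `*` B = (snd : (borel R N * measurableTypeR R)%type -> _) @^-1` B.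
    by apply/seteqP; split => -[x t] //= [].
  rewrite -ntE; apply: uniform_prob_unique => // a.
  rewrite ntE nuE -(mean_time_marginal T0 meanL L0 m1 mL); congr (m _).
  by apply/seteqP; split => -[x t] /=; rewrite in_itv/= andbT.
- move=> u g G tu bG cG GE; rewrite -[RHS](congr1 EFin (L0 u g G tu bG GE)) -mint//.
  pose idS : g_sigma_algebraType (@open ('rV[R]_N * R)%type) -> (borel R N * measurableTypeR R)%type := id.
  pose nu' := pushforward m idS : {measure set (borel R N * measurableTypeR R)%type -> \bar R}.
  have mG := continuous_prod_measurable cG.
  rewrite (eq_measure_integral (nu' measurable_id_space_time)) => [|A mA _]; last exact: nuE.
  rewrite integral_pushforward//; first exact: measurable_id_space_time.
    exact/measurable_EFinP.
  apply: bounded_integrable => //; first by rewrite m1 ltry.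
  exact: continuous_open_measurable.
Qed.

Lemma stationary_kernel :
  exists kappa : R.-pker (measurableTypeR R) ~> (borel R N),
  (forall t A, kappa (t + T) A = kappa t A) /\
  (forall u g (G : 'rV[R]_N * R -> R), test_function b sigma T u g ->
     bounded_fct G -> continuous G ->
     (forall z t, 0 <= t < T -> G (z, t) = g z t) ->
     (\int[lebesgue_measure]_(t in `[0%R, T[) (kernel_mean kappa G t)%:E = 0)%E).
Proof.
have [nu [nuT nu0]] := stationary_measure.
have u1 : (uniform_prob T0 : {measure set (measurableTypeR R) -> \bar R}) setT = 1%E.
  exact: probability_setT.
have uoo : ((uniform_prob T0 : {measure set (measurableTypeR R) -> \bar R}) setT < +oo)%E.
  by rewrite u1 ltry.
have [kappa [mkappa kappa1 kappaE]] := disintegration uoo nuT.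
have mphase A : measurable A -> measurable_fun setT (fun t => kappa (phase T t) A).
  by move=> mA; exact: (measurableT_comp (mkappa _ mA) (measurable_phase T)).
have [kap kapE] := @probability_kernel_ex R _ _ (borel R N) (measurableTypeR R)
  (fun t => kappa (phase T t)) mphase (fun t => kappa1 (phase T t)).
exists kap; split => [t A|u g G tu bG cG GE]; first by rewrite !kapE phase_period.
have nuB A : measurable A -> nu A = bundle_measure kap (uniform_prob T0) A.
  apply: (@measure_unique _ R _
      [set A `*` B | A in (measurable : set (set (borel R N))) &
                     B in (measurable : set (set (measurableTypeR R)))] (fun=> setT)).
  - exact: measurable_prod_measurableType.
  - move=> _ _ [A1 mA1 [B1 mB1 <-]] [A2 mA2 [B2 mB2 <-]].
    exists (A1 `&` A2); first exact: measurableI.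
    by exists (B1 `&` B2); [exact: measurableI|rewrite setXI].
  - by move=> _; exists setT => //; exists setT => //; rewrite setXTT.
  - exact: bigcup_const.
  - move=> _ [A1 mA1 [B1 mB1 <-]]; rewrite kappaE// bundle_measureE integral_mkcond.
    have mI : measurable (`[0, T[%classic : set (measurableTypeR R)).
      exact: measurable_itv.
    have mk : measurable_fun setT (fun t => kap t (ysection (A1 `*` B1) t)).
      by apply: measurable_ysection_kernel; exact: measurableX.
    apply: ae_eq_integral => //.
      by apply/(measurable_restrictT _ _).1 => //; apply: measurable_funTS; exact: mkappa.
    (* The uniform law charges the closed interval [[0, T]]. Its only point outside [[0, T)] is [T],
       of measure zero; on [[0, T)] the phase is the identity, so the periodic kernel is the
       disintegration itself. *)
    exists (~` `[0, T[%classic); split => [||t /= nt].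
    + exact: measurableC.
    + apply: (etrans (uniform_probE T0 (measurableC mI))).
      rewrite (_ : _ `&` _ = [set T]) ?lebesgue_measure_set1 ?mule0//.
      apply/seteqP; split => t /=; rewrite !in_itv/=.
        by move=> [/negP H /andP[t0 tT]]; apply/eqP; rewrite eq_le tT/= leNgt; move: H; rewrite t0.
      by move=> ->; rewrite ltxx andbF (ltW T0) lexx.
    apply: contrapT => tT; apply: nt => _; rewrite patchE kapE.
    have -> : phase T t = t by apply: phase_id; move: tT => /contrapT; rewrite /= in_itv.
    have [tB|tB] := boolP (t \in B1); first by rewrite in_ysectionX.
    by rewrite notin_ysectionX// measure0.
  - by move=> _; rewrite -setXTT nuT// u1 ltry.
have mG := continuous_prod_measurable cG.
apply: uniform_integral0.
- have [M GM] := bG; exact: (measurable_kernel_mean _ mG GM).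
- have [M GM] := bG; exists M => t; exact: (kernel_mean_le _ mG GM).
- rewrite -(bounded_integral_bundle kap uoo bG mG) -(nu0 u g G tu bG cG GE).
  by apply: eq_measure_integral => A mA _; rewrite nuB.
Qed.
End stationary_measure.

(** * Compactly supported test functions and their periodization *)

Section C21_functions.
Context {R : realType} {N : nat}.
Implicit Types (f : 'rV[R]_N -> R -> R).

Lemma continuous_pairl (t : R) : continuous (fun z : 'rV[R]_N => (z, t)).
Proof.
move=> z; apply: (@cvg_pair _ _ _ (nbhs z) (nbhs z) (nbhs t)); first exact: cvg_id.
exact: (@cst_continuous 'rV[R]_N R t z).
Qed.

Lemma continuous_pairr (z : 'rV[R]_N) : continuous (fun t : R => (z, t)).
Proof.
move=> t; apply: (@cvg_pair _ _ _ (nbhs t) (nbhs z) (nbhs t)); last exact: cvg_id.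
exact: (@cst_continuous R 'rV[R]_N z t).
Qed.

Lemma C21_C2 f t : C21 f -> C2 (f ^~ t).
Proof.
move=> [_ f1 f2 _]; split=> i.
  split=> [x|]; first exact: (f1 i).1.
  move=> z; apply: (@continuous_comp _ _ _ (fun z => (z, t))
    (fun p => partial i (f ^~ p.2) p.1) z (@continuous_pairl t z)); exact: (f1 i).2.
move=> j; split=> [x|]; first exact: (f2 j i).1.
move=> z; apply: (@continuous_comp _ _ _ (fun z => (z, t))
  (fun p => partial j (partial i (f ^~ p.2)) p.1) z (@continuous_pairl t z)); exact: (f2 j i).2.
Qed.

Let quotient_shift (h : R -> R) (s t : R) :
  (fun e : R => e^-1 *: (((fun t => h (t + s)) \o shift t) (e *: (1 : R)) - h (t + s))) =
  (fun e => e^-1 *: ((h \o shift (t + s)) (e *: (1 : R)) - h (t + s))).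
Proof. by apply/funext => e /=; rewrite addrA. Qed.

Lemma derive1_shift (h : R -> R) (s t : R) :
  derive1 (fun t => h (t + s)) t = derive1 h (t + s).
Proof. by rewrite !derive1E /derive quotient_shift. Qed.

Lemma derivable_shift (h : R -> R) (s t : R) : derivable h (t + s) 1 ->
  derivable (fun t => h (t + s)) t 1.
Proof. by rewrite /derivable quotient_shift. Qed.

Variables (k : nat) (b : 'rV[R]_N -> R -> 'rV[R]_N)
  (sigma : 'rV[R]_N -> R -> 'M[R]_(N, k)).
Hypothesis b_cont : continuous (fun p : 'rV[R]_N * R => b p.1 p.2).
Hypothesis sigma_cont : continuous (fun p : 'rV[R]_N * R => sigma p.1 p.2).

Lemma continuous_entry (m n : nat) (X : topologicalType) (A : X -> 'M[R]_(m, n)) i j :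
  continuous A -> continuous (fun x => A x i j).
Proof.
move=> cA x; apply: (@continuous_comp _ _ _ A (fun M : 'M[R]_(m, n) => M i j) x (cA x)).
exact: coord_continuous.
Qed.

Lemma continuous_diffusion_coef i j :
  continuous (fun p : 'rV[R]_N * R => diffusion_coef sigma p.1 p.2 i j).
Proof.
have -> : (fun p : 'rV[R]_N * R => diffusion_coef sigma p.1 p.2 i j) =
    (fun p => 2^-1 * \sum_l sigma p.1 p.2 i l * sigma p.1 p.2 j l).
  apply/funext => q; rewrite /diffusion_coef !mxE; congr (_ * _).
  by apply: eq_bigr => l _; rewrite !mxE.
move=> p; apply: cvgM; first exact: cvg_cst.
apply: (@continuous_sum R) => l q.
by apply: cvgM; exact: (continuous_entry sigma_cont).
Qed.

Lemma continuous_generator f : C21 f ->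
  continuous (fun p : 'rV[R]_N * R => generator b sigma f p.1 p.2).
Proof.
move=> [_ f1 f2 [_ ft]] p; rewrite /generator; apply: cvgD; first apply: cvgD.
- exact: ft.
- apply: (@continuous_sum R) => i; apply: (@continuous_sum R) => j q.
  by apply: cvgM; [exact: continuous_diffusion_coef|exact: (f2 i j).2].
- apply: (@continuous_sum R) => i q.
  by apply: cvgM; [exact: (continuous_entry b_cont)|exact: (f1 i).2].
Qed.

(** The complement of [K] is open, so [f] vanishes near each of its points, and all derivatives with
    it. *)
Lemma generator_outside f (K : set ('rV[R]_N * R)) : closed K ->
  (forall x t, ~ K (x, t) -> f x t = 0) ->
  forall x t, ~ K (x, t) -> generator b sigma f x t = 0.
Proof.
move=> cK f0 x t nK.
have f_near (y : 'rV[R]_N) (s : R) : ~ K (y, s) -> \forall p \near (y, s), f p.1 p.2 = 0.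
  move=> nKy; have : nbhs (y, s) (~` K) by apply: open_nbhs_nbhs; split => //; exact: closed_openC.
  by apply: filterS => -[y' s'] /=; exact: f0.
have zero_derive (V : normedModType R) (h : V -> R) (y v : V) :
    (\forall z \near y, h z = 0) -> 'D_v h y = 0.
  by move=> h0; rewrite (@near_eq_derive _ _ _ h (cst 0) y v h0) derive_cst.
have p0 (y : 'rV[R]_N) (s : R) i : ~ K (y, s) -> partial i (f ^~ s) y = 0.
  by move=> nKy; apply: zero_derive; exact: (@continuous_pairl s y _ (f_near y s nKy)).
rewrite /generator derive1E zero_derive ?add0r; last exact: (@continuous_pairr x t _ (f_near x t nK)).
rewrite !big1 ?addr0// => i _; first by rewrite p0// mulr0.
rewrite big1// => j _; rewrite /partial zero_derive ?mulr0//.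
have : nbhs (x, t) (~` K) by apply: open_nbhs_nbhs; split => //; exact: closed_openC.
move=> /(@continuous_pairl t x) H; apply: (@filterS _ (nbhs x) (nbhs_filter x) _ _ _ H) => y /=.
exact: p0.
Qed.

End C21_functions.

Lemma periodicZ (R : realType) (X : Type) (f : R -> X) (T t : R) (i j : nat) :
  (forall t, f (t + T) = f t) -> f (t + (i%:R - j%:R) * T) = f t.
Proof.
move=> fT; have fn n s : f (s + n%:R * T) = f s.
  elim: n => [|n IH]; first by rewrite mul0r addr0.
  by rewrite -natr1 mulrDl mul1r addrA fT.
by rewrite -(fn j) -addrA -mulrDl subrK fn.
Qed.

Section periodization.
Context {R : realType} {N k : nat} (b : 'rV[R]_N -> R -> 'rV[R]_N)
  (sigma : 'rV[R]_N -> R -> 'M[R]_(N, k)) (T : R).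
Hypothesis T0 : 0 < T.
Hypothesis b_cont : continuous (fun p : 'rV[R]_N * R => b p.1 p.2).
Hypothesis sigma_cont : continuous (fun p : 'rV[R]_N * R => sigma p.1 p.2).
Hypothesis b_per : forall z t, b z (t + T) = b z t.
Hypothesis sigma_per : forall z t, sigma z (t + T) = sigma z t.
Notation S := ('rV[R]_N * R)%type.
Notation gen := (generator b sigma).
Notation shift n j := ((j%:R - n%:R) * T).

Lemma generator_at_sum n (f g : nat -> 'rV[R]_N -> R -> R) z t :
  (forall j, generator_at b sigma (f j) z t (g j z t)) ->
  generator_at b sigma (fun z t => \sum_(j < n) f j z t) z t (\sum_(j < n) g j z t).
Proof.
move=> fg; elim: n => [|n IH].
  rewrite big_ord0 (_ : (fun z t => _) = (fun _ _ => 0)); last first.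
    by apply/funext => z'; apply/funext => t'; rewrite big_ord0.
  exact: generator_at0.
rewrite big_ord_recr/= -[g n z t]mul1r.
have -> : (fun z t => \sum_(j < n.+1) f j z t) =
    (fun z t => \sum_(j < n) f j z t + 1 * f n z t).
  by apply/funext => z'; apply/funext => t'; rewrite big_ord_recr/= mul1r.
exact: generator_at_lin.
Qed.

Lemma generator_shift f n j z t :
  gen (fun z t => f z (t + shift n j)) z t = gen f z (t + shift n j).
Proof.
rewrite /generator derive1_shift; congr (_ + _ + _).
  apply: eq_bigr => i _; apply: eq_bigr => l _; congr (_ * _).
  by rewrite /diffusion_coef (@periodicZ _ _ (sigma z) T t j n (sigma_per z)).
by apply: eq_bigr => i _; rewrite (@periodicZ _ _ (b z) T t j n (b_per z)).
Qed.

Variable phi : 'rV[R]_N -> R -> R.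
Hypothesis phiC : C21_compact phi.

Lemma generator_compact :
  exists M n, [/\ 0 <= M, forall z t, `|phi z t| <= M, forall z t, `|gen phi z t| <= M,
    forall z t, n%:R * T <= `|t| -> phi z t = 0 &
    forall z t, n%:R * T <= `|t| -> gen phi z t = 0].
Proof.
have [phi21 [K [cK phi0]]] := phiC.
have clK : closed K by apply: compact_closed => //; exact: space_time_hausdorff.
have gen0 := @generator_outside R N k b sigma phi K clK phi0.
have [r1 [_ r1E]] := compact_bounded cK.
have bd (h : S -> R) : continuous h -> (forall p, ~ K p -> h p = 0) ->
    exists M, forall p, `|h p| <= M.
  move=> ch h0.
  have [M [_ HM]] : bounded_set (h @` K).
    by apply: compact_bounded; apply: continuous_compact => //; exact: continuous_subspaceT.
  exists (`|M| + 1) => p; have [Kp|nKp] := pselect (K p); last by rewrite h0// normr0 addr_ge0.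
  by apply: (HM (`|M| + 1)) => //; rewrite (le_lt_trans (ler_norm _))// ltrDl.
have [M1 H1] := bd (fun p => phi p.1 p.2) (let: And4 c _ _ _ := phi21 in c)
  (fun p => let: (z, t) := p in phi0 z t).
have [M2 H2] := bd (fun p => gen phi p.1 p.2) (continuous_generator b_cont sigma_cont phi21)
  (fun p => let: (z, t) := p in gen0 z t).
pose r := `|r1| + 1; pose n := (Num.truncn (r / T)).+1.
have rn : r < n%:R * T by rewrite -ltr_pdivrMr// truncnS_gt.
have nK z t : n%:R * T <= `|t| -> ~ K (z, t).
  move=> nt /(r1E r (le_lt_trans (ler_norm _) _)) H.
  have : `|(z, t)| <= r by apply: H; rewrite /r ltrDl.
  rewrite prod_normE ge_max/= => /andP[_ tr].
  by have := le_trans nt tr; rewrite leNgt rn.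
exists (`|M1| + `|M2|), n; split.
- by rewrite addr_ge0.
- by move=> z t; rewrite (le_trans (H1 (z, t)))// (le_trans (ler_norm _))// lerDl.
- by move=> z t; rewrite (le_trans (H2 (z, t)))// (le_trans (ler_norm _))// lerDr.
- by move=> z t nt; apply: phi0; exact: nK.
- by move=> z t nt; apply: gen0; exact: nK.
Qed.

Lemma test_function_periodize n M :
  (forall z t, `|phi z t| <= M) -> (forall z t, n%:R * T <= `|t| -> phi z t = 0) ->
  test_function b sigma T (fun z t => \sum_(j < n + n) phi z (t + shift n j))
    (fun z t => \sum_(j < n + n) gen phi z (t + shift n j)).
Proof.
move=> phiM phi0; have [phi21 _] := phiC; have [phi_cont _ _ [phi_t _]] := phi21.
split.
- move=> z t _; apply: (@generator_at_sum _ (fun j z t => phi z (t + shift n j))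
    (fun j z t => gen phi z (t + shift n j))) => j.
  rewrite -generator_shift; apply: generator_at_C2 => [s|z' s].
    exact: C21_C2.
  by apply: derivable_shift; exact: phi_t.
- apply: (@continuous_sum R) => j p.
  apply: (@continuous_comp _ _ _ (fun p : S => (p.1, p.2 + shift n j))
    (fun p : S => phi p.1 p.2)); last exact: phi_cont.
  apply: (@cvg_pair _ _ _ (nbhs p) (nbhs p.1) (nbhs (p.2 + shift n j))).
    exact: cvg_fst.
  by apply: cvgD; [exact: cvg_snd|exact: cvg_cst].
- exists ((n + n)%:R * M) => z t _; apply: le_trans (ler_norm_sum _ _ _) _.
  rewrite -[in (n + n)%:R](card_ord (n + n)) mulr_natl -sumr_const.
  by apply: ler_sum => j _; exact: phiM.
- move=> z; have nT0 : 0 <= n%:R * T by rewrite mulr_ge0// ltW.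
  (* Moving from time 0 to time [T] shifts the index by one. The difference of the end values
     telescopes to [phi] at times [n T] and [- n T], where it vanishes. *)
  have E j : phi z (T + shift n j) = phi z (0 + shift n j.+1).
    by congr (phi z _); rewrite -natr1; ring.
  apply/eqP; rewrite -subr_eq0 -sumrB.
  under eq_bigr do rewrite E -opprB.
  rewrite sumrN oppr_eq0 -(big_mkord xpredT (fun j => phi z (0 + shift n j.+1) - phi z (0 + shift n j))).
  rewrite telescope_sumr// !add0r phi0 ?phi0 ?subrr//.
  + by rewrite mulNr normrN ger0_norm.
  + by rewrite natrD addrK ger0_norm.
Qed.

End periodization.

Section kernel_solution.
Context {R : realType} {N k : nat} (b : 'rV[R]_N -> R -> 'rV[R]_N)
  (sigma : 'rV[R]_N -> R -> 'M[R]_(N, k)) (T : R).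
Hypothesis T0 : 0 < T.
Hypothesis b_cont : continuous (fun p : 'rV[R]_N * R => b p.1 p.2).
Hypothesis sigma_cont : continuous (fun p : 'rV[R]_N * R => sigma p.1 p.2).
Hypothesis b_per : forall z t, b z (t + T) = b z t.
Hypothesis sigma_per : forall z t, sigma z (t + T) = sigma z t.
Notation S := ('rV[R]_N * R)%type.
Notation gen := (generator b sigma).
Notation shift n j := ((j%:R - n%:R) * T).
Notation mu := (@lebesgue_measure R).

Variable kappa : R.-pker (measurableTypeR R) ~> (borel R N).

Lemma continuous_integrable_bundle (K : set S) (f : S -> R) :
  compact K -> continuous f ->
  (bundle_measure kappa mu).-integrable K (EFin \o f).
Proof.
move=> cK cf.
have clK : closed K by apply: compact_closed => //; exact: space_time_hausdorff.
have mK : measurable (K : set (borel R N * measurableTypeR R)%type).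
  by rewrite -(setCK K); apply: measurableC; apply: open_prod_measurable; exact: closed_openC.
have [r [_ rE]] := compact_bounded cK.
pose r1 := `|r| + 1.
have r10 : 0 < r1 by rewrite ltr_wpDl.
have Kr z t : K (z, t) -> `|t| <= r1.
  move=> Kzt; have : `|(z, t)| <= r1.
    by apply: (rE r1) => //; rewrite (le_lt_trans (ler_norm _))// ltrDl.
  by rewrite prod_normE ge_max => /andP[].
have Ioo : (mu `[(- r1)%R, r1]%classic < +oo)%E.
  by rewrite lebesgue_measure_itv/=; case: ifP => _; rewrite -?EFinB ltry.
(* Each section has mass at most 1 and is empty for times outside a bounded interval. *)
have Koo : (bundle_measure kappa mu K < +oo)%E.
  rewrite bundle_measureE; apply: (@le_lt_trans _ _ (\int[mu]_t (\1_(`[- r1, r1]%classic) t)%:E)%E).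
    apply: ge0_le_integral => //.
    - exact: measurable_ysection_kernel.
    - by apply/measurable_EFinP; exact: measurable_indic.
    - move=> t _; rewrite indicE; case: (boolP (t \in _)) => [_|tr].
        by rewrite -(prob_kernel (s := kappa) t) le_measure ?inE//; exact: measurable_ysection.
      rewrite (_ : ysection K t = set0) ?measure0//.
      apply/seteqP; split => z //; rewrite /ysection/= inE => /Kr tr'.
      by move: tr; rewrite mem_set// /= in_itv/= -ler_norml.
  rewrite integral_indic// setIT; exact: Ioo.
apply: measurable_bounded_integrable => //.
  by apply: measurable_funTS; exact: continuous_prod_measurable.
have : bounded_set (f @` K).
  by apply: compact_bounded; apply: continuous_compact => //; exact: continuous_subspaceT.
move=> [M [Mr HM]]; exists M; split => // M' MM' p Kp.
by apply: (HM M' MM'); exists p.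
Qed.

Hypothesis kappa_per : forall t A, kappa (t + T) A = kappa t A.
Hypothesis kappa0 : forall u g (G : S -> R), test_function b sigma T u g ->
  bounded_fct G -> continuous G ->
  (forall z t, 0 <= t < T -> G (z, t) = g z t) ->
  (\int[mu]_(t in `[0%R, T[) (kernel_mean kappa G t)%:E = 0)%E.

Lemma kernel_solution phi : C21_compact phi ->
  (\int[mu]_t \int[kappa t]_z (gen phi z t)%:E = 0)%E.
Proof.
move=> phiC; have [phi21 _] := phiC.
have [M [n [M0 phiM genM phi0 gen0]]] := generator_compact T0 b_cont sigma_cont phiC.
pose G (p : S) := gen phi p.1 p.2.
have cG : continuous G by exact: continuous_generator.
have mG := continuous_prod_measurable cG.
have GM p : `|G p| <= M by exact: genM.
pose H (p : S) := \sum_(j < n + n) G (p.1, p.2 + shift n j).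
have cGj j : continuous (fun p : S => G (p.1, p.2 + shift n j)).
  move=> p.
  apply: (@continuous_comp _ _ _ (fun p : S => (p.1, p.2 + shift n j)) G); last exact: cG.
  apply: (@cvg_pair _ _ _ (nbhs p) (nbhs p.1) (nbhs (p.2 + shift n j))).
    exact: cvg_fst.
  by apply: cvgD; [exact: cvg_snd|exact: cvg_cst].
have cH : continuous H by apply: (@continuous_sum R) => j; exact: cGj.
have HM p : `|H p| <= (n + n)%:R * M.
  apply: le_trans (ler_norm_sum _ _ _) _.
  rewrite -[in (n + n)%:R](card_ord (n + n)) mulr_natl -sumr_const.
  by apply: ler_sum => j _; exact: GM.
have := kappa0 (test_function_periodize T0 b_per sigma_per phiC phiM phi0)
  (G := H) (ex_intro _ _ HM) cH (fun _ _ _ => erefl).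
have kE s : (\int[kappa s]_z (gen phi z s)%:E = (kernel_mean kappa G s)%:E)%E.
  exact: (kernel_meanE kappa mG GM).
under [in X in _ -> X = _]eq_integral do rewrite kE.
(* The integral over all times is folded onto one period. Periodicity of [kappa] then lets all
   translates be integrated against the same [kappa t], which turns the sum into the generator of
   the periodized function. *)
rewrite (@integral_periodize R T (kernel_mean kappa G) n T0).
- move=> H0; rewrite -[RHS]H0; apply: eq_integral => t _.
  rewrite -(kernel_meanE kappa (continuous_prod_measurable cH) HM).
  transitivity (\int[kappa t]_z \sum_(j < n + n) (G (z, t + shift n j))%:E)%E; last first.
    by apply: eq_integral => z _; rewrite /H sumEFin.
  have mGj j : measurable_fun setT (fun z : borel R N => G (z, t + shift n j)).
    apply: (measurableT_comp mG); apply: measurable_fun_pair => //; exact: measurable_id.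
  rewrite integral_sum//; last first.
    move=> j; apply: bounded_integrable => //; first by rewrite prob_kernel ltry.
    by exists M => z; exact: GM.
  rewrite -sumEFin; apply: eq_bigr => j _; rewrite -(kernel_meanE kappa mG GM).
  by apply: eq_measure_integral => A _ _; exact: (@periodicZ _ _ (kappa ^~ A)).
- exact: (measurable_kernel_mean _ mG GM).
- by exists M => t; exact: (kernel_mean_le _ mG GM).
- move=> t nt; rewrite /kernel_mean integral0_eq// => z _; rewrite /G/= gen0//.
  rewrite leNgt; apply/negP => tn; move: nt; rewrite negb_and => /orP[].
    by rewrite -ltNge => tn'; have := ler_norm (- t); rewrite normrN; lra.
  by rewrite -leNgt => tn'; have := ler_norm t; lra.
Qed.

End kernel_solution.

Theorem periodic_solution (R : realType) (N k : nat) (b : 'rV[R]_N -> R -> 'rV[R]_N)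
    (sigma : 'rV[R]_N -> R -> 'M[R]_(N, k)) (T : R)
    (U LU : 'rV[R]_N -> R -> R) (W : 'rV[R]_N -> R) (C : R) : 0 < T ->
  continuous (fun p : 'rV[R]_N * R => b p.1 p.2) ->
  continuous (fun p : 'rV[R]_N * R => sigma p.1 p.2) ->
  (forall z t, b z (t + T) = b z t) -> (forall z t, sigma z (t + T) = sigma z t) ->
  (forall z t, generator_at b sigma U z t (LU z t)) ->
  continuous (fun p : 'rV[R]_N * R => U p.1 p.2) ->
  (forall z, U z 0 = U z T) ->
  (forall A, exists r, forall z t, U z t <= A -> `|z| <= r) ->
  (forall z, 0 <= W z) -> (forall A, exists r, forall z, W z <= A -> `|z| <= r) ->
  (forall z t, LU z t <= C - W z) ->
  exists mu : {measure set (borel R N * measurableTypeR R)%type -> \bar R},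
    periodic_probability_solution T b sigma mu.
Proof.
move=> T0 b_cont sigma_cont b_per sigma_per U_gen U_cont U_per U_co W0 W_co ULW.
have [kappa [kappa_per kappa0]] := stationary_kernel T0 (fun z t _ => U_gen z t) U_cont U_per
  (fun A => let: ex_intro r H := U_co A in ex_intro _ r (fun z t _ => H z t)) W0 W_co
  (fun z t _ => ULW z t).
exists (bundle_measure kappa lebesgue_measure), kappa; split.
- by move=> A _; rewrite bundle_measureE.
- by move=> t A _; rewrite kappa_per.
- move=> K cK; split=> [i j|i].
    by have := continuous_integrable_bundle kappa cK (@continuous_diffusion_coef _ _ _ _ sigma_cont i j).
  by have := continuous_integrable_bundle kappa cK (@continuous_entry _ _ _ _ _ 0 i b_cont).
- move=> phi phiC.
  by have := kernel_solution T0 b_cont sigma_cont b_per sigma_per kappa_per kappa0 phiC.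
Qed.

(** * The energy of the system *)

Section euclidean.
Context {R : realType} {n : nat}.
Implicit Types (u v w : 'rV[R]_n).

Lemma dotvv_ge0 u : 0 <= dotv u u.
Proof. by apply: sumr_ge0 => i _; rewrite -expr2 sqr_ge0. Qed.

Lemma enorm_ge0 u : 0 <= enorm u. Proof. exact: sqrtr_ge0. Qed.

Lemma enorm_sqr u : enorm u ^+ 2 = dotv u u.
Proof. by rewrite sqr_sqrtr// dotvv_ge0. Qed.

Lemma coord_enorm u i : `|u 0 i| <= enorm u.
Proof.
rewrite -sqrtr_sqr ler_wsqrtr// /dotv (bigD1 i)//= expr2 lerDl.
by apply: sumr_ge0 => j _; rewrite -expr2 sqr_ge0.
Qed.

Lemma dotvDl u v w : dotv (u + v) w = dotv u w + dotv v w.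
Proof. by rewrite -big_split; apply: eq_bigr => i _; rewrite mxE mulrDl. Qed.

Lemma cauchy_schwarz u v : `|dotv u v| <= enorm u * enorm v.
Proof.
rewrite /enorm -sqrtrM ?dotvv_ge0// -sqrtr_sqr ler_wsqrtr//.
have [v0|v0] := eqVneq (dotv v v) 0.
  rewrite [dotv u v]big1 ?expr0n ?v0 ?mulr0// => i _.
  have : `|v 0 i| <= 0 by rewrite (le_trans (coord_enorm v i))// /enorm v0 sqrtr0.
  by rewrite normr_le0 => /eqP ->; rewrite mulr0.
have vp : 0 < dotv v v by rewrite lt0r v0 dotvv_ge0.
have : 0 <= \sum_i (dotv v v * u 0 i - dotv u v * v 0 i) ^+ 2.
  by apply: sumr_ge0 => i _; exact: sqr_ge0.
have -> : \sum_i (dotv v v * u 0 i - dotv u v * v 0 i) ^+ 2 =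
    dotv v v * (dotv u u * dotv v v - dotv u v ^+ 2).
  transitivity (\sum_i (dotv v v ^+ 2 * (u 0 i * u 0 i) -
      2 * dotv v v * dotv u v * (u 0 i * v 0 i) + dotv u v ^+ 2 * (v 0 i * v 0 i))).
    by apply: eq_bigr => i _; ring.
  rewrite big_split/= sumrB -!mulr_sumr /dotv; ring.
by rewrite pmulr_rge0// subr_ge0.
Qed.

Lemma norm_le_coord u (r : R) : 0 <= r -> (forall i, `|u 0 i| <= r) -> `|u| <= r.
Proof.
move=> r0 ur; rewrite [leLHS]/Num.norm/= mx_normrE; apply/bigmax_leP; split => // -[i j] _ /=.
by rewrite ord1.
Qed.

Lemma norm_le_enorm u : `|u| <= enorm u.
Proof. by apply: norm_le_coord; [exact: enorm_ge0|exact: coord_enorm]. Qed.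

End euclidean.

Lemma continuous_mx (R : realType) (m n : nat) (X : topologicalType) (A : X -> 'M[R]_(m, n)) :
  (forall i j, continuous (fun x => A x i j)) -> continuous A.
Proof.
move=> cA x B [P PA PB].
have : \forall y \near x, forall ij : 'I_m * 'I_n, P ij.1 ij.2 (A y ij.1 ij.2).
  by apply: filter_forall => ij; exact: (cA ij.1 ij.2 x _ (PA ij.1 ij.2)).
by apply: filterS => y Py; apply: PB => i j; exact: (Py (i, j)).
Qed.

Lemma partial_sym (R : realType) (n : nat) (f : 'rV[R]_n -> R) i j x : C2 f ->
  partial i (partial j f) x = partial j (partial i f) x.
Proof.
move=> [f1 f2]; apply: (@derive_sym _ _ f x (delta_mx 0 j) (delta_mx 0 i)
  (partial j f) (partial i f) (partial i (partial j f)) (partial j (partial i f))).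
- by move=> y; apply: DeriveDef; [exact: (f1 j).1|].
- by move=> y; apply: DeriveDef; [exact: (f1 i).1|].
- by move=> y; apply: DeriveDef; [exact: (f2 j i).1|].
- by move=> y; apply: DeriveDef; [exact: (f2 i j).1|].
- exact: (f2 j i).2.
- exact: (f2 i j).2.
Qed.

Lemma is_derive_dotv (R : realType) (n : nat) (u v : R -> 'rV[R]_n) (r : R)
    (du dv : 'rV[R]_n) :
  (forall i, is_derive r (1 : R) (fun s => u s 0 i) (du 0 i)) ->
  (forall i, is_derive r (1 : R) (fun s => v s 0 i) (dv 0 i)) ->
  is_derive r (1 : R) (fun s => dotv (u s) (v s)) (dotv (u r) dv + dotv du (v r)).
Proof.
move=> Hu Hv.
have -> : (fun s => dotv (u s) (v s)) = \sum_i ((fun s => u s 0 i) * (fun s => v s 0 i)).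
  by apply/funext => s; rewrite fct_sumE.
rewrite /dotv -big_split/=; apply: is_derive_sum => i.
have D := is_deriveM (Hu i) (Hv i).
by apply: (is_derive_eq D); rewrite [du 0 i * _]mulrC.
Qed.

Lemma is_derive_affine (R : realType) (x y r : R) :
  is_derive r (1 : R) (fun s : R => x + s * y) y.
Proof.
have H := @is_derive_line R R id x y r y.
by apply: H; apply: is_derive_eq.
Qed.

Lemma dotv_grad (R : realType) (n : nat) (f : 'rV[R]_n -> R) (x v : 'rV[R]_n) :
  dotv v (grad f x) = \sum_i v 0 i * partial i f x.
Proof. by apply: eq_bigr => i _; rewrite mxE. Qed.

Section energy.
Context {R : realType} {n : nat} (F : 'rV[R]_n -> R) (V : 'rV[R]_n -> R -> R)
  (E : 'rV[R]_n -> 'rV[R]_n -> R -> 'rV[R]_n)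
  (Sigma : 'rV[R]_n -> 'rV[R]_n -> R -> 'M[R]_n) (a : R).
Hypothesis F_C2 : C2 F.
Hypothesis V_C21 : C21 V.

(* In the variable [y + shear x] the drift no longer contains [D^2 F]. *)
Definition shear (x : 'rV[R]_n) : 'rV[R]_n := grad F x - a *: x.

Definition energy (z : 'rV[R]_(n + n)) (t : R) : R :=
  let x := lsubmx z in let y := rsubmx z in
  2^-1 * dotv (y + shear x) (y + shear x)
  + (V x t + (a * F x - a ^+ 2 / 2 * dotv x x)).

(** Along the drift, [w = y + shear x] has derivative [- grad V - E - a y]. In the derivative of
    [|w|^2 / 2], the term [- <y, grad V>] is cancelled by the derivative of [V], and
    [- a <y, shear x>] by that of [a F - a^2 |x|^2 / 2]; this is what remains. *)
Definition energy_dissipation (z : 'rV[R]_(n + n)) (t : R) : R :=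
  let x := lsubmx z in let y := rsubmx z in
  - dotv (grad (V ^~ t) x) (shear x) - dotv (y + shear x) (E x y t) - a * dotv y y.

Let b := system_drift F V E.
Let sigma := system_diffusion Sigma.

Let lsubmx_drift z t s : lsubmx (z + s *: b z t) = lsubmx z + s *: rsubmx z.
Proof. by rewrite linearD linearZ/= row_mxKl. Qed.

Let rsubmx_drift z t s : rsubmx (z + s *: b z t) = rsubmx z - s *:
  ((hessian F (lsubmx z) *m (rsubmx z)^T)^T + grad (V ^~ t) (lsubmx z) +
   E (lsubmx z) (rsubmx z) t).
Proof. by rewrite linearD linearZ/= row_mxKr scalerN. Qed.

Let diffusion_col z t l : (col l (sigma z t))^T =
  row_mx 0 (col l (Sigma (lsubmx z) (rsubmx z) t))^T.
Proof. by rewrite /sigma /system_diffusion col_col_mx tr_col_mx linear0 trmx0. Qed.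

Let lsubmx_diffusion z t l s : lsubmx (z + s *: (col l (sigma z t))^T) = lsubmx z.
Proof. by rewrite diffusion_col linearD linearZ/= row_mxKl scaler0 addr0. Qed.

Let rsubmx_diffusion z t l s : rsubmx (z + s *: (col l (sigma z t))^T) =
  rsubmx z + s *: (col l (Sigma (lsubmx z) (rsubmx z) t))^T.
Proof. by rewrite diffusion_col linearD linearZ/= row_mxKr. Qed.

Lemma energy_drift z t :
  is_derive (0 : R) (1 : R) (fun s : R => energy (z + s *: b z t) t)
    (energy_dissipation z t).
Proof.
pose x := lsubmx z; pose y := rsubmx z.
pose g := (hessian F x *m y^T)^T + grad (V ^~ t) x + E x y t.
pose w (s : R) := y - s *: g + shear (x + s *: y).
have dF : is_derive (0 : R) (1 : R) (fun s : R => F (x + s *: y)) (dotv y (grad F x)).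
  apply: (@is_derive_line _ _ F); rewrite scale0r addr0 dotv_grad.
  exact: C1_is_derive F_C2.1.
have dV : is_derive (0 : R) (1 : R) (fun s : R => V (x + s *: y) t) (dotv y (grad (V ^~ t) x)).
  apply: (@is_derive_line _ _ (V ^~ t)); rewrite scale0r addr0 dotv_grad.
  exact: C1_is_derive (C21_C2 t V_C21).1.
have dx i : is_derive (0 : R) (1 : R) (fun s : R => (x + s *: y) 0 i) (y 0 i).
  have -> : (fun s : R => (x + s *: y) 0 i) = (fun s => x 0 i + s * y 0 i).
    by apply/funext => s; rewrite !mxE.
  exact: is_derive_affine.
have dw i : is_derive (0 : R) (1 : R) (fun s => w s 0 i)
    ((- grad (V ^~ t) x - E x y t - a *: y) 0 i).
  have -> : (fun s => w s 0 i) = (fun s => y 0 i + s * (- g 0 i)) +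
      (fun s => partial i F (x + s *: y)) + (fun s => (- a * x 0 i) + s * (- a * y 0 i)).
    apply/funext => s; rewrite -[RHS]/(y 0 i + s * (- g 0 i) + partial i F (x + s *: y) +
      (- a * x 0 i + s * (- a * y 0 i))).
    by rewrite /w /shear /g !mxE; ring.
  (* The derivative of [partial i F] along [y] sums [partial j (partial i F)], whereas row [i] of
     the Hessian has the opposite order; symmetry of the second derivatives reconciles them, and the
     term cancels against the drift. *)
  have D2 : is_derive (0 : R) (1 : R) (fun s : R => partial i F (x + s *: y))
      (((hessian F x *m y^T)^T) 0 i).
    apply: (@is_derive_line _ _ (partial i F)); rewrite scale0r addr0.
    have := C1_is_derive x y (F_C2.2 i).
    congr (is_derive _ _ _ _); rewrite !mxE; apply: eq_bigr => j _.
    by rewrite !mxE mulrC partial_sym.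
  have D := is_deriveD (is_deriveD (is_derive_affine (y 0 i) (- g 0 i) 0) D2)
    (is_derive_affine (- a * x 0 i) (- a * y 0 i) 0).
  by apply: (is_derive_eq D); rewrite /g !mxE; ring.
rewrite (_ : (fun s => _) = (fun s : R => 2^-1 * dotv (w s) (w s) +
   (V (x + s *: y) t + (a * F (x + s *: y) - a ^+ 2 / 2 * dotv (x + s *: y) (x + s *: y))))); last first.
  by apply/funext => s; rewrite /energy lsubmx_drift rsubmx_drift.
have D := is_deriveD (is_deriveZ 2^-1 (is_derive_dotv dw dw))
  (is_deriveD dV (is_deriveB (is_deriveZ a dF) (is_deriveZ (a ^+ 2 / 2) (is_derive_dotv dx dx)))).
apply: (is_derive_eq D).
have w0 : w 0 = y + shear x by rewrite /w scale0r subr0 scale0r addr0.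
rewrite w0 scale0r addr0 /energy_dissipation -/x -/y /GRing.scale/=.
rewrite /dotv /shear -?big_split/= !mulr_sumr -?sumrN -!big_split; apply: eq_bigr => i _.
by rewrite /= !mxE; field.
Qed.

(** A column of the diffusion matrix moves [y] alone, in which the energy is a quadratic form with
    Hessian the identity. *)
Lemma energy_diffusion z t l : let S := (col l (Sigma (lsubmx z) (rsubmx z) t))^T in
  exists dU : R -> R, (forall r : R, is_derive r (1 : R)
     (fun s : R => energy (z + s *: (col l (sigma z t))^T) t) (dU r)) /\
   is_derive (0 : R) (1 : R) dU (dotv S S).
Proof.
move=> S; pose w (s : R) := rsubmx z + s *: S + shear (lsubmx z).
exists (fun r => dotv (w r) S).
have dw r i : is_derive r (1 : R) (fun s => w s 0 i) (S 0 i).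
  have -> : (fun s => w s 0 i) = (fun s => (rsubmx z + shear (lsubmx z)) 0 i + s * S 0 i).
    by apply/funext => s; rewrite /w !mxE; ring.
  exact: is_derive_affine.
split.
  move=> r; rewrite (_ : (fun s => _) = (fun s : R => 2^-1 * dotv (w s) (w s) +
      (V (lsubmx z) t + (a * F (lsubmx z) - a ^+ 2 / 2 * dotv (lsubmx z) (lsubmx z))))); last first.
    by apply/funext => s; rewrite /energy lsubmx_diffusion rsubmx_diffusion.
  have D := is_deriveD (is_deriveZ 2^-1 (is_derive_dotv (dw r) (dw r)))
    (is_derive_cst (V (lsubmx z) t + (a * F (lsubmx z) - a ^+ 2 / 2 * dotv (lsubmx z) (lsubmx z))) r 1).
  apply: (is_derive_eq D); rewrite /GRing.scale/= addr0.
  rewrite [dotv S _](_ : _ = dotv (w r) S); first by field.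
  by apply: eq_bigr => i _; rewrite mulrC.
have dS i : is_derive (0 : R) (1 : R) (fun=> S 0 i) ((0 : 'rV[R]_n) 0 i).
  by rewrite [X in is_derive _ _ _ X]mxE; exact: is_derive_cst.
apply: (is_derive_eq (is_derive_dotv (dw 0) dS)).
rewrite [dotv _ 0](_ : _ = 0) ?add0r//; apply: big1 => i _.
by rewrite [X in _ * X]mxE mulr0.
Qed.

Lemma energy_generator z t : generator_at b sigma energy z t
  (derive1 (V (lsubmx z)) t + energy_dissipation z t
   + 2^-1 * \tr (Sigma (lsubmx z) (rsubmx z) t *m (Sigma (lsubmx z) (rsubmx z) t)^T)).
Proof.
exists (derive1 (V (lsubmx z)) t), (energy_dissipation z t),
  (fun l => dotv (col l (Sigma (lsubmx z) (rsubmx z) t))^T (col l (Sigma (lsubmx z) (rsubmx z) t))^T).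
split.
- have [_ _ _ [Vt _]] := V_C21.
  have := derivable_right_derive (Vt (lsubmx z) t); rewrite /right_derive.
  rewrite (_ : (fun e : R => e^-1 * (energy z (t + e) - energy z t)) =
    (fun e => e^-1 * (V (lsubmx z) (t + e) - V (lsubmx z) t)))//.
  by apply/funext => e; rewrite /energy; congr (_ * _); ring.
- exact: energy_drift.
- exact: energy_diffusion.
- congr (_ + _ * _); rewrite /mxtrace; under eq_bigr do rewrite mxE.
  rewrite exchange_big; apply: eq_bigr => l _; apply: eq_bigr => i _.
  by rewrite !mxE.
Qed.

End energy.

(** * Continuity of the coefficients and of the energy *)

Section continuity.
Context {R : realType} {n : nat}.

Lemma continuous_dotv (X : topologicalType) (u v : X -> 'rV[R]_n) :
  continuous u -> continuous v -> continuous (fun x => dotv (u x) (v x)).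
Proof.
move=> cu cv; apply: (@continuous_sum R) => i x.
by apply: cvgM; exact: continuous_entry.
Qed.

Lemma continuous_shear (F : 'rV[R]_n -> R) a : C1 F -> continuous (shear F a).
Proof.
move=> F1; apply: continuous_mx => i j; rewrite ord1.
rewrite (_ : (fun x => _) = (fun x => partial j F x - a * x 0 j)); last first.
  by apply/funext => x; rewrite !mxE.
move=> x; apply: cvgB; [exact: nbhs_filter|exact: (F1 j).2|].
by apply: cvgM; [exact: nbhs_filter|exact: cst_continuous|exact: coord_continuous].
Qed.

Lemma continuous_bounded_ball (h : 'rV[R]_n -> R) (r : R) : continuous h ->
  exists M, forall x, enorm x <= r -> `|h x| <= M.
Proof.
move=> ch.
have [M [_ HM]] : bounded_set (h @` [set x | `|x| <= r]).
  apply: compact_bounded; apply: continuous_compact; last exact: compact_norm_ball.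
  exact: continuous_subspaceT.
exists (`|M| + 1) => x xr; apply: (HM (`|M| + 1)).
  by rewrite (le_lt_trans (ler_norm _))// ltrDl.
by exists x => //=; apply: le_trans xr; exact: norm_le_enorm.
Qed.

Lemma enorm_le_sqr (x : 'rV[R]_n) : enorm x <= 1 + dotv x x.
Proof. by rewrite -enorm_sqr; have := sqr_ge0 (enorm x - 2^-1); lra. Qed.

Lemma norm_row_le (z : 'rV[R]_(n + n)) (r s : R) :
  (forall i, `|lsubmx z 0 i| <= r) -> (forall i, `|rsubmx z 0 i| <= s) -> `|z| <= `|r| + `|s|.
Proof.
move=> zr zs; apply: norm_le_coord => [|i]; first exact: addr_ge0.
case: (split_ordP i) => k ->.
  have := zr k; rewrite mxE => /le_trans; apply.
  by rewrite (le_trans (ler_norm r))// lerDl.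
have := zs k; rewrite mxE => /le_trans; apply.
by rewrite (le_trans (ler_norm s))// lerDr.
Qed.

Notation S := ('rV[R]_(n + n) * R)%type.
Variables (F : 'rV[R]_n -> R) (V : 'rV[R]_n -> R -> R)
  (E : 'rV[R]_n -> 'rV[R]_n -> R -> 'rV[R]_n)
  (Sigma : 'rV[R]_n -> 'rV[R]_n -> R -> 'M[R]_n).
Hypothesis D2F_cont : continuous (hessian F).
Hypothesis DV_cont : continuous (fun p : 'rV[R]_n * R => grad (V ^~ p.2) p.1).
Hypothesis E_cont : continuous
  (fun p : 'rV[R]_n * 'rV[R]_n * R => E p.1.1 p.1.2 p.2).
Hypothesis Sigma_cont : continuous
  (fun p : 'rV[R]_n * 'rV[R]_n * R => Sigma p.1.1 p.1.2 p.2).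

Let cx : continuous (fun p : S => lsubmx p.1).
Proof.
move=> p; apply: (@continuous_comp _ _ _ (fst : S -> _) lsubmx).
  exact: cvg_fst.
exact: continuous_lsubmx.
Qed.

Let cy : continuous (fun p : S => rsubmx p.1).
Proof.
move=> p; apply: (@continuous_comp _ _ _ (fst : S -> _) rsubmx).
  exact: cvg_fst.
exact: continuous_rsubmx.
Qed.

Let cxt : continuous (fun p : S => (lsubmx p.1, p.2)).
Proof.
move=> p; apply: (@cvg_pair _ _ _ (nbhs p) (nbhs (lsubmx p.1)) (nbhs p.2)).
  exact: cx.
exact: cvg_snd.
Qed.

Let cxyt : continuous (fun p : S => (lsubmx p.1, rsubmx p.1, p.2)).
Proof.
move=> p.
apply: (@cvg_pair _ _ _ (nbhs p) (nbhs (lsubmx p.1, rsubmx p.1)) (nbhs p.2)); last exact: cvg_snd.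
apply: (@cvg_pair _ _ _ (nbhs p) (nbhs (lsubmx p.1)) (nbhs (rsubmx p.1))).
  exact: cx.
exact: cy.
Qed.

Lemma continuous_system_drift :
  continuous (fun p : S => system_drift F V E p.1 p.2).
Proof.
apply: continuous_mx => i j; rewrite ord1.
have [l ->|l ->] := split_ordP j.
  rewrite (_ : (fun p => _) = (fun p : S => rsubmx p.1 0 l)).
    exact: continuous_entry.
  by apply/funext => p; rewrite row_mxEl.
rewrite (_ : (fun p => _) = (fun p : S => - (
    \sum_k hessian F (lsubmx p.1) l k * rsubmx p.1 0 k +
    grad (V ^~ p.2) (lsubmx p.1) 0 l + E (lsubmx p.1) (rsubmx p.1) p.2 0 l))); last first.
  apply/funext => p; rewrite row_mxEr !mxE; congr (- (_ + _ + _)).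
  by apply: eq_bigr => k _; rewrite !mxE.
move=> p; apply: cvgN; apply: cvgD; first apply: cvgD.
- apply: (@continuous_sum R) => k q; apply: cvgM; last exact: (continuous_entry cy).
  apply: (@continuous_entry R n n S (fun p => hessian F (lsubmx p.1))) => q'.
  by apply: (@continuous_comp _ _ _ (fun p : S => lsubmx p.1) (hessian F)); [exact: cx|exact: D2F_cont].
- apply: (@continuous_entry R 1 n S (fun p => grad (V ^~ p.2) (lsubmx p.1))) => q.
  apply: (@continuous_comp _ _ _ (fun p : S => (lsubmx p.1, p.2))
    (fun p => grad (V ^~ p.2) p.1)); [exact: cxt|exact: DV_cont].
- apply: (@continuous_entry R 1 n S (fun p => E (lsubmx p.1) (rsubmx p.1) p.2)) => q.
  apply: (@continuous_comp _ _ _ (fun p : S => (lsubmx p.1, rsubmx p.1, p.2))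
    (fun p => E p.1.1 p.1.2 p.2)); [exact: cxyt|exact: E_cont].
Qed.

Lemma continuous_system_diffusion :
  continuous (fun p : S => system_diffusion Sigma p.1 p.2).
Proof.
apply: continuous_mx => i j.
have [l ->|l ->] := split_ordP i.
  rewrite (_ : (fun p => _) = cst 0); first exact: cst_continuous.
  by apply/funext => p; rewrite col_mxEu mxE.
rewrite (_ : (fun p => _) = (fun p : S => Sigma (lsubmx p.1) (rsubmx p.1) p.2 l j)); last first.
  by apply/funext => p; rewrite col_mxEd.
apply: (@continuous_entry R n n S (fun p => Sigma (lsubmx p.1) (rsubmx p.1) p.2)) => q.
apply: (@continuous_comp _ _ _ (fun p : S => (lsubmx p.1, rsubmx p.1, p.2))
  (fun p => Sigma p.1.1 p.1.2 p.2)); [exact: cxyt|exact: Sigma_cont].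
Qed.

Lemma continuous_energy a : C1 F -> C21 V -> continuous (fun p : S => energy F V a p.1 p.2).
Proof.
move=> F1 [cV _ _ _].
have cF : continuous (fun p : S => F (lsubmx p.1)).
  move=> p; apply: (@continuous_comp _ _ _ (fun p : S => lsubmx p.1) F); first exact: cx.
  exact: C1_continuous.
have csh : continuous (fun p : S => rsubmx p.1 + shear F a (lsubmx p.1)).
  move=> p; apply: cvgD; first exact: cy.
  apply: (@continuous_comp _ _ _ (fun p : S => lsubmx p.1) (shear F a)); first exact: cx.
  exact: continuous_shear.
move=> p; apply: cvgD.
  by apply: cvgM; [exact: cvg_cst|exact: (continuous_dotv csh csh)].
apply: cvgD.
  by apply: (@continuous_comp _ _ _ (fun p : S => (lsubmx p.1, p.2))
    (fun p => V p.1 p.2)); [exact: cxt|exact: cV].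
apply: cvgB; first by apply: cvgM; [exact: cvg_cst|exact: cF].
by apply: cvgM; [exact: cvg_cst|exact: (continuous_dotv cx cx)].
Qed.

End continuity.

(** * The Lyapunov inequality and coercivity *)

Section lyapunov_bounds.
Context {R : realType} {n : nat}.
Variables (F : 'rV[R]_n -> R) (V : 'rV[R]_n -> R -> R)
  (E : 'rV[R]_n -> 'rV[R]_n -> R -> 'rV[R]_n)
  (Sigma : 'rV[R]_n -> 'rV[R]_n -> R -> 'M[R]_n)
  (a b M m c1 c2 M1 M2 e : R).
Hypotheses (a_gt0 : 0 < a) (b_gt0 : 0 < b) (m_gt0 : 0 < m) (c1_gt0 : 0 < c1)
  (c_lt1 : c1 + c2 < 1) (e_ge0 : 0 <= e) (F_C1 : C1 F).
Hypothesis V_dissip : forall x t,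
  - dotv (grad (V ^~ t) x) (grad F x - a *: x) <= M - b * enorm x `^ (2 * m).
Hypothesis E_bound : forall x y t, enorm (E x y t) <= e.
Hypothesis E_small : e * enorm (grad F x - a *: x) / enorm x `^ (2 * m)
  @[x --> @enorm_infty R n] --> (0 : R).
Hypothesis Vt_bound : forall x t,
  `|derive1 (V x) t| <= c1 * b * enorm x `^ (2 * m) + M1.
Hypothesis Sigma_bound : forall x y t, \tr (Sigma x y t *m (Sigma x y t)^T)
  <= 2 * c2 * (a * enorm y ^+ 2 + b * enorm x `^ (2 * m)) + M2.

(** After the growth of [V_t] and of the trace is paid for, the fraction [1 - (c1 + c2)] of the
    dissipation is still available; half of it absorbs [E], and this is the other half. *)
Definition dissipation_rate (z : 'rV[R]_(n + n)) : R :=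
  (1 - (c1 + c2)) / 2 * (b * enorm (lsubmx z) `^ (2 * m) + a * enorm (rsubmx z) ^+ 2).

Let d : R := 1 - (c1 + c2).

Let d_gt0 : 0 < d. Proof. by rewrite subr_gt0. Qed.

Lemma dissipation_rate_ge0 z : 0 <= dissipation_rate z.
Proof.
rewrite mulr_ge0 ?divr_ge0 ?(ltW d_gt0)// addr_ge0// mulr_ge0 ?(ltW b_gt0) ?(ltW a_gt0)//.
  exact: powR_ge0.
exact: sqr_ge0.
Qed.

Lemma dissipation_rate_coercive A : exists r, forall z, dissipation_rate z <= A -> `|z| <= r.
Proof.
pose K := A / (d / 2).
exists (`|(`|K| / b) `^ (2 * m)^-1| + `|1 + `|K| / a|) => z Wz.
have d2 : 0 < d / 2 by rewrite divr_gt0.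
have X0 : 0 <= enorm (lsubmx z) `^ (2 * m) by exact: powR_ge0.
have Y0 : 0 <= enorm (rsubmx z) ^+ 2 by exact: sqr_ge0.
have aY : 0 <= a * enorm (rsubmx z) ^+ 2 by rewrite mulr_ge0// ltW.
have bX : 0 <= b * enorm (lsubmx z) `^ (2 * m) by rewrite mulr_ge0// ltW.
have WK : b * enorm (lsubmx z) `^ (2 * m) + a * enorm (rsubmx z) ^+ 2 <= `|K|.
  by apply: le_trans (ler_norm _); rewrite /K ler_pdivlMr// mulrC.
apply: norm_row_le => i; apply: le_trans (coord_enorm _ _) _.
- have XK : enorm (lsubmx z) `^ (2 * m) <= `|K| / b by rewrite ler_pdivlMr// mulrC; lra.
  have x0 := enorm_ge0 (lsubmx z).
  have <- : (enorm (lsubmx z) `^ (2 * m)) `^ (2 * m)^-1 = enorm (lsubmx z).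
    by rewrite -powRrM divff ?powRr1// gt_eqF// mulr_gt0.
  apply: (ge0_ler_powR _ _ _ XK); rewrite ?nnegrE//.
  + by rewrite invr_ge0 mulr_ge0// ltW.
  + by rewrite divr_ge0// ltW.
- have YK : enorm (rsubmx z) ^+ 2 <= `|K| / a by rewrite ler_pdivlMr// mulrC; lra.
  by apply: le_trans (enorm_le_sqr _) _; rewrite -enorm_sqr lerD2l.
Qed.

Lemma perturbation_bound : exists C, forall x,
  e * enorm (shear F a x) <= d * b / 2 * enorm x `^ (2 * m) + C.
Proof.
have eps0 : 0 < d * b / 2 by rewrite divr_gt0// mulr_gt0.
have [r _ Hr] := E_small (nbhsx_ballx (0 : R) _ eps0).
(* Taking at least 0 as radius makes [enorm x] positive outside the ball, so the quotient in
   [E_small] can be multiplied out; inside, continuity gives the constant. *)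
have [B HB] := continuous_bounded_ball (Num.max r 0)
  (continuous_dotv (continuous_shear (a := a) F_C1) (continuous_shear (a := a) F_C1)).
exists (e * (1 + `|B|)) => x.
have X0 : 0 <= enorm x `^ (2 * m) by exact: powR_ge0.
have [xr|rx] := leP (enorm x) (Num.max r 0).
  apply: (@le_trans _ _ (e * (1 + `|B|))); last by rewrite lerDr mulr_ge0// ltW.
  rewrite ler_wpM2l// (le_trans (enorm_le_sqr _))// lerD2l.
  by rewrite (le_trans (ler_norm _))// (le_trans (HB x xr))// ler_norm.
move: rx; rewrite gt_max => /andP[rx x0].
have Xp : 0 < enorm x `^ (2 * m) by exact: powR_gt0.
have := Hr x rx; rewrite /= -ball_normE/= sub0r normrN => H.
have := le_lt_trans (ler_norm _) H; rewrite ltr_pdivrMr// => /ltW H'.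
by apply: (le_trans H'); rewrite lerDl mulr_ge0// addr_ge0.
Qed.

Lemma energy_lyapunov : exists C, forall z t,
  derive1 (V (lsubmx z)) t + energy_dissipation F V E a z t
   + 2^-1 * \tr (Sigma (lsubmx z) (rsubmx z) t *m (Sigma (lsubmx z) (rsubmx z) t)^T)
  <= C - dissipation_rate z.
Proof.
have [C1 HC1] := perturbation_bound.
exists (M + M1 + M2 / 2 + C1 + e ^+ 2 / (2 * d * a)) => z t.
rewrite /energy_dissipation /dissipation_rate -/d.
set x := lsubmx z; set y := rsubmx z.
have H1 := le_trans (ler_norm _) (Vt_bound x t).
have H2 := V_dissip x t.
have H3 := Sigma_bound x y t.
have H4 := HC1 x.
have H5 : - dotv (y + shear F a x) (E x y t) <= e * enorm y + e * enorm (shear F a x).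
  rewrite dotvDl opprD lerD//.
  - rewrite (le_trans (ler_norm _))// normrN (le_trans (cauchy_schwarz _ _))// mulrC.
    by rewrite ler_wpM2r ?enorm_ge0.
  - rewrite (le_trans (ler_norm _))// normrN (le_trans (cauchy_schwarz _ _))// mulrC.
    by rewrite ler_wpM2r ?enorm_ge0.
(* Young's inequality, with the weight that spends exactly half of the available [d * a * |y|^2]. *)
have H6 : e * enorm y <= d / 2 * (a * enorm y ^+ 2) + e ^+ 2 / (2 * d * a).
  rewrite -subr_ge0.
  have -> : d / 2 * (a * enorm y ^+ 2) + e ^+ 2 / (2 * d * a) - e * enorm y =
      (d * a * enorm y - e) ^+ 2 / (2 * d * a).
    by field; rewrite !gt_eqF.
  by rewrite divr_ge0 ?sqr_ge0// !mulr_ge0// ltW.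
rewrite -enorm_sqr -/(shear F a x) in H2 *.
(* The bound on [V_t] has no [y] part, so the coefficient of [a |y|^2] is better than that of
   [b |x|^(2m)] by [c1]; the surplus is dropped. *)
have H7 : 0 <= c1 * (a * enorm y ^+ 2).
  by apply: mulr_ge0; [exact: ltW|apply: mulr_ge0; [exact: ltW|exact: sqr_ge0]].
move: H1 H2 H3 H4 H5 H6 H7; rewrite /d.
set X := enorm x `^ (2 * m); set Y := enorm y ^+ 2.
move: (derive1 _ _) (dotv _ _) (dotv _ _) (\tr _) (e * enorm _) (e * enorm _) (e ^+ 2 / _).
move=> v1 v2 v3 v4 v5 v6 v7; lra.
Qed.

(** The kinetic term is non-negative, so a bound on the energy first confines [x], uniformly in [t].
    On that ball [shear] is bounded and the potential is bounded below, thanks to [Cv], which then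
    confines [y]. *)
Lemma energy_coercive (Cv : R) : (forall x t, Cv <= V x t) ->
  (forall A, \forall x \near @enorm_infty R n, forall t,
     A <= V x t + a * F x - a ^+ 2 / 2 * enorm x ^+ 2) ->
  forall A, exists r, forall z t, energy F V a z t <= A -> `|z| <= r.
Proof.
move=> V_lb V_coercive A.
(* [A + 1] instead of [A] makes the non-strict lower bound contradict an energy at most [A]. *)
have [r _ Hr] := V_coercive (A + 1).
have cF := C1_continuous F_C1.
have [B1 HB1] : exists B, forall x : 'rV[R]_n, enorm x <= r ->
    `|a * F x - a ^+ 2 / 2 * dotv x x| <= B.
  apply: continuous_bounded_ball => x.
  have cid : continuous (id : 'rV[R]_n -> 'rV[R]_n) by move=> ?; exact: cvg_id.
  apply: cvgB; first exact: nbhs_filter.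
    by apply: cvgM; [exact: nbhs_filter|exact: cst_continuous|exact: cF].
  apply: cvgM; [exact: nbhs_filter|exact: cst_continuous|exact: (continuous_dotv cid cid)].
have [B2 HB2] := continuous_bounded_ball r
  (continuous_dotv (continuous_shear (a := a) F_C1) (continuous_shear (a := a) F_C1)).
(* A coordinate of [y] is at most [|w| + |shear x|] with [w = y + shear x], hence at most
   [(1 + |w|^2) + (1 + B2)], and the energy bound gives [|w|^2 <= 2 * (A - Cv + B1)]. *)
exists (`|r| + `|2 + 2 * (A - Cv + B1) + B2|) => z t.
rewrite /energy; set x := lsubmx z; set y := rsubmx z => UA.
have w0 := dotvv_ge0 (y + shear F a x).
have xr : enorm x <= r.
  by rewrite leNgt; apply/negP => /Hr/(_ t); rewrite enorm_sqr; lra.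
have /ler_normlP[b1 b1'] := HB1 x xr.
have b2 := le_trans (ler_norm _) (HB2 x xr).
have lb := V_lb x t.
apply: norm_row_le => i; first exact: le_trans (coord_enorm _ _) xr.
have -> : rsubmx z 0 i = (y + shear F a x) 0 i - shear F a x 0 i.
  by rewrite [(y + _) 0 i]mxE addrK.
apply: le_trans (ler_normB _ _) _.
have h1 := le_trans (coord_enorm (y + shear F a x) i) (enorm_le_sqr _).
have h2 := le_trans (coord_enorm (shear F a x) i) (enorm_le_sqr _).
lra.
Qed.

End lyapunov_bounds.

Theorem theorem1p2 (R : realType) (n : nat) (T : R)
  (F : 'rV[R]_n -> R) (V : 'rV[R]_n -> R -> R)
  (E : 'rV[R]_n -> 'rV[R]_n -> R -> 'rV[R]_n)
  (Sigma : 'rV[R]_n -> 'rV[R]_n -> R -> 'M[R]_n)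
  (a b M m c1 c2 M1 M2 e : R)
  (n_ge1 : (1 <= n)%N) (T_gt0 : 0 < T)
  (a_gt0 : 0 < a) (b_gt0 : 0 < b) (M_gt0 : 0 < M) (m_gt0 : 0 < m)
  (c1_gt0 : 0 < c1) (c2_gt0 : 0 < c2) (M1_gt0 : 0 < M1) (M2_gt0 : 0 < M2)
  (c_lt1 : c1 + c2 < 1) (e_ge0 : 0 <= e)
  (* (1) *)
  (D2F_cont : continuous (hessian F))
  (D2F_lip : locally_lipschitz (fun x (_ : R) => hessian F x))
  (DV_cont : continuous (fun p : 'rV[R]_n * R => grad (V ^~ p.2) p.1))
  (DV_lip : locally_lipschitz (fun x t => grad (V ^~ t) x))
  (E_cont : continuous
     (fun p : 'rV[R]_n * 'rV[R]_n * R => E p.1.1 p.1.2 p.2))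
  (E_lip : locally_lipschitz (fun (z : 'rV[R]_n * 'rV[R]_n) t => E z.1 z.2 t))
  (Sigma_cont : continuous
     (fun p : 'rV[R]_n * 'rV[R]_n * R => Sigma p.1.1 p.1.2 p.2))
  (Sigma_lip : locally_lipschitz
     (fun (z : 'rV[R]_n * 'rV[R]_n) t => Sigma z.1 z.2 t))
  (F_C2 : C2 F) (V_C21 : C21_periodic T V)
  (E_per : forall x y t, E x y (t + T) = E x y t)
  (Sigma_per : forall x y t, Sigma x y (t + T) = Sigma x y t)
  (V_lb : exists C : R, forall x t, C <= V x t)
  (* (2) *)
  (V_coercive : forall A : R, \forall x \near @enorm_infty R n, forall t : R,
     A <= V x t + a * F x - a ^+ 2 / 2 * enorm x ^+ 2)
  (* (3) *)
  (V_dissip : forall x t,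
     - dotv (grad (V ^~ t) x) (grad F x - a *: x)
       <= M - b * enorm x `^ (2 * m))
  (* (4) *)
  (E_bound : forall x y t, enorm (E x y t) <= e)
  (E_small : e * enorm (grad F x - a *: x) / enorm x `^ (2 * m)
     @[x --> @enorm_infty R n] --> (0 : R))
  (* (5) *)
  (Vt_bound : forall x t,
     `|derive1 (V x) t| <= c1 * b * enorm x `^ (2 * m) + M1)
  (Sigma_bound : forall x y t,
     \tr (Sigma x y t *m (Sigma x y t)^T)
       <= 2 * c2 * (a * enorm y ^+ 2 + b * enorm x `^ (2 * m)) + M2) :
  exists mu : {measure set (borel R (n + n) * measurableTypeR R)%type
                 -> \bar R},
    periodic_probability_solution T (system_drift F V E)
      (system_diffusion Sigma) mu.
Proof.
have [Cv V_lb'] := V_lb.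
have [C HC] := energy_lyapunov a_gt0 b_gt0 c1_gt0 c_lt1 e_ge0 F_C2.1 V_dissip E_bound
  E_small Vt_bound Sigma_bound.
have [V21 V_per] := V_C21.
have D_per x t : grad (V ^~ (t + T)) x = grad (V ^~ t) x.
  by congr (grad _ x); apply/funext => x'; rewrite V_per.
apply: (@periodic_solution R (n + n) n (system_drift F V E) (system_diffusion Sigma) T
  (energy F V a) _ (dissipation_rate a b m c1 c2) C T_gt0).
- exact: continuous_system_drift.
- exact: continuous_system_diffusion.
- by move=> z t; rewrite /system_drift E_per D_per.
- by move=> z t; rewrite /system_diffusion Sigma_per.
- exact: energy_generator.
- exact: continuous_energy F_C2.1 V21.
- by move=> z; rewrite /energy -[T]add0r V_per.
- exact: (energy_coercive F_C2.1 V_lb').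
- exact: dissipation_rate_ge0.
- exact: dissipation_rate_coercive.
- exact: HC.
Qed.
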